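(* Let $N>1$, let the initial data $(f_\varepsilon^0,\{\xi_{\alpha,\varepsilon}^0,\eta_{\alpha,\varepsilon}^0\})_{0<\varepsilon<1}$ be an admissible family (see context), and let $(f_\varepsilon,\{\xi_{\alpha,\varepsilon}\})$ be the corresponding global weak solutions of $(\mathbf{E}^\varepsilon)$. Let $(\rho,\{\xi_\alpha\})$ be an accumulation point as $\varepsilon\to0$ of $(\rho_\varepsilon,\{\xi_{\alpha,\varepsilon}\})$, in the sense described in the context, which is a weak solution of the Euler equation $(\mathbf{E}^0_\nu)$ with defect measure $\nu$, and suppose that $\nu$ vanishes. If moreover $\rho\in L^\infty_{\rm loc}(\mathbb{R}_+,L^p(\mathbb{R}^2))$ for some $p>2$ and $\{\xi_\alpha\}\subset C^1(\mathbb{R}_+,\mathbb{R}^2)$, then $(\rho,\{\xi_\alpha\})$ satisfies the vortex-wave system $$\partial_t\rho+(E_\rho+F)^\perp\cdot\nabla\rho=0,\quad E_\rho=\frac{x}{|x|^2}*\rho,\qquad \dot\xi_\alpha(t)=\big(E_\rho(t,\xi_\alpha(t))+F(t,\xi_\alpha(t))\big)^\perp,\quad 1\le\alpha\le N,$$ in the distributional sense, where $F(t,x)=\sum_\alpha\frac{x-\xi_\alpha(t)}{|x-\xi_\alpha(t)|^2}$ for $x\notin\{\xi_\alpha(t)\}$ and $F(t,\xi_\alpha(t))=\sum_{\beta\ne\alpha}\frac{\xi_\alpha(t)-\xi_\beta(t)}{|\xi_\alpha(t)-\xi_\beta(t)|^2}$.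
   Context: Notation. $\mathbb{R}_+=[0,\infty)$; $(a_1,a_2)^\perp=(-a_2,a_1)$; indices $\alpha,\beta$ range over $1,\dots,N$; $A:B=\sum_{i,j}A_{ij}B_{ij}$. $\mathcal{M}$ (resp. $\mathcal{M}_+$) denotes bounded real (resp. nonnegative) Radon measures with weak-* topology $\sigma(\mathcal{M},C_0)$. $W^{-2,1}(\mathbb{R}^2)$ is normed by duality against $W^{2,\infty}$ test functions. System $(\mathbf{E}^\varepsilon)$, $0<\varepsilon<1$: $$\partial_tf_\varepsilon+\frac{v}{\varepsilon}\cdot\nabla_xf_\varepsilon+\Big(\frac{v^\perp}{\varepsilon^2}+\frac{E_\varepsilon+F_\varepsilon}{\varepsilon}\Big)\cdot\nabla_vf_\varepsilon=0,\quad E_\varepsilon=\frac{x}{|x|^2}*\rho_\varepsilon,\quad\rho_\varepsilon=\int_{\mathbb{R}^2}f_\varepsilon\,dv,$$ $$\dot\xi_{\alpha,\varepsilon}=\frac{\eta_{\alpha,\varepsilon}}{\varepsilon},\qquad\dot\eta_{\alpha,\varepsilon}=\frac{\eta_{\alpha,\varepsilon}^\perp}{\varepsilon^2}+\frac{E_\varepsilon(t,\xi_{\alpha,\varepsilon})+F_\varepsilon(t,\xi_{\alpha,\varepsilon})}{\varepsilon},$$ with initial data $(f_\varepsilon^0,\xi_{\alpha,\varepsilon}^0,\eta_{\alpha,\varepsilon}^0)$, where $F_\varepsilon(t,x)=\sum_\alpha\frac{x-\xi_{\alpha,\varepsilon}(t)}{|x-\xi_{\alpha,\varepsilon}(t)|^2}$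 for $x\notin\{\xi_{\alpha,\varepsilon}(t)\}$, $F_\varepsilon(t,\xi_{\alpha,\varepsilon}(t))=\sum_{\beta\ne\alpha}\frac{\xi_{\alpha,\varepsilon}(t)-\xi_{\beta,\varepsilon}(t)}{|\xi_{\alpha,\varepsilon}(t)-\xi_{\beta,\varepsilon}(t)|^2}$. Global weak solution: $(f_\varepsilon,\{\xi_{\alpha,\varepsilon}\})$ satisfying these equations in the distributional sense with $f_\varepsilon\ge0$, $f_\varepsilon\in L^\infty(\mathbb{R}_+,L^1\cap L^\infty(\mathbb{R}^4))$ and $\operatorname{supp}f_\varepsilon(t)\subset\{(x,v)\in B(0,R_\varepsilon(t)):\min_\alpha|x-\xi_{\alpha,\varepsilon}(t)|\ge\sigma_\varepsilon(t)\}$ for some $R_\varepsilon(t),\sigma_\varepsilon(t)>0$ continuous in time and depending only on the initial data (global well-posedness for each $\varepsilon$ is known). Energy: $\mathcal{E}(f,\{\xi_\alpha,\eta_\alpha\})=\frac12\iint|v|^2f\,dx\,dv+\frac12\sum_\alpha|\eta_\alpha|^2-\frac12\iint\ln|x-y|\rho(x)\rho(y)\,dx\,dy-\sum_\alpha\int\ln|x-\xi_\alpha|\rho(x)\,dx-\frac12\sum_{\alpha\ne\beta}\ln|\xi_\alpha-\xi_\beta|$ with $\rho=\int f\,dv$. Admissible family: $0\le f_\varepsilon^0\in L^1\cap L^\infty(\mathbb{R}^4)$; for each $0<\varepsilon<1$ there are $R_\varepsilon,\sigma_\varepsilon>0$ with $\operatorname{supp}f_\varepsilon^0\subset\{(x,v)\in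 B(0,R_\varepsilon):\min_\alpha|x-\xi_{\alpha,\varepsilon}^0|\ge\sigma_\varepsilon\}$; $K_0:=\sup_{0<\varepsilon<1}(\iint(1+|x|^2)f_\varepsilon^0\,dx\,dv+\sum_\alpha|\xi_{\alpha,\varepsilon}^0|)<\infty$; $K_1:=|\sup_{0<\varepsilon<1}\mathcal{E}(f_\varepsilon^0,\{\xi_{\alpha,\varepsilon}^0,\eta_{\alpha,\varepsilon}^0\})|<\infty$; $\lim_{\varepsilon\to0}\varepsilon^2\|f_\varepsilon^0\|_\infty=0$. Accumulation point: for some sequence $\varepsilon_n\to0$ and (any) $T>0$, $\rho_{\varepsilon_n}\to\rho$ weak-* in $L^\infty(\mathbb{R}_+,\mathcal{M}_+(\mathbb{R}^2))$ and $\xi_{\alpha,\varepsilon_n}\to\xi_\alpha$ in $C^r([0,T],\mathbb{R}^2)$ for all $r\in[0,1/4)$; $\rho\in L^\infty(\mathbb{R}_+,H^{-1})\cap C^{1/2}([0,T],W^{-2,1})$, $\xi_\alpha\in C^{1/2}([0,T],\mathbb{R}^2)$; $|\xi_\alpha(t)-\xi_\beta(t)|\ge M$ for all $t\ge0$, $\alpha\neq\beta$, with some $M>0$ depending only on $K_0,K_1$; and $(\rho,\sum_\alpha\delta_{\xi_\alpha})$ is a weak solution of $(\mathbf{E}^0_\nu)$ with $\nu=\int_{\mathbb{S}^1}\omega^\perp\otimes\omega\,\mu_0(t,x,d\omega)+\sum_\alpha\mathbf{M}^\alpha(t)\delta_{\xi_\alpha(t)}$ for some $\mu_0\in L^\infty(\mathbb{R}_+,\mathcal{M}_+(\mathbb{R}^2\times\mathbb{S}^1))$,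 $\mathbf{M}^\alpha\in L^\infty(\mathbb{R}_+,\mathbb{R}^{2\times2})$. (Existence of such accumulation points is the paper's main theorem.) Weak solution of $(\mathbf{E}^0_\nu)$ with $\bar\delta(t)=\sum_\alpha\delta_{\xi_\alpha(t)}$: $\rho,\bar\delta\in L^\infty(\mathbb{R}_+,\mathcal{M}_+(\mathbb{R}^2))$, $\nu\in L^\infty(\mathbb{R}_+,\mathcal{M}(\mathbb{R}^2,\mathbb{R}^{2\times2}))$, and for all $\Phi\in C_c^\infty(\mathbb{R}_+\times\mathbb{R}^2)$ and times $t$, $$\int\Phi(t,x)(\rho+\bar\delta)(t,dx)-\int\Phi(0,x)(\rho+\bar\delta)(0,dx)=\int_0^t\!\!\int\partial_t\Phi(\rho+\bar\delta)(s,dx)\,ds+\int_0^t\mathcal{H}_{\Phi(s)}[(\rho+\bar\delta)(s),(\rho+\bar\delta)(s)]\,ds+\int_0^t\!\!\int\nabla_x^2\Phi:\nu(s,dx)\,ds,$$ where $\mathcal{H}_\Phi[\rho,\mu]=\frac12\iint H_\Phi(x,y)\rho(dx)\mu(dy)$, $H_\Phi(x,y)=\frac{(x-y)^\perp}{|x-y|^2}\cdot(\nabla\Phi(x)-\nabla\Phi(y))$ for $x\ne y$, $H_\Phi(x,x)=0$. The first equation of the vortex-wave system in the distributional sense means $\partial_t\rho+\nabla\cdot((E_\rho+F)^\perp\rho)=0$ in distributions (the field $(E_\rho+F)^\perp$ being divergence free). *)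

(* Defs.v *)
From HB Require Import structures.
From mathcomp Require Import all_boot all_order all_algebra.
From mathcomp Require Import all_classical all_reals all_analysis.

Set Implicit Arguments.
Unset Strict Implicit.
Unset Printing Implicit Defensive.

Import Order.TTheory GRing.Theory Num.Theory.
Import numFieldNormedType.Exports.

Local Open Scope classical_set_scope.
Local Open Scope ring_scope.

(* [plane R] carries the normed structure (its own norm is the sup norm, so the
   Euclidean norm is [eucl] below); [mplane R] is the same type with the Borel
   sigma-algebra for which Lebesgue measure is defined.  [phase] is R^2 x R^2,
   with elements (x, v). *)
Notation plane R := (R * R)%type.
Notation mplane R := (measurableTypeR R * measurableTypeR R)%type.
Notation phase R := (plane R * plane R)%type.
Notation mphase R := (mplane R * mplane R)%type.

Section lebesgue_measures.
Context {R : realType}.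

Definition leb2 : set (mplane R) -> \bar R :=
  (@lebesgue_measure R \x @lebesgue_measure R)%E.

HB.instance Definition _ := Measure.on leb2.

Lemma leb2_sigma_finite : sigma_finite setT leb2.
Proof.
have /sigma_finiteP[F [TF ndF Foo]] := sigma_finiteT (@lebesgue_measure R).
exists (fun n => F n `*` F n).
  rewrite -setXTT [in LHS]TF predeqE => -[x y]; split.
    move=> [/= [n _ Fnx] [k _ Gky]]; exists (maxn n k) => //; split.
    - by move: x Fnx; exact/subsetPset/ndF/leq_maxl.
    - by move: y Gky; exact/subsetPset/ndF/leq_maxr.
  by move=> [n _ []/= ? ?]; split; exists n.
move=> k; have [? ?] := Foo k.
split; first exact: measurableX.
by rewrite /leb2 product_measure1E// lte_mul_pinfty// ge0_fin_numE.
Qed.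

HB.instance Definition _ :=
  @Measure_isSigmaFinite.Build _ (mplane R) R leb2 leb2_sigma_finite.

Definition leb4 : set (mphase R) -> \bar R := (leb2 \x leb2)%E.

HB.instance Definition _ := Measure.on leb4.

End lebesgue_measures.

Section plane_geometry.
Context {R : realType}.
Implicit Types x y : plane R.

Definition dot x y : R := x.1 * y.1 + x.2 * y.2.
Definition eucl x : R := Num.sqrt (dot x x).
Definition perp x : plane R := (- x.2, x.1).
Definition coord (i : 'I_2) x : R := if i == ord0 then x.1 else x.2.
Definition basis (i : 'I_2) : plane R := if i == ord0 then (1, 0) else (0, 1).

(* x / |x|^2, with value 0 at x = 0. *)
Definition kernelK x : plane R := (dot x x)^-1 *: x.

Definition grad (f : plane R -> R) x : plane R :=
  ('D_(basis ord0) f x, 'D_(basis ord_max) f x).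

End plane_geometry.

Section test_functions.
Context {R : realType}.
Variable V : normedModType R.

Definition iterD (vs : seq V) (f : V -> R) : V -> R :=
  foldr (fun v g => 'D_v g) f vs.

Definition smooth (f : V -> R) : Prop :=
  forall (vs : seq V) (x : V), differentiable (iterD vs f) x.

(* C_c^oo(U).  Test functions in C_c^oo(R_+ x ...) are the restrictions to
   t >= 0 of elements of [test_function setT]. *)
Definition test_function (U : set V) : set (V -> R) :=
  [set f | [/\ smooth f, compact (closure [set x | f x != 0])
             & closure [set x | f x != 0] `<=` U]].

Definition C0 : set (V -> R) :=
  [set f | continuous f /\
    forall e, 0 < e -> exists2 K, compact K & forall x, ~ K x -> `|f x| < e].

End test_functions.
Arguments test_function {R V} U.

Section time_dependent_measures.
Context {R : realType}.
Local Notation leb := (@lebesgue_measure R).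

Definition ess_bounded_on (D : set R) (g : R -> \bar R) : Prop :=
  exists C : R, {ae leb, forall t, D t -> (g t <= C%:E)%E}.

(* L^oo(R_+, M_+(T)): weak-* measurable (tests is the space C_0 of T) and with
   essentially bounded total mass. *)
Definition Linf_measures d (T : measurableType d) (tests : set (T -> R))
    (mu : R -> {finite_measure set T -> \bar R}) : Prop :=
  (forall phi, tests phi ->
     measurable_fun (`[0, +oo[ : set R) (fun t => \int[mu t]_x phi x)) /\
  ess_bounded_on `[0, +oo[ (fun t => mu t setT).

Section charges.
Context d (T : measurableType d).
Implicit Type nu : {charge set T -> \bar R}.

Definition hahn_pos nu : set T := sval (cid (Hahn_decomposition nu)).
Definition hahn_neg nu : set T :=
  sval (cid (svalP (cid (Hahn_decomposition nu)))).
Definition hahn_posneg nu :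
    hahn_decomposition nu (hahn_pos nu) (hahn_neg nu) :=
  svalP (cid (svalP (cid (Hahn_decomposition nu)))).

Definition charge_integral nu (phi : T -> R) : R :=
  \int[jordan_pos (hahn_posneg nu)]_x phi x -
  \int[jordan_neg (hahn_posneg nu)]_x phi x.

Definition total_variation nu : \bar R :=
  charge_variation (hahn_posneg nu) setT.

Definition Linf_charges (tests : set (T -> R))
    (nu : R -> {charge set T -> \bar R}) : Prop :=
  (forall phi, tests phi ->
     measurable_fun (`[0, +oo[ : set R) (fun t => charge_integral (nu t) phi)) /\
  ess_bounded_on `[0, +oo[ (fun t => total_variation (nu t)).

End charges.

Definition finite_add d (T : measurableType d)
    (m1 m2 : {finite_measure set T -> \bar R}) : set T -> \bar R :=
  measure_add m1 m2.

HB.instance Definition _ d (T : measurableType d)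
    (m1 m2 : {finite_measure set T -> \bar R}) :=
  Measure.on (finite_add m1 m2).

Lemma finite_add_fin d (T : measurableType d)
    (m1 m2 : {finite_measure set T -> \bar R}) :
  fin_num_fun (finite_add m1 m2).
Proof.
by move=> A mA; rewrite /finite_add measure_addE fin_numD !fin_num_measure.
Qed.

HB.instance Definition _ d (T : measurableType d)
    (m1 m2 : {finite_measure set T -> \bar R}) :=
  Measure_isFinite.Build _ _ _ (finite_add m1 m2) (finite_add_fin m1 m2).

Definition dirac_nth N (z : 'I_N -> plane R) (k : nat) :
    {measure set (mplane R) -> \bar R} :=
  if insub k is Some a then \d_(z a : mplane R) else mzero.

Definition sum_dirac N (z : 'I_N -> plane R) : set (mplane R) -> \bar R :=
  msum (dirac_nth z) N.

HB.instance Definition _ N (z : 'I_N -> plane R) := Measure.on (sum_dirac z).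

Lemma sum_diracE N (z : 'I_N -> plane R) (A : set (mplane R)) :
  sum_dirac z A = (\sum_(a < N) \d_(z a : mplane R) A)%E.
Proof.
by rewrite /sum_dirac /msum; apply: eq_bigr => a _; rewrite /dirac_nth valK.
Qed.

Lemma sum_dirac_fin N (z : 'I_N -> plane R) : fin_num_fun (sum_dirac z).
Proof.
by move=> A mA; rewrite sum_diracE; apply/sum_fin_numP => a _ _; rewrite diracE.
Qed.

HB.instance Definition _ N (z : 'I_N -> plane R) :=
  Measure_isFinite.Build _ _ _ (sum_dirac z) (sum_dirac_fin z).

End time_dependent_measures.

Section function_spaces.
Context {R : realType}.
Local Notation leb := (@lebesgue_measure R).

Definition dual_norm (B : set (plane R -> R)) (L : (plane R -> R) -> R)
    : \bar R :=
  ereal_sup [set `|L phi|%:E | phi in B].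

Definition H1_ball : set (plane R -> R) :=
  [set phi | test_function setT phi /\
     \int[leb2]_x (phi x ^+ 2 + dot (grad phi x) (grad phi x)) <= 1].

Definition weak_partial (i : 'I_2) (f g : plane R -> R) : Prop :=
  forall chi : plane R -> R, test_function setT chi ->
    \int[leb2]_x (f x * 'D_(basis i) chi x) = - \int[leb2]_x (g x * chi x).

Definition Linf_le1 (f : plane R -> R) : Prop :=
  measurable_fun (setT : set (mplane R)) f /\
  ('N[leb2]_(+oo)[EFin \o f] <= 1)%E.

(* Unit ball of W^{2,oo}(R^2); the continuous representative is the one that is
   integrated against measures. *)
Definition W2inf_ball : set (plane R -> R) :=
  [set phi | [/\ continuous phi, Linf_le1 phi &
    exists (g : 'I_2 -> plane R -> R) (h : 'I_2 -> 'I_2 -> plane R -> R),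
      forall i, [/\ weak_partial i phi (g i), Linf_le1 (g i) &
        forall j, weak_partial j (g i) (h i j) /\ Linf_le1 (h i j)]]].

Definition Hm1_norm (L : (plane R -> R) -> R) : \bar R := dual_norm H1_ball L.
Definition Wm21_norm (L : (plane R -> R) -> R) : \bar R :=
  dual_norm W2inf_ball L.

(* Norm of C^r([0,T]) for a curve u in a normed space, with [n t] = ||u t|| and
   [d t s] = ||u t - u s||. *)
Definition holder_norm (r T : R) (n : R -> \bar R) (d : R -> R -> \bar R)
    : \bar R :=
  (ereal_sup (n @` `[0%R, T]) +
   ereal_sup [set d ts.1 ts.2 * ((`|ts.1 - ts.2| `^ r)^-1)%R%:E |
     ts in [set ts : R * R | [/\ 0 <= ts.1 <= T, 0 <= ts.2 <= T
                              & ts.1 != ts.2]%R]])%E.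

Definition curve_holder_norm (r T : R) (u : R -> plane R) : \bar R :=
  holder_norm r T (fun t => (eucl (u t))%:E) (fun t s => (eucl (u t - u s))%:E).

Definition measure_holder_norm (r T : R)
    (mu : R -> {finite_measure set (mplane R) -> \bar R}) : \bar R :=
  holder_norm r T
    (fun t => Wm21_norm (fun phi => \int[mu t]_x phi x))
    (fun t s => Wm21_norm (fun phi => \int[mu t]_x phi x - \int[mu s]_x phi x)).

Definition L1_C0 (psi : R -> plane R -> R) : Prop :=
  [/\ measurable_fun ((`[0, +oo[ : set R) `*` setT)
        (fun z : measurableTypeR R * mplane R => psi z.1 z.2),
      forall t, 0 <= t -> C0 (psi t) &
      (\int[leb]_(t in `[0%R, +oo[)
         ereal_sup (range (fun x => `|psi t x|%:E)) < +oo)%E].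

Definition Linf_loc_Lp (p : \bar R)
    (rho : R -> {finite_measure set (mplane R) -> \bar R}) : Prop :=
  forall T : R, 0 < T -> exists C : R,
    {ae leb, forall t, t \in `[0, T] -> exists g : plane R -> R,
      [/\ measurable_fun (setT : set (mplane R)) g, forall x, 0 <= g x,
          forall A : set (mplane R), measurable A ->
            rho t A = (\int[leb2]_(x in A) (g x)%:E)%E &
          ('N[leb2]_p[EFin \o g] <= C%:E)%E]}.

Definition C1_halfline (u : R -> plane R) : Prop :=
  {within `[0, +oo[, continuous u} /\
  exists2 w : R -> plane R, {within `[0, +oo[, continuous w} &
    forall t : R, 0 < t -> is_derive t 1 u (w t).

End function_spaces.

Section fields.
Context {R : realType}.

(* Convolution of x/|x|^2 with the measure whose integration functional is L. *)
Definition convK (L : (plane R -> R) -> R) (x : plane R) : plane R :=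
  (L (fun y => coord ord0 (kernelK (x - y))),
   L (fun y => coord ord_max (kernelK (x - y)))).

Definition Efield_density (rho : plane R -> R) : plane R -> plane R :=
  convK (fun g => \int[leb2]_y (g y * rho y)).

Definition Efield (mu : {finite_measure set (mplane R) -> \bar R})
    : plane R -> plane R :=
  convK (fun g => \int[mu]_y g y).

(* Both cases of the definition of F: the filter is void off the points z b,
   and at x = z a it leaves out b = a (the points being distinct). *)
Definition Ffield N (z : 'I_N -> plane R) (x : plane R) : plane R :=
  \sum_(b < N | z b != x) kernelK (x - z b).

End fields.

Section vlasov_poisson.
Context {R : realType} (N : nat).
Local Notation leb := (@lebesgue_measure R).

Definition density (f : phase R -> R) (x : plane R) : R :=
  \int[leb2]_v f (x, v).

Definition ess_support (f : phase R -> R) : set (phase R) :=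
  [set z | forall U : set (phase R), open U -> U z ->
     ~ leb4.-negligible (U `&` [set w | f w != 0])].

Definition away_from (r s : R) (xi : 'I_N -> plane R) : set (phase R) :=
  [set z | Num.sqrt (dot z.1 z.1 + dot z.2 z.2) < r /\
           forall a, s <= eucl (z.1 - xi a)].

(* [lne 0 = -oo], so that the energy is +oo when two point charges coincide. *)
Definition energy (f : phase R -> R) (xi eta : 'I_N -> plane R) : \bar R :=
  ((2^-1)%:E * \int[leb4]_z (dot z.2 z.2 * f z)%:E
   + (2^-1 * \sum_(a < N) dot (eta a) (eta a))%:E
   - (2^-1)%:E * \int[leb4]_z
       (lne (eucl (z.1 - z.2))%:E * (density f z.1 * density f z.2)%:E)
   - \sum_(a < N) \int[leb2]_x (lne (eucl (x - xi a))%:E * (density f x)%:E)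
   - (2^-1)%:E * \sum_(a < N) \sum_(b < N | b != a)
       lne (eucl (xi a - xi b))%:E)%E.

Definition K0 (f0 : R -> phase R -> R) (xi0 : R -> 'I_N -> plane R) : \bar R :=
  ereal_sup [set (\int[leb4]_z ((1 + dot z.1 z.1) * f0 eps z)%:E
                  + (\sum_(a < N) eucl (xi0 eps a))%:E)%E
            | eps in `]0%R, 1%R[].

Definition K1 (f0 : R -> phase R -> R) (xi0 eta0 : R -> 'I_N -> plane R)
    : \bar R :=
  `| ereal_sup [set energy (f0 eps) (xi0 eps) (eta0 eps)
               | eps in `]0%R, 1%R[] |%E.

Definition admissible_family (f0 : R -> phase R -> R)
    (xi0 eta0 : R -> 'I_N -> plane R) : Prop :=
  [/\ forall eps, 0 < eps < 1 ->
        [/\ {ae leb4, forall z, 0 <= f0 eps z},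
            leb4.-integrable setT (EFin \o f0 eps),
            ('N[leb4]_(+oo)[EFin \o f0 eps] < +oo)%E &
            exists r s : R, [/\ 0 < r, 0 < s &
              ess_support (f0 eps) `<=` away_from r s (xi0 eps)]],
      (K0 f0 xi0 < +oo)%E,
      (K1 f0 xi0 eta0 < +oo)%E &
      ((eps ^+ 2)%:E * 'N[leb4]_(+oo)[EFin \o f0 eps])%E
        @[eps --> 0^'+] --> 0%E].

(* u' = w and u(0) = u0, tested against C_c^oo(R_+). *)
Definition ode_distributional (u w : R -> plane R) (u0 : plane R) : Prop :=
  forall (i : 'I_2) (theta : R -> R), test_function setT theta ->
    \int[leb]_(t in `[0, +oo[) (coord i (u t) * 'D_1 theta t)
    + \int[leb]_(t in `[0, +oo[) (coord i (w t) * theta t)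
    + coord i u0 * theta 0 = 0.

Definition total_field (f : R -> phase R -> R) (xi : 'I_N -> R -> plane R)
    (t : R) (x : plane R) : plane R :=
  Efield_density (density (f t)) x + Ffield (xi^~ t) x.

(* The transport field is divergence free in (x, v). *)
Definition vlasov_distributional (eps : R) (f0 : phase R -> R)
    (f : R -> phase R -> R) (xi : 'I_N -> R -> plane R) : Prop :=
  forall phi : R * phase R -> R, test_function setT phi ->
    \int[leb]_(t in `[0, +oo[) \int[leb4]_z (f t z *
      ('D_(1, 0) phi (t, z)
       + eps^-1 * dot z.2 (grad (fun x => phi (t, (x, z.2))) z.1)
       + dot ((eps ^+ 2)^-1 *: perp z.2 + eps^-1 *: total_field f xi t z.1)
             (grad (fun v => phi (t, (z.1, v))) z.2)))
    + \int[leb4]_z (f0 z * phi (0, z)) = 0.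

Definition global_weak_solution (eps : R) (f0 : phase R -> R)
    (xi0 eta0 : 'I_N -> plane R) (f : R -> phase R -> R)
    (xi eta : 'I_N -> R -> plane R) : Prop :=
  [/\ measurable_fun ((`[0, +oo[ : set R) `*` setT)
        (fun z : measurableTypeR R * mphase R => f z.1 z.2),
      {ae leb, forall t, 0 <= t -> {ae leb4, forall z, 0 <= f t z}},
      ess_bounded_on `[0, +oo[ (fun t =>
        'N[leb4]_1[EFin \o f t] + 'N[leb4]_(+oo)[EFin \o f t])%E,
      exists r s : R -> R,
        [/\ {within `[0, +oo[, continuous r},
            {within `[0, +oo[, continuous s},
            forall t, 0 <= t -> 0 < r t /\ 0 < s t &
            {ae leb, forall t, 0 <= t ->
               ess_support (f t) `<=` away_from (r t) (s t) (xi^~ t)}] &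
      [/\ forall a, {within `[0, +oo[, continuous (xi a)},
          forall a, {within `[0, +oo[, continuous (eta a)},
          vlasov_distributional eps f0 f xi,
          forall a, ode_distributional (xi a)
            (fun t => eps^-1 *: eta a t) (xi0 a) &
          forall a, ode_distributional (eta a)
            (fun t => (eps ^+ 2)^-1 *: perp (eta a t)
                      + eps^-1 *: total_field f xi t (xi a t)) (eta0 a)]].

End vlasov_poisson.

Section euler_with_defect.
Context {R : realType}.
Local Notation leb := (@lebesgue_measure R).
Implicit Types rho delta : R -> {finite_measure set (mplane R) -> \bar R}.

Definition H_kernel (Phi : plane R -> R) (x y : plane R) : R :=
  if x == y then 0
  else dot ((dot (x - y) (x - y))^-1 *: perp (x - y)) (grad Phi x - grad Phi y).

Definition H_form (Phi : plane R -> R)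
    (rho mu : {finite_measure set (mplane R) -> \bar R}) : R :=
  2^-1 * \int[mu]_y \int[rho]_x H_kernel Phi x y.

Definition C0_plane : set (mplane R -> R) := @C0 R (plane R).
Definition C0_phase : set (mphase R -> R) := @C0 R (phase R).

(* A 2x2 matrix of finite signed measures. *)
Definition matrix_charge := 'I_2 -> 'I_2 -> {charge set (mplane R) -> \bar R}.

Definition hessian_integral (Phi : plane R -> R) (nu : matrix_charge) : R :=
  \sum_(i < 2) \sum_(j < 2)
    charge_integral (nu i j) ('D_(basis i) ('D_(basis j) Phi)).

Definition euler_defect_weak_solution rho delta (nu : R -> matrix_charge)
    : Prop :=
  [/\ Linf_measures C0_plane rho,
      Linf_measures C0_plane delta,
      forall i j, Linf_charges C0_plane (fun t => nu t i j) &
      forall Phi : R * plane R -> R, test_function setT Phi ->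
      forall t, 0 <= t ->
        let tot s := finite_add (rho s) (delta s) in
        \int[tot t]_x Phi (t, x) - \int[tot 0]_x Phi (0, x) =
        \int[leb]_(s in `[0, t]) \int[tot s]_x 'D_(1, 0) Phi (s, x)
        + \int[leb]_(s in `[0, t])
            H_form (fun x => Phi (s, x)) (tot s) (tot s)
        + \int[leb]_(s in `[0, t])
            hessian_integral (fun x => Phi (s, x)) (nu s)].

(* nu = int_{S^1} omega^perp (x) omega mu0(t,x,d omega)
        + sum_a M^a(t) delta_{xi_a(t)},
   where mu0 t is a measure on R^2 x R^2 carried by R^2 x S^1. *)
Definition defect_structure N (xi : 'I_N -> R -> plane R)
    (nu : R -> matrix_charge) : Prop :=
  exists (mu0 : R -> {finite_measure set (mphase R) -> \bar R})
         (M : 'I_N -> R -> 'M[R]_2),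
    [/\ Linf_measures C0_phase mu0,
        forall t, 0 <= t -> mu0 t [set z | dot z.2 z.2 != 1] = 0%E,
        forall a i j,
          measurable_fun (`[0, +oo[ : set R) (fun t => M a t i j) /\
          ess_bounded_on `[0, +oo[ (fun t => `|M a t i j|%:E) &
        {ae leb, forall t, 0 <= t ->
          forall i j (A : set (mplane R)), measurable A ->
          nu t i j A =
            (\int[mu0 t]_(z in A `*` setT)
                 (coord i (perp z.2) * coord j z.2)%:E
             + \sum_(a < N) (M a t i j)%:E * \d_(xi a t : mplane R) A)%E}].

Definition defect_vanishes (nu : R -> matrix_charge) : Prop :=
  {ae leb, forall t, 0 <= t ->
     forall i j (A : set (mplane R)), measurable A -> nu t i j A = 0%E}.

Definition accumulation_point N (f : R -> R -> phase R -> R)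
    (xie : R -> 'I_N -> R -> plane R)
    rho (xi : 'I_N -> R -> plane R) (nu : R -> matrix_charge) : Prop :=
  exists epsn : nat -> R,
    [/\ forall n, 0 < epsn n < 1,
        epsn @ \oo --> (0 : R),
        forall psi : R -> plane R -> R, L1_C0 psi ->
          (\int[leb]_(t in `[0, +oo[) \int[leb2]_x
             (psi t x * density (f (epsn n) t) x)) @[n --> \oo] -->
          \int[leb]_(t in `[0, +oo[) \int[rho t]_x psi t x,
        forall T r : R, 0 < T -> 0 <= r < 4^-1 -> forall a,
          curve_holder_norm r T (fun t => xie (epsn n) a t - xi a t)
            @[n --> \oo] --> 0%E &
        [/\ ess_bounded_on `[0, +oo[
              (fun t => Hm1_norm (fun phi => \int[rho t]_x phi x)),
            forall T : R, 0 < T ->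
              (measure_holder_norm 2^-1 T rho < +oo)%E /\
              (forall a, curve_holder_norm 2^-1 T (xi a) < +oo)%E,
            exists2 m : R, 0 < m & forall t a b, 0 <= t -> a != b ->
              m <= eucl (xi a t - xi b t),
            euler_defect_weak_solution rho
              (fun t => sum_dirac (xi^~ t)) nu &
            defect_structure xi nu]].

End euler_with_defect.

Section vortex_wave.
Context {R : realType} (N : nat).
Local Notation leb := (@lebesgue_measure R).
Variables (rho : R -> {finite_measure set (mplane R) -> \bar R})
          (xi : 'I_N -> R -> plane R).

Definition vw_velocity (t : R) (x : plane R) : plane R :=
  perp (Efield (rho t) x + Ffield (xi^~ t) x).

(* The singular integrals defining the velocity converge, and the flux and the
   velocities of the points are locally integrable: without this the
   distributional formulation below would not be meaningful. *)
Definition vw_well_defined : Prop :=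
  [/\ {ae leb, forall t, 0 <= t -> forall (x : plane R) (i : 'I_2),
         (rho t).-integrable setT (fun y => (coord i (kernelK (x - y)))%:E)},
      {ae leb, forall t, 0 <= t -> forall i : 'I_2,
         (rho t).-integrable setT (fun x => (coord i (vw_velocity t x))%:E)},
      forall (T : R) (i : 'I_2), 0 < T ->
        leb.-integrable `[0, T]
          (fun t => \int[rho t]_x `|coord i (vw_velocity t x)|%:E)%E &
      forall (T : R) (a : 'I_N) (i : 'I_2), 0 < T ->
        leb.-integrable `[0, T]
          (fun t => (coord i (vw_velocity t (xi a t)))%:E)].

Definition vortex_wave_system : Prop :=
  [/\ vw_well_defined,
      forall Phi : R * plane R -> R, test_function [set z : R * plane R | 0 < z.1] Phi ->
        \int[leb]_(t in `[0, +oo[) \int[rho t]_x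
          ('D_(1, 0) Phi (t, x)
           + dot (vw_velocity t x) (grad (fun y => Phi (t, y)) x)) = 0 &
      forall (a : 'I_N) (i : 'I_2) (theta : R -> R),
        test_function [set t : R | 0 < t] theta ->
        \int[leb]_(t in `[0, +oo[) (coord i (xi a t) * 'D_1 theta t) =
        - \int[leb]_(t in `[0, +oo[)
            (coord i (vw_velocity t (xi a t)) * theta t)].

End vortex_wave.

(* Main.v *)
From HB Require Import structures.
Require Import Defs.
From mathcomp Require Import all_boot all_order all_algebra.
From mathcomp Require Import all_classical all_reals all_analysis.
From mathcomp Require Import measurable_realfun.
From mathcomp Require Import ring lra.
Import Defs.
Import Order.TTheory GRing.Theory Num.Theory.
Import numFieldNormedType.Exports.
Local Open Scope classical_set_scope.
Local Open Scope ring_scope.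

(** Testing the limit equation with a test function yields
      int rho (dt Phi + V . grad Phi) + sum_a (dt Phi + V . grad Phi)(t, xi_a) = 0
    integrated in time, where V = (E_rho + F)^perp: symmetrizing H_Phi turns the
    quadratic term into the velocity field, the kernel being odd.  Hence the
    flux equation for rho holds up to the terms g_a . grad Phi(t, xi_a), where
    g_a = V(t, xi_a) - xi_a' is the slip of the a-th point.  At a Lebesgue point
    of g_a, take for Phi a coordinate function cut off at scale d in space and
    proportional to d in time around (t, xi_a(t)).  The contribution of rho is
    then controlled by the mass of rho and the integral of |V| over a box of
    side of order d; since rho is in L^p with p > 2, box masses are O(d^(1+s)),
    s > 0, and both tend to 0.  So g_a = 0 almost everywhere, which gives both
    equations of the vortex-wave system. *)

(** The scaling of the test function is what lets the slip outweigh the flux. It has height d, so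
    its spatial gradient stays of order 1 as d tends to 0; it lives for a time of order d, so its
    time derivative stays of order 1 too. After division by this lifetime the slip survives
    unchanged. By Hoelder a box of side d has mass O(d^(2 - 2/p)); the kernel 1/|x| costs one power
    of d, and 1 - 2/p > 0 says exactly p > 2. In the code d runs through powers of 1/2, and the
    decay d^(1+s) is written (theta/2)^m with theta < 1. The box cannot follow the point, because a
    trajectory that is only C^1 may not enter a smooth test function. Hence the lifetime is a small
    multiple of d, chosen from the local speed, during which the point stays where the cut-off is
    flat. The other obstacle is measurability: the weak-* hypothesis speaks of integrals of C_0
    functions only, while the velocity integrates a singular kernel. So masses of Borel sets are
    shown to be measurable in time, and then integrals of jointly measurable functions. *)

(** * Integrals against a measurable family of finite measures *)

Section measurable_families.
Context d d' (X : measurableType d) (Y : measurableType d') (R : realType).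
Variable l : X -> {finite_measure set Y -> \bar R}.
Hypothesis ml : forall A, measurable A -> measurable_fun setT (l ^~ A).

Let k x : {measure set Y -> \bar R} := l x.

Import HBNNSimple.

HB.instance Definition _ := isKernel.Build _ _ X Y R k ml.

Let measurable_xsection_family (A : set (X * Y)) : measurable A ->
  measurable_fun setT (fun x => k x (xsection A x)).
Proof.
move=> mA; rewrite (_ : (fun x => _) =
    (fun x => mrestr (k x) measurableT (xsection A x))); last first.
  by apply/funext => x; rewrite /mrestr setIT.
have [|//] := @measurable_prod_subset_xsection_kernel _ _ X Y R k setT
  measurableT _ A mA.
(* The bound has to be strict, hence the added 1. *)
move=> x; exists (fine (l x setT) + 1) => B mB.
rewrite /mrestr setIT (@le_lt_trans _ _ (l x setT))//.
  by apply: le_measure; rewrite ?inE.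
rewrite -[ltLHS]fineK ?fin_num_measure// lte_fin ltrDl//.
Qed.

Let ge0_measurable_integral_family (f : X * Y -> \bar R) :
  measurable_fun setT f -> (forall z, 0 <= f z)%E ->
  measurable_fun setT (fun x => \int[k x]_y f (x, y))%E.
Proof.
move=> mf f0; pose f_ := nnsfun_approx measurableT mf.
apply: (measurable_fun_xsection_integral _ _ f_).
- by move=> a b ab; exact/nd_nnsfun_approx.
- by move=> z; exact/cvg_nnsfun_approx.
- by move=> n r; apply: measurable_xsection_family; exact: measurable_funPTI.
Qed.

(** The integral is by definition the difference of those of the positive and negative parts; each
    is measurable by approximation with simple functions. *)
Lemma measurable_integral_family (f : X * Y -> \bar R) :
  measurable_fun setT f ->
  measurable_fun setT (fun x => \int[l x]_y f (x, y))%E.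
Proof.
move=> mf; under eq_fun do rewrite integralE.
apply: emeasurable_funB.
- rewrite (_ : (fun x => _) = (fun x => \int[k x]_y f^\+%E (x, y))%E).
    apply: ge0_measurable_integral_family; first exact: measurable_funepos.
    by move=> ?; exact: funepos_ge0.
  by apply/funext => x; apply: eq_integral => y _; rewrite !funeposE.
- rewrite (_ : (fun x => _) = (fun x => \int[k x]_y f^\-%E (x, y))%E).
    apply: ge0_measurable_integral_family; first exact: measurable_funeneg.
    by move=> ?; exact: funeneg_ge0.
  by apply/funext => x; apply: eq_integral => y _; rewrite !funenegE.
Qed.

Lemma measurable_Rintegral_family (f : X * Y -> R) :
  measurable_fun setT f ->
  measurable_fun setT (fun x => \int[l x]_y f (x, y)).
Proof.
move=> mf; apply: measurableT_comp => //.
by apply: (measurable_integral_family (EFin \o f)); exact/measurable_EFinP.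
Qed.

End measurable_families.

(** * Open boxes as a generating pi-system of the Borel sets of the plane *)

Section open_boxes.
Context {R : realType}.

Definition open_box (a b c d : R) : set (mplane R) :=
  [set x | (a < x.1 < b) && (c < x.2 < d)].

Definition open_boxes : set (set (mplane R)) :=
  [set A | exists a b c d, A = open_box a b c d].

Lemma open_boxE a b c d : open_box a b c d = `]a, b[ `*` `]c, d[.
Proof.
apply/seteqP; split => -[x y] /=; rewrite !in_itv/= ?/open_box/=.
  by move/andP.
by move=> [-> ->].
Qed.

Lemma setI_closed_open_boxes : setI_closed open_boxes.
Proof.
move=> _ _ [a [b [c [d ->]]]] [a' [b' [c' [d' ->]]]].
exists (Num.max a a'), (Num.min b b'), (Num.max c c'), (Num.min d d').
apply/seteqP; split => -[x y]; rewrite /open_box/= !gt_max !lt_min.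
  by move=> [/andP[/andP[-> ->] /andP[-> ->]] /andP[/andP[-> ->] /andP[-> ->]]].
by move=> /andP[/andP[/andP[-> ->] /andP[-> ->]] /andP[/andP[-> ->] /andP[-> ->]]].
Qed.

Lemma exists_natr_itv (x : R) : exists n, forall m, (n <= m)%N ->
  - (m%:R : R) < x < m%:R.
Proof.
exists (Num.truncn `|x|).+1 => m nm; rewrite -ltr_norml.
rewrite (lt_le_trans (truncnS_gt _))// ler_nat//.
Qed.

Lemma bigcup_open_box_l (a b : R) :
  \bigcup_n open_box a b (- n%:R) n%:R = fst @^-1` `]a, b[.
Proof.
apply/seteqP; split => -[x y]; rewrite /open_box/= in_itv/=.
  by move=> [n _ /andP[]].
move=> xab; have [n yn] := exists_natr_itv y.
by exists n => //=; rewrite xab yn.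
Qed.

Lemma bigcup_open_box_r (a b : R) :
  \bigcup_n open_box (- n%:R) n%:R a b = snd @^-1` `]a, b[.
Proof.
apply/seteqP; split => -[x y]; rewrite /open_box/= in_itv/=.
  by move=> [n _ /andP[]].
move=> yab; have [n xn] := exists_natr_itv x.
by exists n => //=; rewrite yab xn.
Qed.

Lemma bigcup_open_boxT :
  \bigcup_n open_box (- n%:R) n%:R (- n%:R) n%:R = setT.
Proof.
apply/seteqP; split => // -[x y] _.
have [n xn] := exists_natr_itv x; have [m ym] := exists_natr_itv y.
exists (maxn n m) => //; rewrite /open_box/= xn ?leq_maxl// ym ?leq_maxr//.
Qed.

(** Prepares an induction on Borel sets that starts from open boxes. Both projections are measurable
    for the sigma-algebra of boxes, since an open strip is a countable union of boxes. *)
Lemma measurable_open_boxes :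
  @measurable _ (mplane R) = <<s open_boxes >>.
Proof.
rewrite measurable_prod_measurableType eqEsubset; split.
  apply: smallest_sub; first exact: smallest_sigma_algebra.
  move=> _ [A mA [B mB <-]].
  have -> : A `*` B = (fst @^-1` A) `&` (snd @^-1` B) :> set (R * R) by [].
  pose T := g_sigma_algebraType open_boxes.
  have mf : measurable_fun (setT : set T) (fst : T -> measurableTypeR R).
    apply: (measurability _ (RGenOpens.measurableE R)) => _ [_ [a [b ->]] <-].
    rewrite setTI -bigcup_open_box_l; apply: bigcupT_measurable => n.
    by apply: sub_sigma_algebra; exists a, b, (- n%:R), n%:R.
  have ms : measurable_fun (setT : set T) (snd : T -> measurableTypeR R).
    apply: (measurability _ (RGenOpens.measurableE R)) => _ [_ [a [b ->]] <-].
    rewrite setTI -bigcup_open_box_r; apply: bigcupT_measurable => n.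
    by apply: sub_sigma_algebra; exists (- n%:R), n%:R, a, b.
  have := @measurableI _ T _ _ (mf measurableT _ mA) (ms measurableT _ mB).
  by rewrite !setTI.
apply: smallest_sub; first exact: smallest_sigma_algebra.
move=> _ [a [b [c [d ->]]]]; rewrite open_boxE; apply: sub_sigma_algebra.
by exists `]a, b[%classic => //; exists `]c, d[%classic.
Qed.

Lemma measurable_open_box a b c d : measurable (open_box a b c d).
Proof. by rewrite open_boxE; exact: measurableX. Qed.

End open_boxes.

(** * From weak-* measurability to measurable masses of Borel sets *)

Section weak_star_measurability.
Context {R : realType}.

Section tents.
Variables a b c d : R.

(** Inside the box this is the sup-norm distance to the complement. *)
Definition tent (x : plane R) : R :=
  Num.max 0 (Num.min (Num.min (x.1 - a) (b - x.1)) (Num.min (x.2 - c) (d - x.2))).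

(** These C_0 functions increase to the indicator of the open box, so that monotone convergence
    carries measurability from their integrals to the mass of the box. *)
Definition steep_tent (n : nat) (x : plane R) : R := Num.min 1 (n%:R * tent x).

Lemma tent_ge0 x : 0 <= tent x.
Proof. by rewrite /tent le_max lexx. Qed.

Lemma tent_gt0 x : (0 < tent x) = (x \in open_box a b c d).
Proof.
rewrite /tent lt_max ltxx/= !lt_min !subr_gt0.
by apply/idP/idP; rewrite inE.
Qed.

Lemma continuous_tent : continuous tent.
Proof.
move=> x; have c1 : {for x, continuous (fst : R * R -> R)} by exact: cvg_fst.
have c2 : {for x, continuous (snd : R * R -> R)} by exact: cvg_snd.
have cc (e : R) : {for x, continuous (fun=> e : R)} by exact: cvg_cst.
apply: (@continuous_max R (R * R)%type) => //.
by apply: (@continuous_min R (R * R)%type);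
  apply: (@continuous_min R (R * R)%type);
  apply: (@continuousB R R^o (R * R)%type).
Qed.

Lemma continuous_steep_tent n : continuous (steep_tent n).
Proof.
move=> x; apply: (@continuous_min R (R * R)%type); first exact: cvg_cst.
by apply: cvgM; [exact: cvg_cst|exact: continuous_tent].
Qed.

Lemma steep_tent_ge0 n x : 0 <= steep_tent n x.
Proof. by rewrite /steep_tent le_min ler01/= mulr_ge0 ?tent_ge0. Qed.

Lemma steep_tent_le1 n x : steep_tent n x <= 1.
Proof. by rewrite /steep_tent ge_min lexx. Qed.

Lemma steep_tent_C0 n : C0_plane (steep_tent n).
Proof.
split; first exact: continuous_steep_tent.
move=> e e0; exists (`[a, b] `*` `[c, d]).
  by apply: compact_setX; exact: segment_compact.
move=> x nx; suff -> : steep_tent n x = 0 by rewrite normr0.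
rewrite /steep_tent (_ : tent x = 0) ?mulr0 ?min_r//.
apply/eqP; rewrite eq_le tent_ge0 andbT leNgt tent_gt0.
apply/negP; rewrite inE => /andP[/andP[? ?] /andP[? ?]]; apply: nx.
by split; rewrite /= in_itv/= !ltW.
Qed.

Lemma measurable_steep_tent n :
  measurable_fun (setT : set (mplane R)) (steep_tent n).
Proof.
apply: measurable_minr => //; apply: measurable_funM => //.
by apply: measurable_maxr => //; apply: measurable_minr; apply: measurable_minr;
  apply: measurable_funB.
Qed.

Lemma nondecreasing_steep_tent x m n : (m <= n)%N ->
  steep_tent m x <= steep_tent n x.
Proof.
move=> mn; rewrite /steep_tent le_min ge_min lexx/= ge_min.
by rewrite ler_wpM2r ?orbT ?tent_ge0// ler_nat.
Qed.

Lemma cvg_steep_tent x :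
  (steep_tent n x)%:E @[n --> \oo] --> ((\1_(open_box a b c d) x : R)%:E).
Proof.
rewrite indicE -tent_gt0; have [t0|] := ltP 0 (tent x); last first.
  move=> t0; apply: cvg_near_cst; near=> n; rewrite /steep_tent; congr EFin.
  have -> : tent x = 0 by apply/eqP; rewrite eq_le t0 tent_ge0.
  by rewrite mulr0 min_r.
apply: cvg_near_cst; near=> n; congr EFin; rewrite /steep_tent min_l//.
rewrite -ler_pdivrMr// mul1r; near: n.
exact: nbhs_infty_ger.
Unshelve. all: by end_near. Qed.

End tents.

Context d (X : measurableType d).
Variable r : X -> {finite_measure set (mplane R) -> \bar R}.
Hypothesis mr : forall phi, C0_plane phi ->
  measurable_fun setT (fun t => \int[r t]_x phi x).

Let measurable_mass_open_box a b c e :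
  measurable_fun setT (r ^~ (open_box a b c e)).
Proof.
apply: (emeasurable_fun_cvg
    (fun n t => (\int[r t]_x steep_tent a b c e n x)%:E)).
  by move=> n; apply/measurable_EFinP/mr; exact: steep_tent_C0.
move=> t _.
have -> : r t (open_box a b c e) =
    (\int[r t]_x (\1_(open_box a b c e) x)%:E)%E.
  by rewrite integral_indic ?setIT//; exact: measurable_open_box.
rewrite (_ : (fun n => _) =
  (fun n => \int[r t]_x (steep_tent a b c e n x)%:E)%E); last first.
  apply/funext => n; rewrite fineK//.
  apply: integrable_fin_num => //.
  apply: measurable_bounded_integrable => //.
  - by rewrite ltey_eq fin_num_measure.
  - exact: measurable_steep_tent.
  - exists 1; split => // M M1 x _/=.
    by rewrite ger0_norm ?steep_tent_ge0// (le_trans (steep_tent_le1 _ _ _ _ _ _))// ltW.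
rewrite (_ : (\int[r t]_x _)%E =
  \int[r t]_x lim ((steep_tent a b c e n x)%:E @[n --> \oo]))%E; last first.
  by apply: eq_integral => x _; apply/esym/cvg_lim => //; exact: cvg_steep_tent.
apply: cvg_monotone_convergence => //.
- by move=> n; apply/measurable_EFinP; exact: measurable_steep_tent.
- by move=> n x _; rewrite lee_fin steep_tent_ge0.
- by move=> x _ m n mn; rewrite lee_fin nondecreasing_steep_tent.
Qed.

Lemma C0_family_measurable (A : set (mplane R)) : measurable A ->
  measurable_fun setT (r ^~ A).
Proof.
(* The total mass comes first, by exhaustion with boxes: the complement step of the Dynkin induction
   subtracts from it, and the whole plane is not itself a box. *)
have mrT : measurable_fun setT (r ^~ setT).
  rewrite -bigcup_open_boxT; apply: (emeasurable_fun_cvg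
    (fun n t => r t (open_box (- n%:R) n%:R (- n%:R) n%:R))) => // t _.
  apply: nondecreasing_cvg_mu.
  + by move=> i; exact: measurable_open_box.
  + by apply: bigcupT_measurable => i; exact: measurable_open_box.
  + move=> m n mn; apply/subsetPset => x /andP[/andP[x1 x2] /andP[x3 x4]].
    have mn' : (m%:R : R) <= n%:R by rewrite ler_nat.
    rewrite /open_box/= (lt_le_trans x2)// (lt_le_trans x4)//.
    by rewrite !(le_lt_trans _ x1, le_lt_trans _ x3)// lerN2.
move=> mA; have := mA; rewrite measurable_open_boxes.
apply: (@dynkin_induction _ _ _ (fun B => measurable_fun setT (r ^~ B))
  measurable_open_boxes setI_closed_open_boxes).
- exact: mrT.
- by move=> _ [a [b [c [e ->]]]]; exact: measurable_mass_open_box.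
- move=> B mB mrB; rewrite (_ : (fun _ => _) = (fun t => r t setT - r t B)%E).
    exact: emeasurable_funB.
  apply/funext => t; rewrite -setTD measureD ?setTI//.
  by rewrite ltey_eq fin_num_measure.
- move=> F mF tF mrF.
  rewrite (_ : (fun _ => _) = (fun t => \sum_(0 <= k <oo) r t (F k))%E).
    exact: ge0_emeasurable_sum.
  by apply/funext => t; rewrite measure_semi_bigcup//; exact: bigcupT_measurable.
Qed.

End weak_star_measurability.

Lemma Linf_measures_measurable {R : realType}
    (rho : R -> {finite_measure set (mplane R) -> \bar R})
    (A : set (mplane R)) : Linf_measures C0_plane rho -> measurable A ->
  measurable_fun setT (fun t : R => rho (Num.max 0 t) A).
Proof.
move=> [mrho _].
have := @C0_family_measurable R _ (measurableTypeR R)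
  (fun t : R => rho (Num.max 0 t)).
apply => // phi /mrho mphi; apply: (measurable_comp _ _ mphi) => //.
  by move=> _ [t _ <-]; rewrite /= in_itv/= andbT le_max lexx.
exact: measurable_maxr.
Qed.

(** * Joint measurability of continuous functions and of the kernel *)

(** A Caratheodory function: [q n x] rounds [x] down to the grid of mesh 1/(n+1), and the functions
    frozen on the grid converge pointwise by continuity in the first variable. *)
Lemma continuous_measurable_fun_prod {R : realType} d (T : measurableType d)
    (f : R * T -> R) :
  (forall y, continuous (fun x => f (x, y))) ->
  (forall x, measurable_fun setT (fun y => f (x, y))) ->
  measurable_fun (setT : set (measurableTypeR R * T)) f.
Proof.
move=> cf mf; pose q n (x : R) := (Num.floor (n.+1%:R * x))%:~R / n.+1%:R : R.
apply: (measurable_fun_cvg (h := fun n z => f (q n z.1, z.2))); last first.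
  move=> [x y] _ /=; apply: (@cvg_comp _ _ _ (q ^~ x) (fun x => f (x, y))); last exact: cf.
  apply/cvgrPdist_le => e e0; near=> n.
  have n0 : 0 < n.+1%:R :> R by [].
  have /andP[h1 h2] := floor_itv (n.+1%:R * x).
  have -> : x - q n x = (n.+1%:R * x - (Num.floor (n.+1%:R * x))%:~R) / n.+1%:R.
    by rewrite /q mulrBl mulrAC divff ?mul1r// gt_eqF.
  have d1 : n.+1%:R * x - (Num.floor (n.+1%:R * x))%:~R <= 1.
    by move: h2; rewrite intrD mulr1z => h2; lra.
  rewrite ger0_norm; last by rewrite divr_ge0// subr_ge0.
  rewrite ler_pdivrMr// (le_trans d1)// -ler_pdivrMl// mulr1.
  rewrite (@le_trans _ _ n%:R) ?ler_nat//; near: n.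
  exact: nbhs_infty_ger.
move=> n mD B mB; rewrite setTI.
pose C (k : int) : set (measurableTypeR R * T) :=
  [set x | Num.floor (n.+1%:R * x) = k] `*` [set y | B (f (k%:~R / n.+1%:R, y))].
(* The floor takes countably many values, so the preimage is a countable union of measurable
   rectangles, enumerated through [unpickle]. *)
rewrite (_ : _ @^-1` _ = \bigcup_m (if unpickle m is Some k then C k else set0)).
  apply: bigcupT_measurable => m; case: (unpickle m) => // k.
  apply: measurableX; last by rewrite -[X in measurable X]setTI; exact: mf.
  rewrite (_ : [set _ | _] = `[k%:~R / n.+1%:R, (k + 1)%:~R / n.+1%:R[%classic)//.
  apply/seteqP; split => x /=; rewrite in_itv/= ler_pdivrMr// ltr_pdivlMr// mulrC.
    by move=> <-; exact: floor_itv.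
  by move/floor_def.
apply/seteqP; split => [[x y] /= Bxy|[x y] [m _]].
  by exists (pickle (Num.floor (n.+1%:R * x))); rewrite ?pickleK.
by case: (unpickle m) => // k [/= <-].
Unshelve. all: by end_near. Qed.

Lemma measurable_dot {R : realType} d (T : measurableType d)
    (f g : T -> mplane R) : measurable_fun setT f -> measurable_fun setT g ->
  measurable_fun setT (fun x => dot (f x) (g x)).
Proof.
move=> /measurable_fun_pairP[f1 f2] /measurable_fun_pairP[g1 g2].
by apply: measurable_funD; apply: measurable_funM.
Qed.

Lemma dot_ge0 {R : realType} (x : plane R) : 0 <= dot x x.
Proof. by rewrite /dot -!expr2 addr_ge0 ?sqr_ge0. Qed.

Lemma measurable_coord_kernelK {R : realType} d (T : measurableType d)
    (f : T -> mplane R) i : measurable_fun setT f ->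
  measurable_fun setT (fun x => coord i (kernelK (f x))).
Proof.
(* The inverse is written as a real power, which is measurable on the whole line; both expressions
   have the value 0 at 0. *)
move=> mf; rewrite (_ : (fun x => _) =
    (fun x => dot (f x) (f x) `^ (-1) * coord i (f x))).
  apply: measurable_funM.
    by apply: (measurableT_comp (measurable_powR _)); exact: measurable_dot.
  by have /measurable_fun_pairP[f1 f2] := mf; rewrite /coord; case: (i == ord0).
apply/funext => x; rewrite powR_inv1 ?dot_ge0//.
by rewrite /kernelK /coord; case: ifP.
Qed.

Lemma measurable_plane_funB {R : realType} d (T : measurableType d)
    (f g : T -> mplane R) : measurable_fun setT f -> measurable_fun setT g ->
  measurable_fun setT (fun x => f x - g x : mplane R).
Proof.
move=> /measurable_fun_pairP[f1 f2] /measurable_fun_pairP[g1 g2].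
by apply/measurable_fun_pairP; split; apply: measurable_funB.
Qed.

Section slices.
Context {T U V : topologicalType}.
Variable f : T * U -> V.
Hypothesis cf : continuous f.

Lemma continuous_slicel y : continuous (fun x => f (x, y)).
Proof.
move=> x; apply: (@continuous_comp _ _ _ (fun x => (x, y)) f); last exact: cf.
by apply: (@cvg_pair _ _ _ _ (nbhs x) (nbhs y)); [exact: cvg_id|exact: cvg_cst].
Qed.

Lemma continuous_slicer x : continuous (fun y => f (x, y)).
Proof.
move=> y; apply: (@continuous_comp _ _ _ (fun y => (x, y)) f); last exact: cf.
by apply: (@cvg_pair _ _ _ _ (nbhs x) (nbhs y)); [exact: cvg_cst|exact: cvg_id].
Qed.

End slices.

Lemma continuous_measurable_fun_plane {R : realType} (f : plane R -> R) :
  continuous f -> measurable_fun (setT : set (mplane R)) f.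
Proof.
move=> cf; apply: continuous_measurable_fun_prod => [y|x].
  exact: (@continuous_slicel R R R).
by apply: continuous_measurable_fun; exact: (@continuous_slicer R R R).
Qed.

Lemma continuous_measurable_fun_time_plane {R : realType}
    (f : R * plane R -> R) : continuous f ->
  measurable_fun (setT : set (measurableTypeR R * mplane R)) f.
Proof.
move=> cf; apply: continuous_measurable_fun_prod => [y|x].
  exact: (@continuous_slicel R (R * R)%type R).
apply: continuous_measurable_fun_plane.
exact: (@continuous_slicer R (R * R)%type R).
Qed.

(** * Riesz potential estimates from the growth of box masses *)

Section riesz_potential.
Context {R : realType}.

(** The product norm of [plane R] in coordinates; its balls are squares, whose Lebesgue measure is a
    product of lengths. *)
Definition sup_norm (z : plane R) : R := Num.max `|z.1| `|z.2|.

Definition box (x : plane R) (r : R) : set (mplane R) :=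
  [set y | sup_norm (x - y) < r].

Lemma measurable_box x r : measurable (box x r).
Proof.
rewrite (_ : box x r = open_box (x.1 - r) (x.1 + r) (x.2 - r) (x.2 + r)).
  exact: measurable_open_box.
apply/seteqP; split => y; rewrite /box /open_box /sup_norm /= gt_max !ltr_norml;
  by move=> /andP[/andP[? ?] /andP[? ?]]; apply/andP; split; apply/andP; split;
  lra.
Qed.

Lemma sup_norm_ge0 z : 0 <= sup_norm z.
Proof. by rewrite le_max normr_ge0. Qed.

Lemma sup_norm_eq0 z : (sup_norm z == 0) = (z == 0).
Proof.
case: z => a b; apply/eqP/eqP => [/eqP|[-> ->]]; last first.
  by rewrite /sup_norm/= normr0 maxxx.
rewrite eq_le => /andP[]; rewrite ge_max !normr_le0 /=.
by move=> /andP[/eqP -> /eqP ->].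
Qed.

Lemma sup_normN z : sup_norm (- z) = sup_norm z.
Proof. by rewrite /sup_norm/= !normrN. Qed.

Lemma sup_normD z w : sup_norm (z + w) <= sup_norm z + sup_norm w.
Proof.
by rewrite /sup_norm ge_max !(le_trans (ler_normD _ _))// lerD// le_max lexx ?orbT.
Qed.

Lemma coord_kernelK_le i z : `|coord i (kernelK z)| <= (sup_norm z)^-1.
Proof.
have [->|z0] := eqVneq z 0.
  rewrite /kernelK scaler0 (_ : coord i 0 = 0) ?normr0 ?invr_ge0 ?sup_norm_ge0//.
  by rewrite /coord; case: ifP.
have s0 : 0 < sup_norm z by rewrite lt_def sup_norm_eq0 z0 sup_norm_ge0.
have sd : sup_norm z ^+ 2 <= dot z z.
  rewrite /sup_norm /dot; have [_|_] := leP `|z.1| `|z.2|;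
  by rewrite real_normK ?num_real// expr2; have := sqr_ge0 z.1; have := sqr_ge0 z.2; lra.
have -> : coord i (kernelK z) = coord i z / dot z z.
  by rewrite /coord /kernelK; case: ifP => _ /=; rewrite mulrC.
have d0 : 0 < dot z z by rewrite (lt_le_trans _ sd)// exprn_gt0.
rewrite normrM normfV (ger0_norm (ltW d0)) ler_pdivrMr//.
apply: (@le_trans _ _ (sup_norm z)).
  by rewrite /coord /sup_norm le_max; case: ifP; rewrite lexx ?orbT.
by rewrite mulrC ler_pdivlMr// -expr2.
Qed.

(** Raising the cap on 1/s from 2^(m+k) to its double costs 2^(m+k), and only if s < 2^-(m+k);
    otherwise 1/s is already below the old cap. The cap makes the induction on k possible, and it is
    inactive as soon as 2^-k <= s. *)
Lemma dyadic_staircase (s : R) m k : 0 < s -> s < 2^-1 ^+ m ->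
  Num.min s^-1 (2 ^+ (m + k)) <=
  2 ^+ m + \sum_(0 <= n < k) 2 ^+ (m + n) * (s < 2^-1 ^+ (m + n))%R%:R :> R.
Proof.
move=> s0 sm; elim: k => [|k IH].
  by rewrite addn0 big_nil addr0 ge_min lexx orbT.
rewrite big_nat_recr//= addrA.
have [sk|sk] := ltP s (2^-1 ^+ (m + k)); last first.
  rewrite mulr0 addr0 (le_trans _ IH)// le_min !ge_min lexx/=.
  apply/orP; left; rewrite -[leRHS]invrK lef_pV2 ?posrE ?invr_gt0 ?exprn_gt0//.
  by rewrite -exprVn.
rewrite mulr1 (@le_trans _ _ (2 ^+ (m + k) + 2 ^+ (m + k)))//.
  by rewrite ge_min addnS exprS orbC; apply/orP; left; lra.
rewrite lerD2r (le_trans _ IH)// le_min lexx andbT.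
rewrite -[leLHS]invrK lef_pV2 ?posrE ?invr_gt0 ?exprn_gt0//.
by rewrite -exprVn ltW.
Qed.

Lemma exists_half_exp_le (s : R) : 0 < s -> exists k, 2^-1 ^+ k <= s.
Proof.
move=> s0; exists (Num.truncn s^-1).+1.
rewrite exprVn -[leRHS]invrK lef_pV2 ?posrE ?invr_gt0 ?exprn_gt0//.
rewrite (le_trans (ltW (truncnS_gt _)))// -natrX ler_nat ltnW// ltn_expl//.
Qed.

Variables (mu : {finite_measure set (mplane R) -> \bar R}) (A theta : R).
Hypotheses (A0 : 0 <= A) (theta01 : 0 < theta < 1).

(** Integrating the dyadic staircase, the layer of height 2^n costs 2^n times A (theta/2)^n, that is
    A theta^n, so the layers form a geometric series. The summand 1 in the last factor is the base
    of height 2^m. *)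
Lemma riesz_local (x : plane R) m i :
  (forall n, mu (box x (2^-1 ^+ n)) <= (A * (theta / 2) ^+ n)%:E)%E ->
  (\int[mu]_(y in box x (2^-1 ^+ m)) `|coord i (kernelK (x - y))|%:E <=
   (A * theta ^+ m * (1 + (1 - theta)^-1))%:E)%E.
Proof.
move=> hmu; have /andP[t0 t1] := theta01.
pose a n (y : mplane R) : \bar R :=
  (2 ^+ (m + n) * \1_(box x (2^-1 ^+ (m + n))) y : R)%:E.
have a0 n y : (0 <= a n y)%E by rewrite lee_fin mulr_ge0.
have ma n : measurable_fun setT (a n).
  apply/measurable_EFinP/measurable_funM => //.
  by apply: measurable_indic; exact: measurable_box.
have mB := measurable_box x (2^-1 ^+ m).
apply: (@le_trans _ _ (\int[mu]_(y in box x (2^-1 ^+ m))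
    ((2 ^+ m)%:E + \sum_(0 <= n <oo) a n y))%E).
  apply: ge0_le_integral => //.
  - apply/measurable_EFinP; apply: measurableT_comp => //.
    by apply: measurable_funTS; apply: measurable_coord_kernelK;
      exact: measurable_plane_funB.
  - apply: measurable_funTS; apply: emeasurable_funD => //.
    by apply: ge0_emeasurable_sum.
  move=> y yB; have [/eqP|s0] := eqVneq (sup_norm (x - y)) 0.
    rewrite sup_norm_eq0 => /eqP ->.
    rewrite /kernelK scaler0 (_ : coord i 0 = 0) ?normr0; last first.
      by rewrite /coord; case: ifP.
    by rewrite adde_ge0 ?lee_fin ?exprn_ge0// nneseries_ge0// => n _ _; exact: a0.
  have {}s0 : 0 < sup_norm (x - y) by rewrite lt_def s0 sup_norm_ge0.
  have [k hk] := exists_half_exp_le _ s0.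
  have := dyadic_staircase _ m k s0 yB; rewrite min_l; last first.
    rewrite -[leRHS]invrK lef_pV2 ?posrE ?invr_gt0 ?exprn_gt0//.
    rewrite -exprVn exprD (le_trans _ hk)// ger_pMl ?exprn_gt0//.
    by rewrite exprn_ile1//; lra.
  move=> hs; apply: (@le_trans _ _ ((2 ^+ m)%:E + \sum_(0 <= n < k) a n y)%E).
    rewrite sumEFin -EFinD lee_fin (le_trans (coord_kernelK_le _ _))//.
    rewrite (le_trans hs)// lerD2l; apply: ler_sum => n _.
    rewrite indicE ler_wpM2l//; case: ltP => // h.
    by rewrite mem_set.
  by rewrite leeD2l// nneseries_lim_ge.
rewrite ge0_integralD//; last 2 first.
  by move=> y _; rewrite nneseries_ge0// => n _ _; exact: a0.
  by apply: measurable_funTS; apply: ge0_emeasurable_sum.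
rewrite integral_cst// integral_nneseries//; last by move=> n; exact: measurable_funTS.
have cancel n : 2 ^+ n * (A * (theta / 2) ^+ n) = A * theta ^+ n.
  by rewrite mulrCA -exprMn mulrCA divff// mulr1.
rewrite mulrDr mulr1 EFinD; apply: leeD.
  by rewrite -cancel EFinM lee_wpmul2l ?lee_fin ?exprn_ge0//; exact: hmu.
apply: lime_le.
  by apply: is_cvg_nneseries => n _ _; apply: integral_ge0 => y _; exact: a0.
apply: nearW => k.
apply: (@le_trans _ _ (\sum_(0 <= n < k) (A * theta ^+ (m + n))%:E)%E).
  apply: lee_sum => n _.
  rewrite (_ : (\int[mu]_(y in _) _)%E = ((2 ^+ (m + n))%:E *
    \int[mu]_(y in box x (2^-1 ^+ m)) (\1_(box x (2^-1 ^+ (m + n))) y)%:E)%E).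
    rewrite -cancel EFinM lee_wpmul2l ?lee_fin ?exprn_ge0//.
    rewrite integral_indic//; last exact: measurable_box.
    rewrite (le_trans _ (hmu (m + n)%N))// le_measure// ?inE//.
      by apply: measurableI => //; exact: measurable_box.
    exact: measurable_box.
  rewrite -ge0_integralZl_EFin//.
  apply/measurable_EFinP/measurable_funTS/measurable_indic.
  exact: measurable_box.
rewrite sumEFin lee_fin.
under eq_bigr do rewrite exprD mulrA.
rewrite -mulr_sumr ler_wpM2l ?mulr_ge0 ?exprn_ge0 ?(ltW t0)//.
have -> : \sum_(0 <= n < k) theta ^+ n = (1 - theta ^+ k) / (1 - theta).
  have := @geometric_seriesE R 1 theta; rewrite lt_eqF// => /(_ isT).
  move=> /(congr1 (fun u => u k)); rewrite /series/= mul1r => <-.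
  by apply: eq_bigr => n _; rewrite mul1r.
rewrite ler_pdivrMr ?subr_gt0// mulVf ?subr_eq0 ?gt_eqF//.
by rewrite gerBl exprn_ge0// ltW.
Qed.

(** Outside the unit box the kernel is at most 1 and contributes at most the total mass; inside, the
    local estimate with m = 0 applies. *)
Lemma riesz_global (x : plane R) i :
  (forall n, mu (box x (2^-1 ^+ n)) <= (A * (theta / 2) ^+ n)%:E)%E ->
  (\int[mu]_y `|coord i (kernelK (x - y))|%:E <=
   mu setT + (A * (1 + (1 - theta)^-1))%:E)%E.
Proof.
move=> hmu.
have mk : measurable_fun (setT : set (mplane R))
    (fun y : mplane R => `|coord i (kernelK (x - y))|%:E).
  apply/measurable_EFinP; apply: measurableT_comp => //.
  by apply: measurable_coord_kernelK; exact: measurable_plane_funB.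
have mB := measurable_box x 1.
rewrite -(setUv (box x 1)) ge0_integral_setU//; last 3 first.
- exact: measurableC.
- by rewrite setUv.
- exact/disj_setPCl.
rewrite setUv addeC; apply: leeD; last first.
  by have := riesz_local x 0 i hmu; rewrite !expr0 mulr1.
apply: (@le_trans _ _ (\int[mu]_(y in ~` box x 1) (cst 1%E y))%E).
  apply: ge0_le_integral => //; first exact: measurableC.
    exact: measurable_funTS.
  move=> y /negP; rewrite -leNgt => y1.
  by rewrite lee_fin (le_trans (coord_kernelK_le _ _))// invf_le1// (lt_le_trans _ y1).
rewrite integral_cst ?mul1e; last exact: measurableC.
by rewrite le_measure ?inE//; exact: measurableC.
Qed.

End riesz_potential.

(** * Growth of box masses for L^p densities with p > 2 *)

Section morrey.
Context {R : realType}.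

Lemma leb2_box (x : plane R) (r : R) : 0 <= r ->
  leb2 (box x r) = (4 * r ^+ 2)%:E.
Proof.
move=> r0; have -> : box x r = `]x.1 - r, x.1 + r[ `*` `]x.2 - r, x.2 + r[.
  rewrite -open_boxE; apply/seteqP; split => y;
  rewrite /box /open_box /sup_norm /= gt_max !ltr_norml;
  by move=> /andP[/andP[? ?] /andP[? ?]]; apply/andP; split; apply/andP; split;
  lra.
have itvE (a : R) : lebesgue_measure (`]a - r, a + r[%classic : set R) = (2 * r)%:E.
  rewrite lebesgue_measure_itv/= lte_fin; case: ltP => h.
    by rewrite -EFinB; congr EFin; ring.
  by congr EFin; lra.
rewrite /leb2 product_measure1E//= !itvE -EFinM; congr EFin; ring.
Qed.

Variables (p : \bar R).
Hypothesis p2 : (2%:E < p)%E.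

(** Chosen so that theta/2 = 4^-(1 - 1/p), the factor by which the Hoelder bound on the mass of a
    box shrinks when its side is halved. It is below 1 exactly when 1 - 1/p > 1/2. For p = +oo the
    factor is 1/4. *)
Let theta : R := if p is r%:E then 2 * (4^-1) `^ (1 - r^-1) else 2^-1.

Let theta01 : 0 < theta < 1.
Proof.
rewrite /theta; case: p p2 => [r| |//]; last by move=> _; lra.
rewrite lte_fin => r2; rewrite mulr_gt0 ?powR_gt0//=.
rewrite -ltr_pdivlMl// mulr1 (_ : 2^-1 = 4^-1 `^ 2^-1 :> R); last first.
  have -> : 4^-1 = 2^-1 `^ 2%:R :> R by rewrite powR_mulrn// expr2; lra.
  by rewrite -powRrM divff// powRr1.
rewrite /powR; case: ifPn => [/eqP|_]; first by lra.
rewrite ltr_expR ltr_nM2r ?ln_lt0//; last by apply/andP; split; lra.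
have : r^-1 < 2^-1 by rewrite ltf_pV2 ?posrE//; lra.
by lra.
Qed.

Lemma Lp_morrey : exists2 theta : R, 0 < theta < 1 & forall C : R,
  exists2 A : R, 0 <= A & forall (g : plane R -> R)
    (mu : {finite_measure set (mplane R) -> \bar R}),
    measurable_fun (setT : set (mplane R)) g -> (forall x, 0 <= g x) ->
    (forall A, measurable A -> mu A = \int[leb2]_(x in A) (g x)%:E)%E ->
    ('N[leb2]_p[EFin \o g] <= C%:E)%E ->
    forall x n, (mu (box x (2^-1 ^+ n)) <= (A * (theta / 2) ^+ n)%:E)%E.
Proof.
(* The box of half-side 2^-n has area 4 times 4^-n, and 4^(1 - 1/p) <= 4. The maximum keeps the
   constant nonnegative before any density is given. *)
exists theta => // C; exists (4 * Num.max 0 C) => [|g mu mg g0 muE gC x n].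
  by rewrite mulr_ge0// le_max lexx.
have mB := measurable_box x (2^-1 ^+ n).
have C0 : 0 <= C by rewrite -lee_fin (le_trans _ gC)// Lnorm_ge0.
rewrite (max_r C0) muE// /theta; case: p p2 gC => [r| |//]; last first.
  (* The norm with exponent +oo is an essential supremum only if the whole space has positive
     measure; the unit box shows that it does. *)
  move=> _; rewrite unlock; case: ifPn => [_ gC|/negP]; last first.
    move=> []; rewrite (@lt_le_trans _ _ (leb2 (box 0 1)))//.
      by rewrite leb2_box// lte_fin; lra.
    by rewrite le_measure ?inE//; exact: measurable_box.
  apply: (@le_trans _ _ (\int[leb2]_(y in box x (2^-1 ^+ n)) C%:E)%E).
    apply: ae_ge0_le_integral => //.
    - by move=> y _; rewrite lee_fin.
    - by apply/measurable_EFinP; exact: measurable_funTS.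
    have := ess_sup_inf.ess_sup_ge leb2 (abse \o (EFin \o g)).
    apply: filterS => y /= h _.
    by rewrite (le_trans _ gC)// (le_trans _ h)//= lee_fin ler_norm.
  rewrite integral_cst// -[X in (_ * X)%E]/(leb2 (box x (2^-1 ^+ n))).
  rewrite leb2_box ?exprn_ge0// -EFinM lee_fin.
  have -> : (2^-1 / 2) ^+ n = (2^-1 ^+ n) ^+ 2 :> R.
    by rewrite -exprM mulnC exprM expr2.
  by rewrite mulrCA mulrA.
rewrite lte_fin => r2 gC.
have r0 : 0 < r by lra.
pose q := (1 - r^-1)^-1.
have r1 : r^-1 < 1 by rewrite invf_lt1//; lra.
have q0 : 0 < q by rewrite invr_gt0 subr_gt0.
have := @hoelder _ _ R leb2 g (\1_(box x (2^-1 ^+ n))) r q mg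
  (measurable_indic mB) r0 q0.
rewrite /q invrK addrC subrK => /(_ erefl) hh.
rewrite (_ : (\int[leb2]_(x in _) _)%E =
    'N[leb2]_1[EFin \o (g \* \1_(box x (2^-1 ^+ n)))%R])%E; last first.
  rewrite Lnorm1 [LHS]integral_mkcond; apply: eq_integral => y _.
  rewrite /patch/= indicE; case: ifPn => _; last by rewrite mulr0 normr0.
  by rewrite mulr1 ger0_norm.
rewrite (le_trans hh)//.
have -> : ('N[leb2]_q%:E[EFin \o \1_(box x (2^-1 ^+ n))] =
    ((4 * (2^-1 ^+ n) ^+ 2) `^ (1 - r^-1))%:E)%E.
  rewrite unlock /q invrK -poweR_EFin -(leb2_box x) ?exprn_ge0//; congr poweR.
  rewrite -[in RHS](setIT (box _ _)) -integral_indic//.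
  apply: eq_integral => y _ /=; rewrite indicE; case: (y \in _) => /=.
    by rewrite normr1 powR1.
  by rewrite normr0 powR0// gt_eqF.
apply: (@le_trans _ _ (C%:E * ((4 * (2^-1 ^+ n) ^+ 2) `^ (1 - r^-1))%:E)%E).
  by rewrite lee_wpmul2r// lee_fin powR_ge0.
rewrite -EFinM lee_fin.
have -> : 2 * 4^-1 `^ (1 - r^-1) / 2 = 4^-1 `^ (1 - r^-1) by rewrite mulrAC divff ?mul1r.
rewrite powRM ?exprn_ge0// mulrA (mulrC C) ler_pM ?mulr_ge0 ?powR_ge0//.
  rewrite ler_wpM2r// -[leRHS]powRr1// ler_powR ?ler1n//.
  by rewrite gerBl invr_ge0 ltW.
rewrite -exprM mulnC exprM -!powR_mulrn ?powR_ge0//.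
by rewrite powRAC (_ : 2^-1 `^ 2%:R = 4^-1)// powR_mulrn//; lra.
Qed.

End morrey.

(** * Smooth functions stable under differentiation, and cut-offs *)

Section smooth_functions.
Context {R : realType}.

(** The flat function exp(-1/x), with the factors x^-n that make the family closed under
    differentiation. *)
Definition psi (n : nat) (x : R) : R :=
  if 0 < x then x^-1 ^+ n * expR (- x^-1) else 0.

Lemma psi_ge0 n x : 0 <= psi n x.
Proof.
rewrite /psi; case: ifP => // x0.
by rewrite mulr_ge0 ?expR_ge0// exprn_ge0// invr_ge0 ltW.
Qed.

Lemma psi_gt0 x : (0 < psi 0 x) = (0 < x).
Proof. by rewrite /psi; case: ifP => // x0; rewrite mul1r expR_gt0. Qed.

(** One term of the exponential series, exp(1/x) >= x^-(n+2) / (n+2)!, suffices. The quadratic bound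
    makes the difference quotients at 0 tend to 0. *)
Lemma psi_le_sqr n x : `|psi n x| <= n.+2`!%:R * x ^+ 2.
Proof.
rewrite ger0_norm ?psi_ge0// /psi; case: ifPn => x0; last first.
  by rewrite mulr_ge0 ?sqr_ge0.
have xV0 : 0 < x^-1 by rewrite invr_gt0.
have h := expR_ge1Dxn n.+1 (ltW xV0).
rewrite expRN ler_pdivrMr ?expR_gt0//.
apply: (@le_trans _ _ (n.+2`!%:R * x ^+ 2 * (x^-1 ^+ n.+2 / n.+2`!%:R))).
  rewrite [leRHS]mulrC mulrA divfK ?pnatr_eq0 -?lt0n ?fact_gt0//.
  by rewrite -addn2 exprD -mulrA -exprMn mulVf ?gt_eqF// expr1n mulr1.
apply: ler_wpM2l; first by rewrite mulr_ge0 ?sqr_ge0.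
by rewrite (le_trans _ h)// lerDr.
Qed.

Lemma is_derive_psi n (x : R) :
  is_derive x 1 (psi n) (- n%:R * psi n.+1 x + psi n.+2 x).
Proof.
have [x0|x0|<-] := ltgtP 0 x.
- apply: (@near_eq_is_derive R R^o R^o (fun y => y^-1 ^+ n * expR (- y^-1))).
    near=> y; rewrite /psi ifT//; near: y; exact: lt_nbhsr.
  have xn0 : x != 0 by rewrite gt_eqF.
  have dV : is_derive x 1 (fun y : R => y^-1) (- x ^- 2).
    apply: DeriveDef; first exact: derivableV.
    by rewrite deriveV// derive_id [LHS]mulr1.
  have dE : is_derive x 1 (expR \o (fun y : R => - y^-1)) (expR (- x^-1) * x ^- 2).
    apply: is_derive1_comp.
    rewrite -[x ^- 2]opprK; exact: is_deriveN.
  have dX := @is_deriveX _ _ (fun y : R => y^-1) n x 1 _ dV.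
  have dM := is_deriveM dX dE.
  rewrite (_ : (fun y => _) = (fun y => y^-1) ^+ n * (expR \o (fun y => - y^-1))); last first.
    by apply/funext => y; rewrite /= [RHS]/GRing.mul/= exprfctE.
  apply: (is_derive_eq dM).
  rewrite /psi x0 exprfctE /= -[x ^- 2]exprVn /GRing.scale/=.
  case: n {dX dM} => [|n]; rewrite ?exprS/=; ring.
- apply: (@near_eq_is_derive R R^o R^o (fun=> 0)).
    near=> y; rewrite /psi ifF//; apply/negbTE; rewrite -leNgt; near: y.
    exact: lt_le_nbhsl.
  rewrite /psi ltNge ltW//= mulr0 addr0; exact: is_derive_cst.
- have cv : h^-1 *: ((psi n \o shift 0) h%:A - psi n 0) @[h --> 0^'] --> (0 : R).
    apply/cvgrPdist_le => e e0; near=> h.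
    have h0 : h != 0 by near: h; exact: nbhs_dnbhs_neq.
    rewrite sub0r normrN /= addr0 [in psi n 0]/psi ltxx subr0.
    rewrite -[h%:A]/(h * 1) mulr1 -[_ *: _]/(h^-1 * psi n h) normrM normfV.
    rewrite ler_pdivrMl ?normr_gt0// (le_trans (psi_le_sqr _ _))//.
    rewrite -real_normK ?num_real// expr2 mulrCA ler_wpM2l// mulrC.
    rewrite -ler_pdivlMr ?ltr0n ?fact_gt0//; near: h.
    apply: dnbhs0_le; rewrite divr_gt0// ltr0n fact_gt0//.
  apply: DeriveDef; first by apply/cvg_ex; exists 0.
  by rewrite /derive (cvg_lim _ cv)// /psi ltxx mulr0 addr0.
Unshelve. all: by end_near. Qed.

End smooth_functions.

Section smooth_class.
Context {R : realType} {V : normedModType R}.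

(* A class of everywhere differentiable functions that is stable under directional derivatives. *)
Inductive elementary : (V -> R) -> Prop :=
| elementary_cst c : elementary (fun=> c)
| elementary_linear f : (forall x, differentiable f x) ->
    (forall v, exists c, forall x, 'D_v f x = c) -> elementary f
| elementaryD f g : elementary f -> elementary g ->
    elementary (fun x => f x + g x)
| elementaryM f g : elementary f -> elementary g ->
    elementary (fun x => f x * g x)
| elementaryV f : elementary f -> (forall x, f x != 0) ->
    elementary (fun x => (f x)^-1)
| elementary_psi n f : elementary f -> elementary (fun x => psi n (f x)).

Lemma differentiable_psi n (x : R) : differentiable (psi n : R -> R) x.
Proof. by apply/derivable1_diffP; have [] := is_derive_psi n x. Qed.

Lemma elementary_differentiable f x : elementary f -> differentiable f x.
Proof.
move=> ef; elim: ef x => {f}.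
- by move=> c x; exact: differentiable_cst.
- by [].
- by move=> f g _ df _ dg x; exact: differentiableD.
- by move=> f g _ df _ dg x; exact: differentiableM.
- by move=> f _ df f0 x; exact: differentiableV.
- move=> n f _ df x.
  apply: (@differentiable_comp _ _ _ _ f (psi n)) => //.
  exact: differentiable_psi.
Qed.

Lemma derive_comp1 (f : V -> R) (g : R -> R) x v dg :
  differentiable f x -> is_derive (f x) 1 g dg ->
  'D_v (fun y => g (f y)) x = dg * 'D_v f x.
Proof.
move=> df [dg1 <-]; have dg' : differentiable g (f x) by exact/derivable1_diffP.
rewrite (deriveE _ (differentiable_comp df dg')) diff_comp//= -(deriveE _ df).
by rewrite diff1E//= derive1E mulrC.
Qed.

(** By induction on the construction of [f]: each differentiation rule produces only the operations
    of the class, and the [psi] case closes because the derivative of [psi n] combines [psi n.+1]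
    and [psi n.+2]. *)
Lemma elementary_derive f v : elementary f ->
  exists2 g, elementary g & 'D_v f = g.
Proof.
elim=> {f}.
- move=> c; exists (fun=> 0); first exact: elementary_cst.
  by apply/funext => x; exact: derive_cst.
- move=> f df /(_ v) [c fc]; exists (fun=> c); first exact: elementary_cst.
  exact/funext.
- move=> f g ef [f' ef' f'E] eg [g' eg' g'E].
  exists (fun x => f' x + g' x); first exact: elementaryD.
  apply/funext => x; rewrite -f'E -g'E.
  by apply: deriveD; apply: diff_derivable; exact: elementary_differentiable.
- move=> f g ef [f' ef' f'E] eg [g' eg' g'E].
  exists (fun x => f x * g' x + g x * f' x).
    by apply: elementaryD; exact: elementaryM.
  apply/funext => x; rewrite -f'E -g'E.
  by apply: deriveM; apply: diff_derivable; exact: elementary_differentiable.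
- move=> f ef [f' ef' f'E] f0.
  exists (fun x => (-1 * ((f x)^-1 * (f x)^-1)) * f' x).
    by repeat first [exact: elementary_cst|apply: elementaryM|apply: elementaryV].
  apply/funext => x; rewrite -f'E deriveV//; last first.
    by apply: diff_derivable; exact: elementary_differentiable.
  by rewrite mulN1r -exprVn expr2.
- move=> n f ef [f' ef' f'E].
  exists (fun x => (- n%:R * psi n.+1 (f x) + psi n.+2 (f x)) * f' x).
    by repeat first [exact: elementary_cst|apply: elementaryM|apply: elementaryD|
      apply: elementary_psi].
  apply/funext => x; rewrite -f'E; apply: derive_comp1.
    exact: elementary_differentiable.
  exact: is_derive_psi.
Qed.

Lemma elementary_smooth f : elementary f -> smooth f.
Proof.
move=> ef vs; suff : elementary (iterD vs f).
  by move=> ? x; apply: elementary_differentiable.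
by elim: vs => //= v vs /(elementary_derive _ v)[g eg ->].
Qed.

End smooth_class.

Section bump.
Context {R : realType}.

(** The numerator vanishes for |x| >= 2, the other term of the denominator for |x| <= 1. They never
    vanish together, which keeps the quotient in the class [elementary]. *)
Definition bump (x : R) : R :=
  psi 0 (4 - x * x) * (psi 0 (4 - x * x) + psi 0 (x * x - 1))^-1.

Let bump_den (x : R) : 0 < psi 0 (4 - x * x) + psi 0 (x * x - 1).
Proof.
have [h|h] := ltP (x * x) 4.
  by rewrite ltr_pwDl ?psi_ge0// psi_gt0 subr_gt0.
by rewrite ltr_wpDl ?psi_ge0// psi_gt0; lra.
Qed.

Lemma bump1 x : `|x| <= 1 -> bump x = 1.
Proof.
move=> x1; have h : x * x <= 1.
  by rewrite -expr2 -real_normK ?num_real// expr_le1.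
have p0 : psi 0 (x * x - 1) = 0 by rewrite /psi ltNge subr_le0 h.
rewrite /bump p0 addr0 divff// gt_eqF// psi_gt0; lra.
Qed.

Lemma bump0 x : 2 <= `|x| -> bump x = 0.
Proof.
move=> x2; have h : 4 <= x * x.
  rewrite -expr2 -real_normK ?num_real//.
  have -> : 4 = 2 ^+ 2 :> R by rewrite expr2; lra.
  by rewrite lerXn2r ?nnegrE.
by rewrite /bump {1}/psi ltNge subr_le0 h/= mul0r.
Qed.

Lemma bump_ge0 x : 0 <= bump x.
Proof. by rewrite mulr_ge0 ?psi_ge0// invr_ge0 ltW. Qed.

Lemma elementary_bump (V : normedModType R) (f : V -> R) :
  elementary f -> elementary (fun x => bump (f x)).
Proof.
move=> ef.
have e1 : elementary (fun x => psi 0 (4 - f x * f x)).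
  apply: elementary_psi; apply: elementaryD; first exact: elementary_cst.
  rewrite (_ : (fun x => _) = (fun x => -1 * (f x * f x))).
    by repeat first [exact: elementary_cst|apply: elementaryM].
  by apply/funext => x; rewrite mulN1r.
apply: elementaryM => //; apply: elementaryV; last by move=> x; rewrite gt_eqF.
apply: elementaryD => //; apply: elementary_psi; apply: elementaryD.
  exact: elementaryM.
exact: elementary_cst.
Qed.

(* Equals [x] near [0], with compact support. *)
Definition cut_id (x : R) : R := x * bump x.

Lemma elementary_id : elementary (fun x : R => x).
Proof.
apply: elementary_linear => // v; exists v => x.
exact: (derive_id (V := R^o)).
Qed.

Lemma elementary_cut_id (V : normedModType R) (f : V -> R) :
  elementary f -> elementary (fun x => cut_id (f x)).
Proof. by move=> ef; apply: elementaryM => //; exact: elementary_bump. Qed.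

(** One name for both profiles: the tested coordinate gets [cut_id], the other one [bump], and the
    estimates need no case distinction. *)
Definition cut_off (i : bool) : R -> R := if i then cut_id else bump.

Lemma cut_off0 i x : 2 <= `|x| -> cut_off i x = 0.
Proof. by case: i => /bump0 h; rewrite /cut_off//= /cut_id h mulr0. Qed.

Lemma elementary_cut_off i (V : normedModType R) (f : V -> R) :
  elementary f -> elementary (fun x => cut_off i (f x)).
Proof. by case: i; [exact: elementary_cut_id|exact: elementary_bump]. Qed.

Lemma smooth_cut_off i : smooth (cut_off i).
Proof. exact/elementary_smooth/elementary_cut_off/elementary_id. Qed.

Lemma derivable_cut_off i x : derivable (cut_off i) x 1.
Proof. by apply/diff_derivable; exact: (smooth_cut_off i [::]). Qed.

Lemma derive_cut_off0 i x : 2 < `|x| -> 'D_1 (cut_off i) x = 0.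
Proof.
move=> x2; rewrite (@near_eq_derive R R^o R^o _ (fun=> 0)) ?(derive_cst (V:=R^o) (W:=R^o))//.
near=> y; rewrite cut_off0// ltW//; near: y.
have : {for x, continuous (fun y : R => `|y|)} by exact: norm_continuous.
by move=> /cvgr_gt; exact.
Unshelve. all: by end_near. Qed.

Lemma derive_bump x : `|x| < 1 -> 'D_1 (cut_off false) x = 0.
Proof.
move=> x1; rewrite (@near_eq_derive R R^o R^o _ (fun=> 1)) ?(derive_cst (V:=R^o) (W:=R^o))//.
near=> y; rewrite /cut_off bump1// ltW//; near: y.
have : {for x, continuous (fun y : R => `|y|)} by exact: norm_continuous.
by move=> /cvgr_lt; exact.
Unshelve. all: by end_near. Qed.

Lemma derive_cut_id x : `|x| < 1 -> 'D_1 (cut_off true) x = 1.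
Proof.
move=> x1; rewrite (@near_eq_derive R R^o R^o _ id) ?derive_id//.
near=> y; rewrite /cut_off /cut_id bump1 ?mulr1// ltW//; near: y.
have : {for x, continuous (fun y : R => `|y|)} by exact: norm_continuous.
by move=> /cvgr_lt; exact.
Unshelve. all: by end_near. Qed.

Lemma cut_off_bounded : exists2 M : R, 0 < M & forall i x,
  `|cut_off i x| <= M /\ `|'D_1 (cut_off i) x| <= M.
Proof.
(* 3 and not 2, because the derivative is known to vanish only where |x| > 2 strictly. *)
have bnd (f : R -> R) : continuous f -> (forall x, 3 <= `|x| -> f x = 0) ->
    exists2 M : R, 0 < M & forall x, `|f x| <= M.
  move=> cf f0.
  have : compact (f @` `[-3, 3]).
    apply: continuous_compact; last exact: segment_compact.
    exact: continuous_subspaceT.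
  move/compact_bounded => [M [_ /(_ (Num.max 1 (M + 1)))]].
  rewrite lt_max ltrDl ltr01 orbT => /(_ isT) h.
  exists (Num.max 1 (M + 1)); first by rewrite lt_max ltr01.
  move=> x; have [x3|x3] := leP `|x| 3.
    by apply: h; exists x => //=; rewrite in_itv/= -ler_norml.
  by rewrite f0 ?normr0 ?le_max ?ler01// ltW.
have c1 i : continuous (cut_off i).
  by move=> x; apply: differentiable_continuous; exact: (smooth_cut_off i [::]).
have c2 i : continuous ('D_1 (cut_off i)).
  by move=> x; apply: differentiable_continuous; exact: (smooth_cut_off i [:: 1]).
have b i : exists2 M : R, 0 < M & forall x, `|cut_off i x| <= M /\ `|'D_1 (cut_off i) x| <= M.
  have [|M1 M10 hM1] := bnd _ (c1 i).
    by move=> x x3; rewrite cut_off0//; lra.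
  have [|M2 M20 hM2] := bnd _ (c2 i).
    by move=> x x3; rewrite derive_cut_off0//; lra.
  exists (M1 + M2); first by rewrite addr_gt0.
  by move=> x; have := hM1 x; have := hM2 x; lra.
have [M1 M10 hM1] := b true; have [M2 M20 hM2] := b false.
exists (M1 + M2); first by rewrite addr_gt0.
by move=> [] x; [have := hM1 x|have := hM2 x]; lra.
Qed.

End bump.

Section slice_derivatives.
Context {R : realType} {U V W : normedModType R}.

Lemma derive_slicel (f : U * V -> W) u x y :
  'D_(u, 0) f (x, y) = 'D_u (fun s => f (s, y)) x.
Proof.
rewrite /derive; set F := (fun h => _); set G := (fun h => _).
rewrite (_ : F = G)//; apply/funext => h; rewrite /F /G /=.
by rewrite [_ + (x, y)]surjective_pairing /= scaler0 add0r.
Qed.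

Lemma derive_slicer (f : U * V -> W) v x y :
  'D_(0, v) f (x, y) = 'D_v (fun s => f (x, s)) y.
Proof.
rewrite /derive; set F := (fun h => _); set G := (fun h => _).
rewrite (_ : F = G)//; apply/funext => h; rewrite /F /G /=.
by rewrite [_ + (x, y)]surjective_pairing /= scaler0 add0r.
Qed.

End slice_derivatives.

Lemma elementary_linear_map {R : realType} {V : normedModType R}
    (f : {linear V -> R^o}) : continuous f -> elementary f.
Proof.
move=> cf; apply: elementary_linear => [x|v]; first exact: linear_differentiable.
exists (f v) => x; rewrite deriveE; last exact: linear_differentiable.
by rewrite diff_lin.
Qed.

(** * The localized test function and its scale-invariant bounds *)

Section localized_test_function.
Context {R : realType}.

Lemma derive_rescaled_cut_off i (a b c k t : R) :
  'D_1 (fun s => a * cut_off i ((s - b) / c) * k) t =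
  a * ('D_1 (cut_off i) ((t - b) / c) / c) * k.
Proof.
have da x : differentiable (fun s : R => (s - b) / c) x.
  by apply: elementary_differentiable; apply: elementaryM;
    [apply: elementaryD; [exact: elementary_id|]|]; exact: elementary_cst.
have dc x : derivable (fun s => cut_off i ((s - b) / c)) x 1.
  apply: diff_derivable.
  apply: (@differentiable_comp _ _ _ _ (fun s : R => (s - b) / c) (cut_off i)) => //.
  exact: (smooth_cut_off i [::]).
have dcE : 'D_1 (fun s => cut_off i ((s - b) / c)) t = 'D_1 (cut_off i) ((t - b) / c) / c.
  have H : is_derive ((t - b) / c) 1 (cut_off i) ('D_1 (cut_off i) ((t - b) / c)).
    by apply: DeriveDef => //; exact: derivable_cut_off.
  rewrite (derive_comp1 (V := R^o) _ _ _ _ _ (da t) H); congr (_ * _).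
  rewrite (_ : (fun s : R => (s - b) / c) = c^-1 \o* (fun s : R => s - b)); last exact/funext.
  rewrite deriveMr; last first.
    by apply: derivableB; [exact: derivable_id|exact: derivable_cst].
  rewrite deriveB; [|exact: derivable_id|exact: derivable_cst].
  by rewrite derive_id derive_cst subr0 mulr1.
rewrite (_ : (fun s => a * cut_off i ((s - b) / c) * k) =
  (a * k) \*o (fun s => cut_off i ((s - b) / c))); last first.
  by apply/funext => s /=; rewrite mulrAC.
by rewrite deriveMl// dcE mulrAC.
Qed.

Variables (l d t0 : R) (z : plane R) (i : 'I_2).
Hypotheses (l0 : 0 < l) (d0 : 0 < d).

(** On the square of half-side d around z this is x_i - z_i times a bump in time. The prefactor d
    cancels the 1/d of each space derivative, and turns the 1/(l d) of the time derivative into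
    1/l. *)
Definition localized (w : R * plane R) : R :=
  d * bump ((w.1 - t0) / (l * d)) *
  (cut_off (i == ord0) ((w.2.1 - z.1) / d) *
   cut_off (i != ord0) ((w.2.2 - z.2) / d)).

Let ld0 : 0 < l * d. Proof. exact: mulr_gt0. Qed.

Lemma localized_smooth : smooth localized.
Proof.
apply: elementary_smooth.
have e1 : elementary (fun w : R * plane R => w.1).
  exact: (elementary_linear_map (fst : {linear _ -> R^o}) (fun x => cvg_fst)).
have e2 : elementary (fun w : R * plane R => w.2.1).
  apply: (elementary_linear_map (fst \o snd : {linear _ -> R^o})) => x.
  by apply: continuous_comp; [exact: cvg_snd|exact: cvg_fst].
have e3 : elementary (fun w : R * plane R => w.2.2).
  apply: (elementary_linear_map (snd \o snd : {linear _ -> R^o})) => x.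
  by apply: continuous_comp; exact: cvg_snd.
have ea (f : R * plane R -> R) b c : elementary f -> elementary (fun w => (f w - b) / c).
  by move=> ef; apply: elementaryM; [apply: elementaryD => //|]; exact: elementary_cst.
apply: elementaryM.
  by apply: elementaryM; [exact: elementary_cst|apply: elementary_bump; exact: ea].
by apply: elementaryM; apply: elementary_cut_off; exact: ea.
Qed.

Lemma localized_dt t x : 'D_(1, 0) localized (t, x) =
  l^-1 * 'D_1 (cut_off false) ((t - t0) / (l * d)) *
  (cut_off (i == ord0) ((x.1 - z.1) / d) * cut_off (i != ord0) ((x.2 - z.2) / d)).
Proof.
rewrite derive_slicel.
rewrite (_ : (fun s => _) = (fun s => d * cut_off false ((s - t0) / (l * d)) *
  (cut_off (i == ord0) ((x.1 - z.1) / d) * cut_off (i != ord0) ((x.2 - z.2) / d))))//.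
rewrite derive_rescaled_cut_off; field.
by rewrite !gt_eqF.
Qed.

Lemma localized_grad t x : grad (fun x => localized (t, x)) x =
  (bump ((t - t0) / (l * d)) * ('D_1 (cut_off (i == ord0)) ((x.1 - z.1) / d) *
     cut_off (i != ord0) ((x.2 - z.2) / d)),
   bump ((t - t0) / (l * d)) * (cut_off (i == ord0) ((x.1 - z.1) / d) *
     'D_1 (cut_off (i != ord0)) ((x.2 - z.2) / d))).
Proof.
case: x => x1 x2; rewrite /grad /basis /= derive_slicel derive_slicer /localized/=.
congr (_, _).
  under eq_fun do rewrite mulrA.
  by rewrite derive_rescaled_cut_off; field; rewrite gt_eqF.

rewrite (_ : (fun s => _) = (fun s => d * bump ((t - t0) / (l * d)) *
  cut_off (i == ord0) ((x1 - z.1) / d) * cut_off (i != ord0) ((s - z.2) / d) * 1)).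
  by rewrite derive_rescaled_cut_off; field; rewrite gt_eqF.
by apply/funext => s; rewrite mulr1 mulrA.
Qed.

Lemma localized_off_support t x :
  2 * (l * d) < `|t - t0| \/ 2 * d < sup_norm (x - z) ->
  [/\ localized (t, x) = 0, 'D_(1, 0) localized (t, x) = 0 &
    grad (fun x => localized (t, x)) x = 0].
Proof.
have big (c y : R) : 0 < c -> 2 * c < `|y| -> 2 < `|y / c|.
  by move=> c0; rewrite normrM normfV (gtr0_norm c0) ltr_pdivlMr.
rewrite localized_dt localized_grad /localized/=.
case=> [/(big _ _ ld0) tb|].
  have b0 : bump ((t - t0) / (l * d)) = 0 by rewrite bump0// ltW.
  by rewrite b0 (derive_cut_off0 false _ tb); split; rewrite ?mulr0 ?mul0r.
rewrite /sup_norm lt_max => /orP[] /(big _ _ d0) xb.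
  rewrite (cut_off0 _ _ (ltW xb)) (derive_cut_off0 _ _ xb).
  by split; rewrite ?mul0r ?mulr0.
rewrite (cut_off0 _ _ (ltW xb)) (derive_cut_off0 _ _ xb).
by split; rewrite ?mul0r ?mulr0.
Qed.

Lemma localized_grad_near t x : sup_norm (x - z) < d ->
  grad (fun x => localized (t, x)) x = bump ((t - t0) / (l * d)) *: basis i.
Proof.
have small (c y : R) : 0 < c -> `|y| < c -> `|y / c| < 1.
  by move=> c0; rewrite normrM normfV (gtr0_norm c0) ltr_pdivrMr ?mul1r.
rewrite /sup_norm gt_max => /andP[/(small _ _ d0) h1 /(small _ _ d0) h2].
have {}h1 : `|(x.1 - z.1) / d| < 1 := h1.
have {}h2 : `|(x.2 - z.2) / d| < 1 := h2.
rewrite localized_grad /basis; case: (i == ord0) => /=.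
  rewrite (derive_cut_id _ h1 : 'D_1 cut_id _ = 1) (derive_bump _ h2 : 'D_1 bump _ = 0).
  rewrite (bump1 _ (ltW h2)).
  rewrite !mulr1 !mulr0 [RHS]surjective_pairing /=.
  by congr (_, _); [exact: (esym (mulr1 _))|exact: (esym (mulr0 _))].
rewrite (derive_cut_id _ h2 : 'D_1 cut_id _ = 1) (derive_bump _ h1 : 'D_1 bump _ = 0).
rewrite (bump1 _ (ltW h1)).
rewrite mul0r !mulr1 !mulr0 [RHS]surjective_pairing /=.
by congr (_, _); [exact: (esym (mulr0 _))|exact: (esym (mulr1 _))].
Qed.

Lemma localized_test_function : test_function setT localized.
Proof.
pose I (a e : R) := `[a - e, a + e]%classic.
pose K := I t0 (2 * (l * d)) `*` (I z.1 (2 * d) `*` I z.2 (2 * d)).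
have cK : compact K.
  by repeat apply: compact_setX; exact: segment_compact.
have sK : closure [set w | localized w != 0] `<=` K.
  have -> : K = closure K.
    apply/closure_id; apply: compact_closed => //.
  apply: closureS => -[t x] /= /eqP ne.
  have [h|h] := ltP (2 * (l * d)) `|t - t0|.
    by case: ne; have [] := localized_off_support t x (or_introl h).
  have [h'|h'] := ltP (2 * d) (sup_norm (x - z)).
    by case: ne; have [] := localized_off_support t x (or_intror h').
  have itvP (a e y : R) : `|y - a| <= e -> I a e y.
    by rewrite /I/= in_itv/= ler_norml => /andP[? ?]; apply/andP; split; lra.
  move: h'; rewrite /sup_norm ge_max => /andP[h1 h2].
  by split; [exact: itvP|split; exact: itvP].
split => //; first exact: localized_smooth.
by apply: subclosed_compact sK => //; exact: closed_closure.
Qed.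

End localized_test_function.

(** The point is the order of quantifiers: [M] comes from the fixed profiles alone and survives the
    limit d -> 0. *)
Lemma localized_bounded {R : realType} : exists2 M : R, 0 < M &
  forall l d t0 (z : plane R) i t x, 0 < l -> 0 < d ->
    `|'D_(1, 0) (localized l d t0 z i) (t, x)| <= M / l /\
    forall j, `|coord j (grad (fun x => localized l d t0 z i (t, x)) x)| <= M.
Proof.
have [M M0 hM] := @cut_off_bounded R; exists (M * (M * M)); first by rewrite !mulr_gt0.
move=> l d t0 z i t x l0 d0.
have h a b c : `|a| <= M -> `|b| <= M -> `|c| <= M -> `|a * (b * c)| <= M * (M * M).
  by move=> a1 b1 c1; rewrite !normrM !ler_pM ?mulr_ge0.
have hb (i' : bool) y : `|cut_off i' y| <= M by have [] := hM i' y.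
have hd (i' : bool) y : `|'D_1 (cut_off i') y| <= M by have [] := hM i' y.
split.
  rewrite localized_dt// -mulrA normrM mulrC normfV (gtr0_norm l0).
  by rewrite ler_wpM2r ?invr_ge0 ?(ltW l0)// h.
move=> j; rewrite localized_grad// /coord/=.
have hb' y : `|bump y| <= M := hb false y.
by case: (j == ord0) => /=; apply: h.
Qed.

(** * Real-valued integrals: domination, bounds, Fubini *)

Section real_integrals.
Context d (T : measurableType d) (R : realType).
Variables (m : {measure set T -> \bar R}) (D : set T).
Hypothesis mD : measurable D.
Local Notation mint f := (m.-integrable D (fun x => (f x)%:E)).
Implicit Types f g h : T -> R.

Lemma integrable_le f g : measurable_fun D f ->
  (forall x, D x -> `|f x| <= g x) -> mint g -> mint f.
Proof.
move=> mf fg; apply: le_integrable => //; first exact/measurable_EFinP.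
move=> x Dx /=; rewrite lee_fin; apply: le_trans (fg _ Dx) (ler_norm _).
Qed.

Lemma integrable_norm f : mint f -> mint (fun x => `|f x|).
Proof.
move=> mf; apply: (@le_integrable _ _ _ m D mD _ (fun x => (f x)%:E)) => //.
  apply/measurable_EFinP; apply: measurableT_comp => //.
  exact/measurable_EFinP/(measurable_int m mf).
by move=> x _; rewrite /= normr_id.
Qed.

Lemma integrable_realD f g : mint f -> mint g -> mint (fun x => f x + g x).
Proof. by move=> fi gi; have := integrableD mD fi gi; apply: eq_integrable. Qed.

Lemma integrable_realB f g : mint f -> mint g -> mint (fun x => f x - g x).
Proof. by move=> fi gi; have := integrableB mD fi gi; apply: eq_integrable. Qed.

Lemma integrable_realZl k f : mint f -> mint (fun x => k * f x).
Proof. by move=> fi; have := integrableZl mD k fi; apply: eq_integrable. Qed.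

Lemma integrable_bounded C f : (m D < +oo)%E -> measurable_fun D f ->
  (forall x, D x -> `|f x| <= C) -> mint f.
Proof.
move=> mDoo mf fC; apply: measurable_bounded_integrable => //.
exists C; split; first exact: num_real.
by move=> M CM x Dx /=; rewrite (le_trans (fC _ Dx))// ltW.
Qed.

Lemma integrableM_bounded C f g : mint f -> measurable_fun D g ->
  (forall x, D x -> `|g x| <= C) -> mint (fun x => f x * g x).
Proof.
move=> fi mg gC; apply: (@integrable_le _ (fun x => C * `|f x|)).
- apply: measurable_funM => //; exact/measurable_EFinP/(measurable_int m fi).
- by move=> x Dx; rewrite normrM mulrC ler_wpM2r// gC.
- by apply: integrable_realZl; exact: integrable_norm.
Qed.

Lemma integrable_realP f : measurable_fun D f ->
  mint f <-> (\int[m]_(x in D) `|f x|%:E < +oo)%E.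
Proof.
move=> mf; split=> [/integrableP[_]//|h]; apply/integrableP; split => //.
exact/measurable_EFinP.
Qed.

Lemma EFin_Rintegral f : mint f ->
  (\int[m]_(x in D) f x)%:E = (\int[m]_(x in D) (f x)%:E)%E.
Proof. by move=> fi; rewrite fineK// integrable_fin_num. Qed.

Lemma Rintegral_norm_le_bound C f : mint f ->
  (\int[m]_(x in D) `|f x|%:E <= C%:E)%E -> `|\int[m]_(x in D) f x| <= C.
Proof.
move=> fi fC; rewrite (le_trans (le_normr_Rintegral mD fi))//.
by rewrite -lee_fin EFin_Rintegral//; exact: integrable_norm.
Qed.

End real_integrals.

(** Integrability of every section, not of almost every one, allows [fine] to be removed from each
    inner integral pointwise. *)
Lemma Rintegral_Fubini d (T : measurableType d) (R : realType)
    (m : {finite_measure set T -> \bar R}) (G : T * T -> R) :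
  (m \x m)%E.-integrable setT (EFin \o G) ->
  (forall y, m.-integrable setT (fun x => (G (x, y))%:E)) ->
  (forall x, m.-integrable setT (fun y => (G (x, y))%:E)) ->
  \int[m]_y \int[m]_x G (x, y) = \int[m]_x \int[m]_y G (x, y).
Proof.
move=> iG iy ix; have F := Fubini iG.
have -> : \int[m]_y \int[m]_x G (x, y) = fine (\int[m]_y \int[m]_x (G (x, y))%:E)%E.
  by congr fine; apply: eq_integral => y _; rewrite EFin_Rintegral.
rewrite -[in LHS]F; congr fine.
by apply: eq_integral => x _; rewrite EFin_Rintegral.
Qed.

(** * Symmetrization of the quadratic form *)

Section symmetrization.
Context {R : realType}.
Variable m : {finite_measure set (mplane R) -> \bar R}.
Local Notation K i x y := (coord i (kernelK (x - y))).

Lemma kernelKN (z : plane R) : kernelK (- z) = - kernelK z.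
Proof.
rewrite /kernelK (_ : dot (- z) (- z) = dot z z) ?scalerN//.
by rewrite /dot /= !mulrNN.
Qed.

Lemma coordN i (z : plane R) : coord i (- z) = - coord i z.
Proof. by rewrite /coord; case: ifP. Qed.

Lemma KC i (x y : plane R) : K i y x = - K i x y.
Proof. by rewrite -opprB kernelKN coordN. Qed.

Lemma measurable_K d (T : measurableType d) i (f g : T -> mplane R) :
  measurable_fun setT f -> measurable_fun setT g ->
  measurable_fun setT (fun t => K i (f t) (g t)).
Proof.
by move=> mf mg; apply: measurable_coord_kernelK; exact: measurable_plane_funB.
Qed.

Hypothesis K1 : forall x i, m.-integrable setT (fun y => (K i x y)%:E).
Hypothesis K2 : forall i, (\int[m]_x \int[m]_y `|K i x y|%:E < +oo)%E.

Variables (Phi : plane R -> R) (C : R).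
Hypothesis mPhi : forall i,
  measurable_fun (setT : set (mplane R)) (fun x => coord i (grad Phi x)).
Hypothesis PhiC : forall i x, `|coord i (grad Phi x)| <= C.

(** The unsymmetrized kernel: perp K(x - y) . grad Phi(x). *)
Let G (z : mplane R * mplane R) : R :=
  K ord0 z.1 z.2 * coord ord_max (grad Phi z.1) -
  K ord_max z.1 z.2 * coord ord0 (grad Phi z.1).

Let W (x : plane R) : R := dot (perp (convK (fun g => \int[m]_y g y) x)) (grad Phi x).

Let mK i : measurable_fun setT (fun z : mplane R * mplane R => K i z.1 z.2).
Proof. by apply: measurable_K. Qed.

Let mPhi1 i : measurable_fun setT
  (fun z : mplane R * mplane R => coord i (grad Phi z.1)).
Proof. by apply: (measurableT_comp (mPhi i)). Qed.

Let intK i : (m \x m)%E.-integrable setT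
  (fun z : mplane R * mplane R => (K i z.1 z.2)%:E).
Proof.
apply/(integrable12ltyP m m) => /=; last exact: K2.
exact/measurable_EFinP.
Qed.

Let intG : (m \x m)%E.-integrable setT (EFin \o G).
Proof.
by apply: integrable_realB => //; apply: (integrableM_bounded _ _ _ _ _ measurableT C) => //.
Qed.

(** The kernel is odd, so the term carrying grad Phi(y) is [G] with its arguments exchanged. On the
    diagonal both sides are 0, the default value of [kernelK] at 0 agreeing with that of
    [H_kernel]. *)
Let H_kernelE x y : H_kernel Phi x y = G (x, y) + G (y, x).
Proof.
have KE : (dot (x - y) (x - y))^-1 *: perp (x - y) = perp (kernelK (x - y)).
  rewrite [LHS]surjective_pairing [RHS]surjective_pairing /=.
  by congr (_, _); rewrite -mulrN.
rewrite /G /= (KC ord0 x y) (KC ord_max x y) /H_kernel KE.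
case: eqP => [->|_]; last by rewrite /dot /perp /coord /=; ring.
by rewrite subrr (_ : kernelK 0 = 0 :> plane R) ?/kernelK ?scaler0// /coord /=; ring.
Qed.

Let intKZ i x c : m.-integrable setT (fun y => (K i x y * c)%:E).
Proof.
have := integrable_realZl _ _ _ _ _ measurableT c _ (K1 x i).
by apply: eq_integrable => // y _; rewrite mulrC.
Qed.

Let W_int x : \int[m]_y G (x, y) = W x.
Proof.
rewrite /G /= RintegralB//; [|exact: intKZ..].
rewrite !RintegralZr//; [|exact: K1..].
by rewrite /W /convK /dot /perp /= /coord /=; ring.
Qed.

Let intGx x : m.-integrable setT (fun y => (G (x, y))%:E).
Proof.
have H := integrable_realB _ _ _ m _ measurableT _ _
  (intKZ ord0 x (coord ord_max (grad Phi x))) (intKZ ord_max x (coord ord0 (grad Phi x))).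
exact: H.
Qed.

Let intGy y : m.-integrable setT (fun x => (G (x, y))%:E).
Proof.
have h i : m.-integrable setT (fun x => (K i x y)%:E).
  have := integrable_realZl _ _ _ _ _ measurableT (-1) _ (K1 y i).
  by apply: eq_integrable => // x _; rewrite mulN1r -KC.
have hM i j := integrableM_bounded _ _ _ m _ measurableT C _ _ (h i) (mPhi j)
  (fun x _ => PhiC j x).
have H := integrable_realB _ _ _ m _ measurableT _ _ (hM ord0 ord_max) (hM ord_max ord0).
exact: H.
Qed.

Let intW : m.-integrable setT (EFin \o W).
Proof.
have := integrable_fubini_F intG; apply: eq_integrable => // x _.
by rewrite /fubini_F /= -W_int EFin_Rintegral.
Qed.

(** By Fubini the two copies of [G] have the same double integral, which absorbs the factor 1/2.
    Atoms of [m] are allowed: they do not act on themselves, since the kernel is 0 on the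
    diagonal. *)
Lemma H_form_velocity : H_form Phi m m = \int[m]_x W x.
Proof.
rewrite /H_form.
have -> : \int[m]_y \int[m]_x H_kernel Phi x y = \int[m]_y (\int[m]_x G (x, y) + W y).
  apply: eq_Rintegral => y _; rewrite -W_int -RintegralD//.
  - by apply: eq_Rintegral => x _; exact: H_kernelE.
  - exact: intGy.
  - exact: intGx.
have intF : m.-integrable setT (fun y => (\int[m]_x G (x, y))%:E).
  have intGs : (m \x m)%E.-integrable setT (EFin \o (fun z => G (z.2, z.1))).
    have hK i : (m \x m)%E.-integrable setT
        (fun z : mplane R * mplane R => (K i z.2 z.1)%:E).
      have := integrable_realZl _ _ _ _ _ measurableT (-1) _ (intK i).
      by apply: eq_integrable => // z _; rewrite mulN1r -KC.
    have hM i j := integrableM_bounded _ _ _ _ _ measurableT C _ _ (hK i)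
      (measurableT_comp (mPhi j) measurable_snd) (fun z _ => PhiC j z.2).
    have H := integrable_realB _ _ _ _ _ measurableT _ _ (hM ord0 ord_max) (hM ord_max ord0).
    exact: H.
  have := integrable_fubini_F intGs; apply: eq_integrable => // x _.
  by rewrite /fubini_F /= EFin_Rintegral.
rewrite RintegralD//.
rewrite (Rintegral_Fubini _ _ _ m G intG intGy intGx).
by under [X in 2^-1 * (X + _)]eq_Rintegral do rewrite W_int; field.
Qed.

End symmetrization.

(** * The field of a diffuse part together with point charges *)

Section density_plus_points.
Context {R : realType} (N : nat).
Variables (mu : {finite_measure set (mplane R) -> \bar R}) (z : 'I_N -> plane R).
Local Notation K i x y := (coord i (kernelK (x - y))).

Definition total_measure : {finite_measure set (mplane R) -> \bar R} :=
  finite_add mu (sum_dirac z).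

Local Notation m := total_measure.

Let ge0_integral_sum_dirac (f : mplane R -> \bar R) : measurable_fun setT f ->
  (forall x, 0 <= f x)%E -> (\int[sum_dirac z]_x f x = \sum_(a < N) f (z a))%E.
Proof.
move=> mf f0; rewrite [LHS](ge0_integral_measure_sum _ measurableT)//.
by apply: eq_bigr => a _; rewrite /dirac_nth valK integral_dirac// diracT mul1e.
Qed.

Lemma ge0_integral_total (f : mplane R -> \bar R) : measurable_fun setT f ->
  (forall x, 0 <= f x)%E ->
  (\int[m]_x f x = \int[mu]_x f x + \sum_(a < N) f (z a))%E.
Proof.
move=> mf f0; rewrite [LHS](ge0_integral_measure_add _ _ measurableT)//.
by rewrite ge0_integral_sum_dirac.
Qed.

Lemma integrable_total (f : mplane R -> R) :
  mu.-integrable setT (EFin \o f) -> m.-integrable setT (EFin \o f).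
Proof.
move=> fi; have mf := measurable_int mu fi.
apply/integrableP; split=> //; rewrite ge0_integral_total//; last exact: measurableT_comp.
by rewrite sumEFin /= lte_add_pinfty ?ltry//; move/integrableP : fi => [].
Qed.

Lemma Rintegral_total (f : mplane R -> R) : mu.-integrable setT (EFin \o f) ->
  \int[m]_x f x = \int[mu]_x f x + \sum_(a < N) f (z a).
Proof.
move=> fi; have mf := measurable_int mu fi.
apply: EFin_inj; rewrite EFinD EFin_Rintegral//; last exact: integrable_total.
rewrite EFin_Rintegral// [LHS]integralE [X in (_ = X + _)%E]integralE.
rewrite ge0_integral_total//; last exact: measurable_funepos.
rewrite ge0_integral_total//; last exact: measurable_funeneg.
have fp := integrable_pos_fin_num measurableT fi.
have fn := integrable_neg_fin_num measurableT fi.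
rewrite oppeD; last by rewrite fin_num_adde_defr.
rewrite addeACA; congr (_ + _)%E.
rewrite funerpos funerneg !sumEFin -EFinN -EFinD; congr EFin.
rewrite -sumrB; apply: eq_bigr => a _.
by rewrite -[in RHS](funrposBneg f).
Qed.

(** The omitted terms are those with [z a = x], where [kernelK] is 0. This gives a single formula,
    measurable in all variables, on and off the points. *)
Lemma FfieldE x : Ffield z x = \sum_(a < N) kernelK (x - z a).
Proof.
rewrite /Ffield [RHS](bigID (fun a => z a != x))/= [X in _ = _ + X]big1 ?addr0//.
by move=> a /negPn/eqP ->; rewrite subrr /kernelK scaler0.
Qed.

Lemma coordD i (x y : plane R) : coord i (x + y) = coord i x + coord i y.
Proof. by rewrite /coord; case: ifP. Qed.

Lemma coord_sum i (F : 'I_N -> plane R) :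
  coord i (\sum_a F a) = \sum_a coord i (F a).
Proof.
apply: (big_morph (coord i)); first by move=> x y; exact: coordD.
by rewrite /coord; case: ifP.
Qed.

Lemma coord_convK i (L : (plane R -> R) -> R) x :
  coord i (convK L x) = L (fun y => K i x y).
Proof. by case: i => -[|[|//]] ilt; congr (L _); apply/funext. Qed.

Variable B : R.
Hypothesis hB : forall x i, (\int[mu]_y `|K i x y|%:E <= B%:E)%E.

Let mK i x : measurable_fun (setT : set (mplane R)) (fun y : mplane R => K i x y).
Proof. exact: measurable_K. Qed.

Lemma integrable_K i x : mu.-integrable setT (fun y => (K i x y)%:E).
Proof.
by apply/integrable_realP => //; rewrite (le_lt_trans (hB x i))// ltry.
Qed.

Lemma integrable_KC i y : mu.-integrable setT (fun x => (K i x y)%:E).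
Proof.
have := integrable_realZl _ _ _ _ _ measurableT (-1) _ (integrable_K i y).
by apply: eq_integrable => // x _; rewrite mulN1r -KC.
Qed.

Lemma integral_KC i y : (\int[mu]_x `|K i x y|%:E <= B%:E)%E.
Proof.
rewrite (le_trans _ (hB y i))//; under eq_integral do rewrite KC normrN; exact: lexx.
Qed.

Lemma B_ge0 : 0 <= B.
Proof. by rewrite -lee_fin (le_trans _ (hB 0 ord0))// integral_ge0. Qed.

(** Holds at the points as well, where the self-interaction drops out by the default value of the
    kernel; this is what makes the symmetrized form produce exactly the vortex-wave velocity. *)
Lemma coord_convK_total i x : coord i (convK (fun g => \int[m]_y g y) x) =
  coord i (Efield mu x + Ffield z x).
Proof.
rewrite coordD FfieldE coord_sum !coord_convK Rintegral_total//.
exact: integrable_K.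
Qed.

Lemma coord_Efield_le i x : `|coord i (Efield mu x)| <= B.
Proof.
rewrite coord_convK; apply: Rintegral_norm_le_bound => //.
  exact: integrable_K.
exact: hB.
Qed.

Lemma measurable_Efield i :
  measurable_fun (setT : set (mplane R)) (fun x => coord i (Efield mu x)).
Proof.
under eq_fun do rewrite coord_convK.
apply: (measurable_Rintegral_family _ _ (mplane R) (mplane R) R (fun=> mu) _
  (fun w => K i w.1 w.2)) => //.
exact: measurable_K.
Qed.

Lemma integrable_real_sum d (T : measurableType d) (m' : {measure set T -> \bar R})
    (F : 'I_N -> T -> R) : (forall a, m'.-integrable setT (fun x => (F a x)%:E)) ->
  m'.-integrable setT (fun x => (\sum_a F a x)%:E).
Proof.
move=> iF; elim: (index_enum _) => [|a s IH].
  by under eq_fun do rewrite big_nil; exact: integrable0.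
under eq_fun do rewrite big_cons.
exact: (integrable_realD _ _ _ m' _ measurableT _ _ (iF a) IH).
Qed.

Lemma integrable_Ffield i : mu.-integrable setT (fun x => (coord i (Ffield z x))%:E).
Proof.
under eq_fun do rewrite FfieldE coord_sum.
by apply: integrable_real_sum => a; exact: integrable_KC.
Qed.

Lemma integrable_Efield i : mu.-integrable setT (fun x => (coord i (Efield mu x))%:E).
Proof.
apply: (integrable_bounded _ _ _ _ _ measurableT B) => //.
- by rewrite ltey_eq fin_num_measure.
- exact: measurable_Efield.
- by move=> x _; exact: coord_Efield_le.
Qed.

(** The field of the density is bounded by B everywhere. The field of each point is singular, but
    its integral against [mu] is, by oddness, a Riesz potential of [mu] at that point, again at most
    B. *)
Lemma integral_field_le i :
  (\int[mu]_x `|coord i (Efield mu x + Ffield z x)|%:E <=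
   B%:E * mu setT + (N%:R * B)%:E)%E.
Proof.
have iE := integrable_norm _ _ _ _ _ measurableT _ (integrable_Efield i).
have iF a := integrable_norm _ _ _ _ _ measurableT _ (integrable_KC i (z a)).
have iEF := integrable_realD _ _ _ mu _ measurableT _ _ iE (integrable_real_sum _ _ _ _ iF).
apply: (@le_trans _ _ (\int[mu]_x (`|coord i (Efield mu x)|%:E +
    \sum_a `|K i x (z a)|%:E))%E).
  apply: ge0_le_integral => //.
  - apply/measurable_EFinP; apply: measurableT_comp => //.
    under eq_fun do rewrite coordD.
    apply: measurable_funD; first exact: measurable_Efield.
    by have /measurable_EFinP := measurable_int mu (integrable_Ffield i).
  - have := measurable_int mu iEF; apply: eq_measurable_fun => x _.
    by rewrite /= sumEFin EFinD.
  - move=> x _; rewrite sumEFin -EFinD lee_fin coordD (le_trans (ler_normD _ _))//.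
    by rewrite lerD2l FfieldE coord_sum ler_norm_sum.
rewrite ge0_integralD//; last 3 first.
- exact: (measurable_int mu iE).
- by move=> x _; apply: sume_ge0 => a _; rewrite lee_fin.
- have := measurable_int mu (integrable_real_sum _ _ _ _ iF).
  by apply: eq_measurable_fun => x _; rewrite sumEFin.
apply: leeD.
  apply: (@le_trans _ _ (\int[mu]_x (cst B%:E x))%E).
    apply: ge0_le_integral => //; first exact: (measurable_int mu iE).
    by move=> x _; rewrite lee_fin coord_Efield_le.
  by rewrite integral_cst.
rewrite ge0_integral_sum//; last by move=> a; exact: (measurable_int mu (iF a)).
apply: (@le_trans _ _ (\sum_(a < N) B%:E)%E).
  by apply: lee_sum => a _; exact: integral_KC.
by rewrite sumEFin sumr_const card_ord mulr_natl.
Qed.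

Lemma integrable_field i :
  mu.-integrable setT (fun x => (coord i (Efield mu x + Ffield z x))%:E).
Proof.
under eq_fun do rewrite coordD.
exact: (integrable_realD _ _ _ mu _ measurableT _ _ (integrable_Efield i) (integrable_Ffield i)).
Qed.

(** The inner integral is at most B plus the finite sum of kernels centred at the points. That sum
    is integrable for [mu], and finite at the points themselves because the kernel is 0 there. *)
Lemma integral_K_total_lty i :
  (\int[m]_x \int[m]_y `|K i x y|%:E < +oo)%E.
Proof.
have iF a := integrable_norm _ _ _ _ _ measurableT _ (integrable_KC i (z a)).
have iB : mu.-integrable setT (fun x => (B + \sum_a `|K i x (z a)|)%:E).
  apply: integrable_realD => //; last exact: integrable_real_sum.
  by apply: finite_measure_integrable_cst.
have /integrableP[_] := integrable_total _ iB.
apply: le_lt_trans; apply: ge0_le_integral => //.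
- by move=> x _; exact: integral_ge0.
- apply: (measurable_fun_fubini_tonelli_F (m2 := m)
    (fun w : mplane R * mplane R => `|K i w.1 w.2|%:E)) => //.
  apply/measurable_EFinP; apply: measurableT_comp => //.
  exact: measurable_K.
- by apply: measurableT_comp => //; exact: (measurable_int mu iB).
move=> x _; rewrite ge0_integral_total//; last first.
  by apply/measurable_EFinP; exact: measurableT_comp.
rewrite sumEFin /= ger0_norm; last by rewrite addr_ge0 ?B_ge0 ?sumr_ge0.
by rewrite EFinD leeD2r.
Qed.

Section velocity_form.
Variables (Phi : plane R -> R) (C : R).
Hypothesis mPhi : forall i,
  measurable_fun (setT : set (mplane R)) (fun x => coord i (grad Phi x)).
Hypothesis PhiC : forall i x, `|coord i (grad Phi x)| <= C.

Let vel x := perp (Efield mu x + Ffield z x).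

Lemma integrable_velocity_grad :
  mu.-integrable setT (fun x => (dot (vel x) (grad Phi x))%:E).
Proof.
have iM i j := integrableM_bounded _ _ _ mu _ measurableT C _ _
  (integrable_field i) (mPhi j) (fun x _ => PhiC j x).
have := integrable_realB _ _ _ mu _ measurableT _ _ (iM ord0 ord_max) (iM ord_max ord0).
apply: eq_integrable => // x _; congr EFin.
by rewrite /dot /vel /perp /coord /=; ring.
Qed.

Lemma H_form_total : H_form Phi m m = \int[mu]_x dot (vel x) (grad Phi x) +
  \sum_(a < N) dot (vel (z a)) (grad Phi (z a)).
Proof.
rewrite (H_form_velocity m _ _ Phi C)//; last 2 first.
- by move=> x i; apply: integrable_total; exact: integrable_K.
- exact: integral_K_total_lty.
rewrite -Rintegral_total; last exact: integrable_velocity_grad.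
apply: eq_Rintegral => x _; congr (dot (perp _) _).
have e0 := coord_convK_total ord0 x; have e1 := coord_convK_total ord_max x.
by rewrite [LHS]surjective_pairing [RHS]surjective_pairing; congr (_, _).
Qed.

End velocity_form.

End density_plus_points.

(** * Integrals of functions that agree almost everywhere *)

Section almost_everywhere_integrals.
Context d (T : measurableType d) (R : realType).
Variable mu : {measure set T -> \bar R}.
Import HBNNSimple.

Lemma ae_impl (P Q : T -> Prop) : (forall x, P x -> Q x) ->
  {ae mu, forall x, P x} -> {ae mu, forall x, Q x}.
Proof. by move=> PQ; apply: (@filterS _ _ (ae_filter_ringOfSetsType mu)). Qed.

Lemma ae_and (P Q : T -> Prop) : {ae mu, forall x, P x} ->
  {ae mu, forall x, Q x} -> {ae mu, forall x, P x /\ Q x}.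
Proof. by move=> aP aQ; exact: (@filterI _ _ (ae_filter_ringOfSetsType mu)). Qed.

(* No measurability of [f] or [g] is assumed: the integral of a nonnegative function is a
   supremum over simple functions, which may be cut off on a null set. *)
Let ge0_le_integral_ae (f g : T -> \bar R) :
  (forall x, 0 <= f x)%E -> (forall x, 0 <= g x)%E ->
  {ae mu, forall x, (f x <= g x)%E} -> (\int[mu]_x f x <= \int[mu]_x g x)%E.
Proof.
move=> f0 g0 [N [mN N0 sub]]; rewrite !ge0_integralTE//.
apply: ge_ereal_sup => _ [h hf <-].
pose h' := proj_nnsfun h (measurableC mN).
have -> : sintegral mu h = sintegral mu h'.
  rewrite -!integralT_nnsfun; apply: ae_eq_integral => //.
  - by apply/measurable_EFinP.
  - by apply/measurable_EFinP.
  exists N; split => // x /= hx; apply: contrapT => Nx; apply: hx => _.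
  by rewrite mindicE mem_set ?mulr1.
apply: ereal_sup_ubound; exists h' => // x /=; rewrite mindicE.
have [Nx|Nx] := pselect (N x).
  by rewrite memNset ?mulr0//=; exact.
rewrite mem_set ?mulr1// (le_trans (hf x))//.
by apply: contrapT => fg; apply: Nx; exact: sub.
Qed.

(** Meant for the time integrands of the weak formulation, which are only known to coincide with
    measurable expressions outside a null set of times. *)
Lemma integral_ae_eq (D : set T) (f g : T -> \bar R) :
  {ae mu, forall x, D x -> f x = g x} ->
  (\int[mu]_(x in D) f x = \int[mu]_(x in D) g x)%E.
Proof.
move=> fg; rewrite integral_mkcond [RHS]integral_mkcond.
have {}fg : {ae mu, forall x, (f \_ D) x = (g \_ D) x}.
  by apply: filterS fg => x fg; rewrite /patch; case: ifPn => // /set_mem.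
rewrite integralE [RHS]integralE; congr (_ - _)%E; apply/eqP; rewrite eq_le;
  apply/andP; split; apply: ge0_le_integral_ae => //;
  by apply: filterS fg => x fg; rewrite ?funeposE ?funenegE fg lexx.
Qed.

Lemma Rintegral_ae_eq (D : set T) (f g : T -> R) :
  {ae mu, forall x, D x -> f x = g x} ->
  \int[mu]_(x in D) f x = \int[mu]_(x in D) g x.
Proof.
by move=> fg; congr fine; apply: integral_ae_eq; apply: filterS fg => x fg /fg ->.
Qed.

End almost_everywhere_integrals.

(** * Measurability of the field in time and space *)

Section time_dependence.
Context {R : realType} (N : nat).
Variables (r : R -> {finite_measure set (mplane R) -> \bar R})
          (x : 'I_N -> R -> mplane R).
Hypothesis mr : forall A, measurable A -> measurable_fun setT (r ^~ A).
Hypothesis mx : forall a, measurable_fun setT (x a).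
Local Notation K i x y := (coord i (kernelK (x - y))).

Definition field (t : R) (y : plane R) : plane R := Efield (r t) y + Ffield (x^~ t) y.

Lemma measurable_field i : measurable_fun setT
  (fun w : measurableTypeR R * mplane R => coord i (field w.1 w.2)).
Proof.
rewrite /field; under eq_fun do rewrite coordD FfieldE coord_sum coord_convK.
apply: measurable_funD.
  (* The parameter of the family is the pair of time and evaluation point; the measure depends on
     the time alone. *)
  apply: (measurable_Rintegral_family _ _ (measurableTypeR R * mplane R)%type (mplane R) R
    (fun w => r w.1) _ (fun w => K i w.1.2 w.2)).
    by move=> A mA; exact: (measurableT_comp (mr A mA) measurable_fst).
  apply: measurable_K => //.
  exact: (measurableT_comp (@measurable_snd _ _ (measurableTypeR R) (mplane R)) measurable_fst).
apply: measurable_sum => a; apply: measurable_K => //.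
exact: (measurableT_comp (mx a) measurable_fst).
Qed.

Lemma measurable_field_point i a :
  measurable_fun setT (fun t : measurableTypeR R => coord i (field t (x a t))).
Proof.
have h : measurable_fun setT (fun t : measurableTypeR R => (t, x a t)).
  by apply: measurable_fun_pair => //; exact: mx.
exact: (measurableT_comp (measurable_field i) h).
Qed.

Lemma measurable_integral_abs_field i : measurable_fun setT
  (fun t : measurableTypeR R => \int[r t]_y `|coord i (field t y)|%:E)%E.
Proof.
apply: (measurable_integral_family _ _ (measurableTypeR R) (mplane R) R r mr
  (fun w => `|coord i (field w.1 w.2)|%:E)).
apply/measurable_EFinP; apply: measurableT_comp => //; exact: measurable_field.
Qed.

Lemma measurable_time_Rintegral (g : R * plane R -> R) :
  measurable_fun (setT : set (measurableTypeR R * mplane R)) g ->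
  measurable_fun setT (fun t : measurableTypeR R => \int[r t]_y g (t, y)).
Proof.
move=> mg.
exact: (measurable_Rintegral_family _ _ (measurableTypeR R) (mplane R) R r mr).
Qed.

End time_dependence.

(** * Bounds on the field of a density with controlled box masses *)

Section controlled_densities.
Context {R : realType}.
Local Notation leb := (@lebesgue_measure R).
Local Notation K i x y := (coord i (kernelK (x - y))).

(** All that later estimates use of a time slice: total mass, decay of box masses faster than the
    side, and a uniform Riesz potential. *)
Definition controlled (theta C A B : R)
    (mu : {finite_measure set (mplane R) -> \bar R}) : Prop :=
  [/\ (mu setT <= C%:E)%E,
      forall x n, (mu (box x (2^-1 ^+ n)) <= (A * (theta / 2) ^+ n)%:E)%E &
      forall x i, (\int[mu]_y `|K i x y|%:E <= B%:E)%E].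

(** The rate [theta] depends on p only and is fixed before the horizon T; the constants may depend
    on T. [B] is the bound of [riesz_global]. *)
Lemma Linf_loc_Lp_controlled (p : \bar R)
    (rho : R -> {finite_measure set (mplane R) -> \bar R}) :
  (2%:E < p)%E -> Linf_measures C0_plane rho -> Linf_loc_Lp p rho ->
  exists2 theta : R, 0 < theta < 1 & forall T, 0 < T -> exists C A B : R,
    0 <= A /\
    {ae leb, forall t, 0 <= t <= T -> controlled theta C A B (rho t)}.
Proof.
move=> p2 [_ [C rhoC]] rhop; have [theta th01 morrey] := Lp_morrey p p2.
exists theta => // T T0; have [D rhoD] := rhop T T0.
have [A A0 hA] := morrey D.
exists C, A, (C + A * (1 + (1 - theta)^-1)); split=> //.
apply: ae_impl (ae_and _ _ _ _ _ _ rhoC rhoD) => t [hC hD] /andP[t0 tT].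
have {}hC : (rho t setT <= C%:E)%E by apply: hC; rewrite /= in_itv/= t0.
have [|g [mg g0 rhoE gD]] := hD; first by rewrite in_itv/= t0.
have bx := hA g (rho t) mg g0 rhoE gD.
split => // x i; rewrite EFinD (le_trans (riesz_global (rho t) A theta A0 th01 x i _))//.
by rewrite leeD2r.
Qed.

Section field_bounds.
Variables (N : nat) (theta C A B : R)
  (mu : {finite_measure set (mplane R) -> \bar R}) (z : 'I_N -> plane R).
Hypotheses (th01 : 0 < theta < 1) (A0 : 0 <= A).
Hypothesis cmu : controlled theta C A B mu.
Local Notation fld x := (Efield mu x + Ffield z x).

Lemma controlled_integral_field i :
  (\int[mu]_x `|coord i (fld x)|%:E <= (B * C + N%:R * B)%:E)%E.
Proof.
have [hC _ hB] := cmu; rewrite (le_trans (integral_field_le _ _ _ _ hB _))//.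
rewrite EFinD leeD2r// EFinM lee_wpmul2l// lee_fin.
exact: (B_ge0 mu B hB).
Qed.

Lemma controlled_field_point i a (e : R) : 0 < e ->
  (forall b, b != a -> e <= sup_norm (z a - z b)) ->
  `|coord i (fld (z a))| <= B + N%:R / e.
Proof.
move=> e0 sep; have [hC _ hB] := cmu.
rewrite coordD (le_trans (ler_normD _ _))// lerD//.
  exact: (coord_Efield_le mu B hB).
rewrite FfieldE coord_sum (le_trans (ler_norm_sum _ _ _))//.
(* The term b = a is 0, so summing over all N indices only enlarges the bound. *)
apply: (@le_trans _ _ (\sum_(b < N) e^-1)).
  apply: ler_sum => b _; have [->|ba] := eqVneq b a.
    rewrite subrr /kernelK scaler0 (_ : coord i 0 = 0) ?normr0 ?invr_ge0 1?ltW//.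
    by rewrite /coord; case: ifP.
  rewrite (le_trans (coord_kernelK_le _ _))// lef_pV2 ?posrE ?sep//.
  by rewrite (lt_le_trans e0) ?sep.
by rewrite sumr_const card_ord mulr_natl.
Qed.

(* Near [z a] only the self-interaction is singular, and the Riesz bound controls it. *)
Lemma controlled_local_field i a (e : R) m : 0 < e ->
  (forall b, b != a -> e + 2^-1 ^+ m <= sup_norm (z a - z b)) ->
  (\int[mu]_(x in box (z a) (2^-1 ^+ m)) `|coord i (fld x)|%:E <=
   ((B + N%:R / e) * (A * (theta / 2) ^+ m) +
    A * theta ^+ m * (1 + (1 - theta)^-1))%:E)%E.
Proof.
move=> e0 sep; have [hC hbox hB] := cmu.
have mB := measurable_box (z a) (2^-1 ^+ m).
have B0 := B_ge0 mu B hB.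
have mk : measurable_fun setT (fun x : mplane R => `|K i (z a) x|%:E).
  apply/measurable_EFinP; apply: measurableT_comp => //; exact: measurable_K.
apply: (@le_trans _ _ (\int[mu]_(x in box (z a) (2^-1 ^+ m))
    ((B + N%:R / e)%:E + `|K i (z a) x|%:E))%E).
  apply: ge0_le_integral => //.
  - apply: measurable_funTS; apply/measurable_EFinP; apply: measurableT_comp => //.
    by have /measurable_EFinP := measurable_int mu (integrable_field _ mu z B hB i).
  - by apply: emeasurable_funD => //; exact: measurable_funTS.
  move=> x xB; rewrite -EFinD lee_fin coordD (le_trans (ler_normD _ _))//.
  rewrite -addrA lerD ?(coord_Efield_le mu B hB)//.
  rewrite FfieldE coord_sum (bigD1 a)//= (le_trans (ler_normD _ _))//.
  rewrite [leLHS]addrC lerD//; last by rewrite (KC i (z a) x) normrN.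
  rewrite (le_trans (ler_norm_sum _ _ _))//.
  apply: (@le_trans _ _ (\sum_(b < N | b != a) e^-1)).
    apply: ler_sum => b ba; rewrite (le_trans (coord_kernelK_le _ _))//.
    have h : e <= sup_norm (x - z b).
      have := sep b ba; have : sup_norm (z a - x) < 2^-1 ^+ m by [].
      have := sup_normD (z a - x) (x - z b); rewrite addrA subrK; lra.
    by rewrite lef_pV2 ?posrE// (lt_le_trans e0).
  rewrite sumr_const mulr_natl; apply: ler_wpMn2l.
    by rewrite invr_ge0 ltW.
  by rewrite (leq_trans (max_card _))// card_ord.
rewrite ge0_integralD//; last first.
- exact: measurable_funTS.
- by move=> x _; rewrite lee_fin addr_ge0// divr_ge0// ltW.
rewrite integral_cst// [leRHS]EFinD; apply: leeD.
  by rewrite EFinM lee_wpmul2l ?hbox// lee_fin addr_ge0// divr_ge0// ltW.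
exact: (riesz_local mu A theta A0 th01 (z a) m i (hbox (z a))).
Qed.

End field_bounds.
End controlled_densities.

(** * Supports of test functions, and null charges *)

Section test_function_facts.
Context {R : realType} {V : normedModType R}.
Implicit Types (phi : V -> R) (p : V -> R).

Lemma test_function_off_support phi U z v : test_function U phi ->
  ~ closure [set x | phi x != 0] z -> phi z = 0 /\ 'D_v phi z = 0.
Proof.
move=> _ nz; have oC : open (~` closure [set x | phi x != 0]).
  by apply: closed_openC; exact: closed_closure.
have h y : (~` closure [set x | phi x != 0]) y -> phi y = 0.
  move=> ny; apply/eqP; apply: contra_notT ny => py; exact: subset_closure.
split; first exact: h.
rewrite (near_eq_derive v (g := fun=> 0)); first exact: derive_cst.
have : nbhs z (~` closure [set x | phi x != 0]) by exact: open_nbhs_nbhs.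
by apply: filterS => y /h.
Qed.

Lemma test_function_derive_bounded phi v : test_function setT phi ->
  exists C : R, forall z, `|'D_v phi z| <= C.
Proof.
move=> tphi; have [sphi cK _] := tphi.
have c : continuous ('D_v phi).
  by move=> z; apply: differentiable_continuous; exact: (sphi [:: v]).
have : compact ('D_v phi @` closure [set x | phi x != 0]).
  by apply: continuous_compact => //; exact: continuous_subspaceT.
move/compact_bounded => [M [_ /(_ (Num.max 1 (M + 1)))]].
rewrite lt_max ltrDl ltr01 orbT => /(_ isT) h.
exists (Num.max 1 (M + 1)) => z.
have [zK|zK] := pselect (closure [set x | phi x != 0] z).
  by apply: h; exists z.
by have [_ ->] := test_function_off_support phi setT z v tphi zK; rewrite normr0 le_max ler01.
Qed.

Lemma compact_bounded_above p (K : set V) : continuous p -> compact K ->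
  exists2 T : R, 0 < T & forall z, K z -> p z <= T.
Proof.
move=> cp cK; have : compact (p @` K).
  by apply: continuous_compact => //; exact: continuous_subspaceT.
move/compact_bounded => [M [_ /(_ (Num.max 1 (M + 1)))]].
rewrite lt_max ltrDl ltr01 orbT => /(_ isT) h.
exists (Num.max 1 (M + 1)); first by rewrite lt_max ltr01.
by move=> z Kz; rewrite (le_trans (ler_norm _))//; apply: h; exists z.
Qed.

(** The image of K is closed and misses 0, so a ball around 0 avoids it. Applied to the time
    coordinate, it keeps the support of a test function away from time 0. *)
Lemma compact_bounded_below p (K : set V) : continuous p -> compact K ->
  K `<=` [set z | 0 < p z] -> exists2 tau : R, 0 < tau & forall z, K z -> tau <= p z.
Proof.
move=> cp cK K0; have cpK : compact (p @` K).
  by apply: continuous_compact => //; exact: continuous_subspaceT.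
have oC : open (~` (p @` K)).
  by apply: closed_openC; apply: compact_closed => //; exact: norm_hausdorff.
have : nbhs (0 : R) (~` (p @` K)).
  by apply: open_nbhs_nbhs; split=> // -[z /K0 /= + p0]; rewrite p0 ltxx.
move=> /nbhs_ballP[e /= e0 he]; exists e => // z Kz; rewrite leNgt; apply/negP => pe.
apply: (he (p z)); last by exists z.
by rewrite /ball/= sub0r normrN gtr0_norm// K0.
Qed.

End test_function_facts.

Lemma Rintegral_eq_domain d (T : measurableType d) (R : realType)
    (mu : {measure set T -> \bar R}) (D E : set T) (f : T -> R) :
  (forall x, D x -> ~ E x -> f x = 0) -> (forall x, E x -> ~ D x -> f x = 0) ->
  \int[mu]_(x in D) f x = \int[mu]_(x in E) f x.
Proof.
move=> DE ED; rewrite Rintegral_mkcond [RHS]Rintegral_mkcond.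
congr (fine _); apply: eq_integral => x _; rewrite /patch.
case: ifPn => [/set_mem Dx|/negP nDx]; case: ifPn => [/set_mem Ex|/negP nEx] //.
  by rewrite DE// => Ex; apply: nEx; rewrite inE.
by rewrite ED// => Dx; apply: nDx; rewrite inE.
Qed.

(** The Jordan parts are, up to sign, restrictions of the charge to Hahn sets, hence null
    measures. *)
Lemma charge_integral_null d (T : measurableType d) (R : realType)
    (nu : {charge set T -> \bar R}) (phi : T -> R) :
  (forall A, measurable A -> nu A = 0%E) -> charge_integral nu phi = 0.
Proof.
move=> nu0; have z (m : {measure set T -> \bar R}) :
    (forall A, measurable A -> m A = 0%E) -> \int[m]_x phi x = 0.
  move=> m0; rewrite /Rintegral (@eq_measure_integral _ _ _ _ mzero).
    by rewrite integral_measure_zero.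
  by move=> A mA _; rewrite m0.
have r0 D (mD : measurable D) A : measurable A -> crestr0 nu mD A = 0%E.
  by move=> mA; rewrite /crestr0 mem_set// /crestr nu0//; exact: measurableI.
have p0 A : measurable A -> jordan_pos (hahn_posneg nu) A = 0%E.
  by move=> mA; rewrite jordan_posE cjordan_posE r0.
have n0 A : measurable A -> jordan_neg (hahn_posneg nu) A = 0%E.
  by move=> mA; rewrite jordan_negE cjordan_negE r0 ?oppe0.
by rewrite /charge_integral (z _ p0) (z _ n0) subr0.
Qed.

(** * Integrating a derivative along a trajectory *)

Section fundamental_theorem.
Context {R : realType}.
Local Notation leb := (@lebesgue_measure R).

(* [h] vanishes near [0] and from [T] on, so its derivative integrates to zero. *)
Lemma integral_derive_eq0 (h dh : R -> R) (tau T : R) : 0 < tau < T ->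
  (forall t : R, 0 < t -> is_derive t 1 h (dh t)) ->
  (forall t : R, 0 < t -> {for t, continuous dh}) ->
  (forall t, t < tau -> h t = 0 /\ dh t = 0) -> h T = 0 ->
  \int[leb]_(t in `[0, T]) dh t = 0.
Proof.
move=> /andP[tau0 tauT] dh1 cdh h0 hT.
have t2 : tau / 2 < T by lra.
have t20 : 0 < tau / 2 by lra.
(* Derivatives are available for t > 0 only, so the integral is first cut at tau/2, where [h]
   already vanishes. *)
transitivity (\int[leb]_(t in `[tau / 2, T]) dh t); last first.
- rewrite /Rintegral (continuous_FTC2 (F := h) t2).
  + have [|-> _] := h0 (tau / 2); first by lra.
    by rewrite hT subee.
  + apply: continuous_in_subspaceT => t; rewrite inE/= in_itv/= => /andP[ht _].
    by apply: cdh; lra.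
  + have ch (t : R) : 0 < t -> {for t, continuous h}.
      by move=> /dh1[dt _]; apply: differentiable_continuous; exact/derivable1_diffP.
    split.
    * move=> t; rewrite in_itv/= => /andP[ht _].
      by have [] := dh1 t (lt_trans t20 ht).
    * by apply: cvg_at_right_filter; exact: ch.
    * by apply: cvg_at_left_filter; apply: ch; lra.
  + move=> t; rewrite in_itv/= => /andP[ht _]; rewrite derive1E.
    by have [_ ->] := dh1 t (lt_trans t20 ht).
apply: Rintegral_eq_domain.
- move=> t; rewrite /= !in_itv/= => /andP[ht tT] nt.
  have [|_ ->//] := h0 t; rewrite ltNge; apply/negP => tt.
  by apply: nt; apply/andP; split => //; lra.
- move=> t; rewrite /= !in_itv/= => /andP[ht tT] nt; exfalso; apply: nt.
  by apply/andP; split => //; lra.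
Qed.

Lemma is_derive_along_curve (Phi : R * plane R -> R) (u : R -> plane R) t (w : plane R) :
  differentiable Phi (t, u t) -> is_derive t 1 u w ->
  is_derive t 1 (fun s => Phi (s, u s))
    ('D_(1, 0) Phi (t, u t) + dot w (grad (fun x => Phi (t, x)) (u t))).
Proof.
move=> dP [du duE].
have did : differentiable (fun s : R => s) t.
  exact/elementary_differentiable/elementary_id.
have ddu : differentiable u t by exact/derivable1_diffP.
have dg : differentiable (fun s : R => (s, u s)) t by exact: differentiable_pair.
have dc : differentiable (Phi \o (fun s : R => (s, u s))) t by exact: differentiable_comp.
apply: DeriveDef; first exact/derivable1_diffP.
rewrite (deriveE _ dc) diff_comp//= diff_pair//.
have -> : ('d (fun s : R => s) t 1, 'd u t 1) =
   (1, 0) + (w.1 *: (0, (1, 0)) + w.2 *: (0, (0, 1))) :> R * plane R.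
  rewrite -(deriveE _ did) -(deriveE _ ddu) duE derive_id.
  rewrite [RHS]surjective_pairing /= !scaler0 !addr0 add0r; congr (_, _).
  rewrite [LHS]surjective_pairing [RHS]surjective_pairing /= /GRing.scale/=.
  by congr (_, _); rewrite !(mulr0, mulr1, addr0, add0r).
rewrite /grad /basis /= -!derive_slicer !deriveE//.
by rewrite linearD linearD !linearZ.
Qed.

End fundamental_theorem.

(** Difference quotients are eventually below |u'(t)| + 1. The resulting L fixes how long a point
    stays in a small box. *)
Lemma is_derive_lipschitz {R : realType} (u : R -> plane R) (t : R) (w : plane R) :
  is_derive t 1 u w -> exists2 L : R, 0 < L & exists2 d : R, 0 < d &
    forall s, `|s - t| < d -> sup_norm (u s - u t) <= L * `|s - t|.
Proof.
have supE (z : plane R) : sup_norm z = `|z| by [].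
move=> [du _]; set L := `|'D_1 u t| + 1.
have hL : `|'D_1 u t| < L by rewrite ltrDl.
have [d /= d0 hd] := cvg_norm du (lt_nbhsl hL).
exists L; first by rewrite ltr_wpDl.
exists d => // s std; have [->|st] := eqVneq s t.
  by rewrite !subrr supE !normr0 mulr0.
have h0 : s - t != 0 by rewrite subr_eq0.
have := hd (s - t); rewrite /= sub0r normrN => /(_ std h0).
rewrite normrZ normfV ltr_pdivrMl ?normr_gt0// mulrC.
rewrite -[(s - t) *: 1]/((s - t) * 1) mulr1 subrK supE; exact: ltW.
Qed.

(** * Time averages and Lebesgue points *)

Section bounded_time_integrals.
Context {R : realType}.
Local Notation leb := (@lebesgue_measure R).

Lemma integrable_ae_bounded (g : R -> R) (T C : R) :
  measurable_fun setT g -> {ae leb, forall t, 0 <= t <= T -> `|g t| <= C} ->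
  leb.-integrable `[0, T] (fun t => (g t)%:E).
Proof.
move=> mg gC; apply/integrable_realP => //; first exact: measurable_funTS.
apply: (@le_lt_trans _ _ (\int[leb]_(t in `[0%R, T]) (Num.max 0 C)%:E)%E).
  apply: ae_ge0_le_integral => //.
  - by apply/measurable_EFinP; apply: measurable_funTS; exact: measurableT_comp.
  - by move=> t _; rewrite lee_fin le_max lexx.
  apply: (ae_impl _ _ _ _ _ _ _ gC) => t h; rewrite /= in_itv/= => /h {}h.
  by rewrite lee_fin le_max h orbT.
have mT : (leb (`[0%R, T]%classic : set R) < +oo)%E.
  by rewrite lebesgue_measure_itv/=; case: ifPn => _; rewrite ?ltry// -EFinB ltry.
by rewrite integral_cst// lte_mul_pinfty// lee_fin le_max lexx.
Qed.

Lemma Rintegral_real_sum d (T : measurableType d) (m : {measure set T -> \bar R})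
    (D : set T) (I : Type) (s : seq I) (F : I -> T -> R) : measurable D ->
  (forall a, m.-integrable D (fun x => (F a x)%:E)) ->
  m.-integrable D (fun x => (\sum_(a <- s) F a x)%:E) /\
  \int[m]_(x in D) (\sum_(a <- s) F a x) = \sum_(a <- s) \int[m]_(x in D) F a x.
Proof.
move=> mD iF; elim: s => [|a s [ih1 ih2]].
  rewrite big_nil; split.
    under eq_fun do rewrite big_nil; exact: integrable0.
  by under eq_Rintegral do rewrite big_nil; rewrite Rintegral_cst// mul0r.
split.
  under eq_fun do rewrite big_cons; exact: integrable_realD.
under eq_Rintegral do rewrite big_cons.
rewrite big_cons -ih2; exact: (RintegralD mD (iF a) ih1).
Qed.

Lemma continuous_halfline_continuous {V : topologicalType} (u : R -> V) (t : R) :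
  {within `[0, +oo[, continuous u} -> 0 < t -> {for t, continuous u}.
Proof.
move=> cu t0; have : {within `]0, +oo[%classic, continuous u}.
  by apply: continuous_subspaceW cu => s /=; rewrite !in_itv/= !andbT; exact: ltW.
rewrite continuous_open_subspace; last exact: interval_open.
by apply; rewrite inE/= in_itv/= t0.
Qed.

Lemma continuous_halfline_measurable (u : R -> plane R) :
  {within `[0, +oo[, continuous u} ->
  measurable_fun setT (fun t : R => u (Num.max 0 t) : mplane R).
Proof.
move=> cu; have h (p : plane R -> R) : continuous p ->
    measurable_fun setT (fun t : R => p (u (Num.max 0 t))).
  move=> cp; have mpu : measurable_fun (`[0, +oo[%classic : set R) (p \o u).
    apply: subspace_continuous_measurable_fun => // t.
    apply: (@continuous_comp (subspace (`[0, +oo[%classic : set R)) (R * R)%type R u p).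
      exact: cu.
    exact: cp.
  apply: (measurable_comp _ _ mpu) => //; last exact: measurable_maxr.
  by move=> _ [t _ <-]; rewrite /= in_itv/= andbT le_max lexx.
apply/measurable_fun_pairP; split.
  by apply: (h fst) => z; exact: cvg_fst.
by apply: (h snd) => z; exact: cvg_snd.
Qed.

Lemma continuous_halfline_bounded (u : R -> plane R) (T : R) :
  {within `[0, +oo[, continuous u} ->
  exists C : R, forall t i, 0 <= t <= T -> `|coord i (u t)| <= C.
Proof.
move=> cu; have h (p : plane R -> R) : continuous p ->
    exists2 C : R, 0 < C & forall t, 0 <= t <= T -> `|p (u t)| <= C.
  move=> cp; have : compact ((p \o u) @` `[0, T]).
    apply: continuous_compact; last exact: segment_compact.
    have : {within `[0, T], continuous u}.
      apply: continuous_subspaceW cu => t /=; rewrite !in_itv/= andbT.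
      by move=> /andP[].
    move=> cu' t.
    apply: (@continuous_comp (subspace (`[0, T]%classic : set R)) (R * R)%type R u p).
      exact: cu'.
    exact: cp.
  move/compact_bounded => [M [_ /(_ (Num.max 1 (M + 1)))]].
  rewrite lt_max ltrDl ltr01 orbT => /(_ isT) hM.
  exists (Num.max 1 (M + 1)); first by rewrite lt_max ltr01.
  by move=> t tT; apply: hM; exists t => //=; rewrite in_itv.
have [C1 C10 h1] := h fst (fun z => cvg_fst).
have [C2 C20 h2] := h snd (fun z => cvg_snd).
exists (C1 + C2) => t i tT; rewrite /coord; case: ifP => _.
  by rewrite (le_trans (h1 t tT))// lerDl ltW.
by rewrite (le_trans (h2 t tT))// lerDr ltW.
Qed.

Lemma Rintegral_ball_le (g : R -> R) (T C t s : R) : measurable_fun setT g -> 0 <= C ->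
  {ae leb, forall t, 0 <= t <= T -> `|g t| <= C} -> 0 < s -> s <= t -> t + s <= T ->
  leb.-integrable (ball t s) (fun y => (g y)%:E) /\
  `|\int[leb]_(y in ball t s) g y| <= C * (2 * s).
Proof.
move=> mg C0 gC s0 st tT.
have bT y : ball t s y -> 0 <= y <= T.
  by rewrite /ball/= ltr_norml => /andP[h1 h3]; apply/andP; split; lra.
have mT : measurable (`[0, T]%classic : set (measurableTypeR R)) by exact: measurable_itv.
have mb : measurable (ball t s : set (measurableTypeR R)) := measurable_ball _ _.
have iT := integrable_ae_bounded _ _ _ mg gC.
have ib : leb.-integrable (ball t s) (fun y => (g y)%:E).
  by apply: integrableS iT => // y /bT; rewrite /= in_itv.
split => //; have H := Rintegral_norm_le_bound _ _ _ leb _ mb _ _ ib.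
apply: H; apply: (@le_trans _ _ (\int[leb]_(y in ball t s) C%:E)%E).
  apply: ae_ge0_le_integral => //.
  - by apply/measurable_EFinP; apply: measurable_funTS; exact: measurableT_comp.
  - by apply: (ae_impl _ _ _ _ _ _ _ gC) => y h /bT /h.
have bE := lebesgue_measure_ball t (ltW s0).
by rewrite integral_cst// EFinM; apply: lee_wpmul2l => //; rewrite mulr_natl -bE.
Qed.

(** Writing g = g(t0) + (g - g(t0)) in the last hypothesis leaves g(t0) times the integral of [bm],
    which is at least 2s. The rest is the integral of F, at most 6 s k, and the oscillation term, at
    most M eta. *)
Lemma average_estimate (F g bm : R -> R) (t0 s M eta k : R) : 0 < s ->
  measurable_fun setT bm -> (forall t, 0 <= bm t) -> (forall t, `|bm t| <= M) ->
  (forall t, ball t0 s t -> bm t = 1) ->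
  leb.-integrable (ball t0 (3 * s)) (fun t => (g t)%:E) ->
  `|\int[leb]_(t in ball t0 (3 * s)) F t| <= k * (2 * (3 * s)) ->
  (\int[leb]_(t in ball t0 (3 * s)) `|g t - g t0|%:E <= eta%:E)%E ->
  \int[leb]_(t in ball t0 (3 * s)) F t +
    \int[leb]_(t in ball t0 (3 * s)) (bm t * g t) = 0 ->
  s * `|g t0| <= M * eta + s * (3 * k).
Proof.
move=> s0 mbm bm0 bmM bm1; set D := ball t0 (3 * s) => ig hflux heta W.
have s3 : 0 < 3 * s by lra.
have mD : measurable (D : set (measurableTypeR R)) := measurable_ball _ _.
have M0 : 0 <= M := le_trans (normr_ge0 _) (bmM 0).
have Dfin : (leb D < +oo)%E by rewrite (lebesgue_measure_ball _ (ltW s3)) ltry.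
have ic (c : R) : leb.-integrable D (fun=> c%:E).
  by apply: (integrable_bounded _ _ _ leb _ mD `|c|).
have ibm : leb.-integrable D (fun t => (bm t)%:E).
  by apply: (integrable_bounded _ _ _ leb _ mD M) => //; exact: measurable_funTS.
have igg : leb.-integrable D (fun t => (g t - g t0)%:E).
  exact: (integrable_realB _ _ _ leb _ mD _ _ ig (ic _)).
have iJ : leb.-integrable D (fun t => (bm t * (g t - g t0))%:E).
  under eq_fun do rewrite mulrC.
  by apply: (integrableM_bounded _ _ _ leb _ mD M) => //; exact: measurable_funTS.
have iI : leb.-integrable D (fun t => (g t0 * bm t)%:E).
  exact: (integrable_realZl _ _ _ leb _ mD).
have split_g : \int[leb]_(t in D) (bm t * g t) =
    g t0 * \int[leb]_(t in D) bm t + \int[leb]_(t in D) (bm t * (g t - g t0)).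
  rewrite -(RintegralZl (g t0) mD ibm) -(RintegralD mD iI iJ).
  by apply: eq_Rintegral => t _; ring.
have hJ : `|\int[leb]_(t in D) (bm t * (g t - g t0))| <= M * eta.
  have H := Rintegral_norm_le_bound _ _ _ leb _ mD _ _ iJ.
  apply: H; apply: (@le_trans _ _ (M%:E * \int[leb]_(t in D) `|g t - g t0|%:E)%E).
    have mgg := measurable_int leb igg.
    have mg' : measurable_fun D (fun t => `|g t - g t0|%:E).
      by apply/measurable_EFinP; apply: measurableT_comp => //; apply/measurable_EFinP.
    rewrite -ge0_integralZl_EFin//.
    apply: ge0_le_integral => //.
    - apply/measurable_EFinP; apply: measurableT_comp => //; apply/measurable_EFinP.
      exact: (measurable_int leb iJ).
    - by apply: measurable_funeM.
    by move=> t _; rewrite -EFinM lee_fin normrM ler_wpM2r.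
  by rewrite EFinM lee_wpmul2l// lee_fin ltW.
have hI : 2 * s <= \int[leb]_(t in D) bm t.
  rewrite -lee_fin EFin_Rintegral//.
  have mb : measurable (ball t0 s : set (measurableTypeR R)) := measurable_ball _ _.
  have bD : ball t0 s `<=` D.
    by move=> t; rewrite /D /ball/= => /lt_le_trans; apply; rewrite ler_peMl ?ler1n ?ltW.
  apply: (@le_trans _ _ (\int[leb]_(t in ball t0 s) (bm t)%:E)%E); last first.
    apply: ge0_subset_integral => //; first exact: (measurable_int leb ibm).
    by move=> t _; rewrite lee_fin.
  rewrite (eq_integral (cst 1%E)); last first.
    by move=> t; rewrite inE => /bm1 ->.
  by rewrite integral_cst// mul1e mulr_natl -(lebesgue_measure_ball t0 (ltW s0)).
have : `|g t0| * (2 * s) <= k * (2 * (3 * s)) + M * eta.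
  apply: (le_trans (ler_wpM2l (normr_ge0 _) hI)).
  have I0 : 0 <= \int[leb]_(t in D) bm t by rewrite (le_trans _ hI)// mulr_ge0// ltW.
  rewrite -(ger0_norm I0) -normrM.
  have -> : g t0 * \int[leb]_(t in D) bm t = - (\int[leb]_(t in D) F t +
      \int[leb]_(t in D) (bm t * (g t - g t0))).
    by apply/eqP; rewrite -addr_eq0 addrCA -split_g W.
  by rewrite normrN (le_trans (ler_normD _ _))// lerD.
have := normr_ge0 (g t0).
have eta0 : 0 <= eta.
  by rewrite -lee_fin (le_trans _ heta)// integral_ge0// => t _; rewrite lee_fin.
have := mulr_ge0 M0 eta0; lra.
Qed.

(** Lebesgue differentiation for [g] cut off outside [0, T], with averages turned into integrals. *)
Lemma small_averages (g : R -> R) (T C : R) : measurable_fun setT g ->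
  {ae leb, forall t, 0 <= t <= T -> `|g t| <= C} ->
  {ae leb, forall t, 0 < t < T -> forall eta : R, 0 < eta ->
    exists2 d : R, 0 < d & forall s : R, 0 < s < d ->
      (\int[leb]_(y in ball t s) `|g y - g t|%:E <= (eta * s)%:E)%E}.
Proof.
move=> mg gC; pose f := g \_ (`[0, T]%classic : set R).
have mT : measurable (`[0, T]%classic : set (measurableTypeR R)) by exact: measurable_itv.
have iT := integrable_ae_bounded _ _ _ mg gC.
have lf : locally_integrable setT f by exact: integrable_locally_restrict.
have ld := lebesgue_differentiation lf.
apply: (ae_impl _ _ _ _ _ _ _ ld) => t ft /andP[t0 tT] eta eta0.
(* Half of eta, because the average divides by the length 2s of the ball. *)
have h2 : (0 < (eta / 2)%:E)%E by rewrite lte_fin divr_gt0.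
have [d /= d0 hd] := ft _ (open_ereal_lt' h2).
(* The last two terms keep the ball inside [0, T], where the cut-off function equals [g]. *)
exists (Num.min d (Num.min t (T - t))); first by rewrite !lt_min d0 t0 subr_gt0.
move=> s; rewrite !lt_min => /andP[s0 /and3P[sd st sT]].
have bT y : ball t s y -> 0 <= y <= T.
  by rewrite /ball/= ltr_norml => /andP[h1 h3]; apply/andP; split; lra.
have := hd s; rewrite /= sub0r normrN gtr0_norm// => /(_ sd s0).
rewrite /davg /iavg (lebesgue_measure_ball _ (ltW s0)) inver mulrn_eq0/= gt_eqF//.
have -> : (\int[leb]_(y in ball t s) `|((center (f t) \o f) y)%:E| =
    \int[leb]_(y in ball t s) `|g y - g t|%:E)%E.
  apply: eq_integral => y; rewrite inE => /bT hy /=.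
  rewrite /f !patchE !ifT//; rewrite inE/= in_itv/=; first by rewrite (ltW t0) ltW.
  by [].
move=> /ltW; rewrite lee_pdivrMl ?mulrn_wgt0// -EFinM mulrC => /le_trans; apply.
by rewrite lee_fin -mulr_natr; lra.
Qed.

End bounded_time_integrals.

Lemma is_derive_coord {R : realType} i (u : R -> plane R) (t : R) (w : plane R) :
  is_derive t 1 u w -> is_derive t 1 (fun s => coord i (u s)) (coord i w).
Proof.
move=> [du duE].
have cu : h^-1 *: ((u \o shift t) (h *: 1) - u t) @[h --> 0^'] --> w by rewrite -duE.
have h (p : plane R -> R) : (forall (c : R) (y z : plane R), p (c *: (y - z)) = c *: (p y - p z)) ->
    continuous p -> is_derive t 1 (p \o u) (p w).
  move=> hp cp.
  have cpu : h^-1 *: (((p \o u) \o shift t) (h *: 1) - (p \o u) t) @[h --> 0^'] --> p w.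
    rewrite (_ : (fun h => _) = p \o (fun h => h^-1 *: ((u \o shift t) (h *: 1) - u t))).
      exact: (cvg_comp _ _ cu (cp w)).
    by apply/funext => c /=; rewrite hp.
  by apply: DeriveDef; [exact: (cvgP (p w))|exact: cvg_lim].
rewrite /coord; case: (i == ord0).
  by apply: (h fst) => // z; exact: cvg_fst.
by apply: (h snd) => // z; exact: cvg_snd.
Qed.

(** * The weak identity for the slips and its localization *)

Section weak_identity.
Context {R : realType} (N : nat).
Local Notation leb := (@lebesgue_measure R).
Variables (rho : R -> {finite_measure set (mplane R) -> \bar R})
  (xi w : 'I_N -> R -> plane R) (nu : R -> matrix_charge (R := R)).
Variables (theta e : R).
Hypothesis mrho : Linf_measures C0_plane rho.
Hypothesis theta01 : 0 < theta < 1.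
Hypothesis ctrl : forall T, 0 < T -> exists C A B : R,
  0 <= A /\ {ae leb, forall t, 0 <= t <= T -> controlled theta C A B (rho t)}.
Hypothesis e0 : 0 < e.
Hypothesis sep : forall (t : R) a b, 0 <= t -> a != b -> e <= sup_norm (xi a t - xi b t).
Hypothesis cxi : forall a, {within `[0, +oo[, continuous (xi a)}.
Hypothesis cw : forall a, {within `[0, +oo[, continuous (w a)}.
Hypothesis dxi : forall a (t : R), 0 < t -> is_derive t 1 (xi a) (w a t).
Hypothesis weak : euler_defect_weak_solution rho (fun t => sum_dirac (xi^~ t)) nu.
Hypothesis nu0 : defect_vanishes nu.

(* The data are only meaningful for [t >= 0]; freezing them before time [0] makes the
   measurability statements hold on the whole line. *)
Definition halfline_extension {T : Type} (u : R -> T) (t : R) : T := u (Num.max 0 t).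

Local Notation r := (halfline_extension rho).
Local Notation x a := (halfline_extension (xi a)).
Local Notation v a := (halfline_extension (w a)).
Local Notation fld := (field _ r (fun a => x a)).

Definition slip a t : plane R := perp (fld t (x a t)) - v a t.

Lemma halfline_extensionE {T : Type} (u : R -> T) t : 0 <= t -> halfline_extension u t = u t.
Proof. by move=> t0; rewrite /halfline_extension max_r. Qed.

Lemma measurable_r A : measurable A -> measurable_fun setT (r ^~ A).
Proof. exact: Linf_measures_measurable. Qed.

Lemma measurable_x a : measurable_fun setT (x a : R -> mplane R).
Proof. exact: continuous_halfline_measurable. Qed.

Lemma measurable_v a : measurable_fun setT (v a : R -> mplane R).
Proof. exact: continuous_halfline_measurable. Qed.

Lemma ctrl_r T : 0 < T -> exists C A B : R, 0 <= A /\
  {ae leb, forall t, 0 <= t <= T -> controlled theta C A B (r t)}.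
Proof.
move=> /ctrl[C [A [B [A0 h]]]]; exists C, A, B; split => //.
apply: (ae_impl _ _ _ _ _ _ _ h) => t ht /[dup] /ht{}ht /andP[t0 _].
by rewrite halfline_extensionE.
Qed.

Lemma sep_x t a b : a != b -> e <= sup_norm (x a t - x b t).
Proof. by move=> ab; apply: sep => //; rewrite le_max lexx. Qed.

Lemma measurable_slip i a : measurable_fun setT (fun t : R => coord i (slip a t)).
Proof.
have mF j := measurable_field_point _ r (fun a => x a) measurable_r measurable_x j a.
have [m1 m2] := (measurable_fun_pairP _).1 (measurable_v a).
rewrite /slip; under eq_fun do rewrite coordD coordN.
apply: measurable_funB; rewrite /coord; case: (i == ord0) => //=.
- by apply: measurableT_comp => //; exact: (mF ord_max).
- exact: (mF ord0).
Qed.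

Lemma slip_bounded T : 0 < T -> exists C : R,
  {ae leb, forall t, 0 <= t <= T -> forall i a, `|coord i (slip a t)| <= C}.
Proof.
move=> /[dup] T0 /ctrl_r[C [A [B [A0 h]]]].
have hv a : exists C : R, forall t i, 0 <= t <= T -> `|coord i (w a t)| <= C.
  exact: continuous_halfline_bounded.
pose D a := sval (cid (hv a)); have hD a := svalP (cid (hv a)).
exists (B + N%:R / e + \sum_a `|D a|).
apply: (ae_impl _ _ _ _ _ _ _ h) => t ht /[dup] tT /ht{}ht i a.
rewrite /slip coordD coordN (le_trans (ler_normB _ _))// lerD//.
  have hF j := controlled_field_point _ _ _ _ _ _ (fun b => x b t) ht j a e e0.
  have sp b : b != a -> e <= sup_norm (x a t - x b t).
    by move=> ba; rewrite sep_x// eq_sym.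
  rewrite /coord; case: (i == ord0) => /=.
    by rewrite normrN; exact: (hF ord_max sp).
  exact: (hF ord0 sp).
rewrite halfline_extensionE; last by case/andP: tT.
rewrite (le_trans (hD a t i tT))// (bigD1 a)//= -[leLHS]addr0.
by rewrite lerD ?ler_norm// sumr_ge0.
Qed.

Lemma coord_grad i (f : plane R -> R) y : coord i (grad f y) = 'D_(basis i) f y.
Proof. by rewrite /coord /grad /basis; case: (i == ord0). Qed.

Lemma dot_coord (y z : plane R) :
  dot y z = coord ord0 y * coord ord0 z + coord ord_max y * coord ord_max z.
Proof. by []. Qed.

Lemma dot_perp (y z : plane R) :
  dot (perp y) z = coord ord0 y * coord ord_max z - coord ord_max y * coord ord0 z.
Proof. by rewrite /dot /perp /coord /=; ring. Qed.

Section test.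
Variable Phi : R * plane R -> R.
Hypothesis tPhi : test_function setT Phi.

Local Notation gradP t y := (grad (fun y' => Phi (t, y')) y).
Local Notation dtP t y := ('D_(1, 0) Phi (t, y)).

Let gradPE i t y : coord i (gradP t y) = 'D_(0, basis i) Phi (t, y).
Proof. by rewrite coord_grad derive_slicer. Qed.

Let cderive u : continuous ('D_u Phi).
Proof.
by move=> z; apply: differentiable_continuous; have [sP _ _] := tPhi; exact: (sP [:: u]).
Qed.

Let derive_bound : exists2 c : R, 0 <= c & forall t y,
  `|dtP t y| <= c /\ forall i, `|coord i (gradP t y)| <= c.
Proof.
have [c0 h0] := test_function_derive_bounded Phi (1, 0) tPhi.
have [c1 h1] := test_function_derive_bounded Phi (0, basis ord0) tPhi.
have [c2 h2] := test_function_derive_bounded Phi (0, basis ord_max) tPhi.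
exists (`|c0| + `|c1| + `|c2|); first by rewrite !addr_ge0.
have n0 := normr_ge0 c0; have n1 := normr_ge0 c1; have n2 := normr_ge0 c2.
move=> t y; split=> [|i].
  by have := h0 (t, y); have := ler_norm c0; lra.
rewrite gradPE /basis; case: (i == ord0).
  by have := h1 (t, y); have := ler_norm c1; rewrite /basis/=; lra.
by have := h2 (t, y); have := ler_norm c2; rewrite /basis/=; lra.
Qed.

Let mdtP : measurable_fun (setT : set (measurableTypeR R * mplane R)) ('D_(1, 0) Phi).
Proof. exact: continuous_measurable_fun_time_plane. Qed.

Let mgradP i : measurable_fun (setT : set (measurableTypeR R * mplane R))
  (fun w => coord i (gradP w.1 w.2)).
Proof.
rewrite (_ : (fun w => _) = 'D_(0, basis i) Phi).
  exact: continuous_measurable_fun_time_plane.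
by apply/funext => -[t y]; rewrite gradPE.
Qed.

Let mdtP_t t : measurable_fun (setT : set (mplane R)) (fun y => dtP t y).
Proof.
exact: (measurableT_comp (f := 'D_(1, 0) Phi) (g := fun y : mplane R => (t : measurableTypeR R, y)) mdtP (pair1_measurable t)).
Qed.

Let mgradP_t i t : measurable_fun (setT : set (mplane R)) (fun y => coord i (gradP t y)).
Proof.
exact: (measurableT_comp (g := fun y : mplane R => (t : measurableTypeR R, y)) (mgradP i) (pair1_measurable t)).
Qed.

Let mpair a : measurable_fun setT (fun t : measurableTypeR R => (t, x a t)).
Proof. by apply: measurable_fun_pair => //; exact: measurable_x. Qed.

Definition time_flux (t : R) : R := \int[r t]_y (dtP t y + dot (perp (fld t y)) (gradP t y)).

Let I1 t : R := \int[r t]_y dtP t y.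
Let I2 t : R := \int[r t]_y dot (perp (fld t y)) (gradP t y).
Let J1 a t : R := dtP t (x a t).
Let J2 a t : R := dot (perp (fld t (x a t))) (gradP t (x a t)).

Let mI1 : measurable_fun setT I1.
Proof. exact: (measurable_time_Rintegral r measurable_r ('D_(1, 0) Phi) mdtP). Qed.

Let mI2 : measurable_fun setT I2.
Proof.
apply: (measurable_time_Rintegral r measurable_r
  (fun w => dot (perp (fld w.1 w.2)) (gradP w.1 w.2))).
under eq_fun do rewrite dot_perp.
have mF := measurable_field _ r (fun a => x a) measurable_r measurable_x.
by apply: measurable_funB; apply: measurable_funM.
Qed.

Let mJ1 a : measurable_fun setT (J1 a).
Proof. exact: (measurableT_comp mdtP (mpair a)). Qed.

Let mJ2 a : measurable_fun setT (J2 a).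
Proof.
rewrite /J2; under eq_fun do rewrite dot_perp.
have mF i := measurable_field_point _ r (fun a => x a) measurable_r measurable_x i a.
have mG i := measurableT_comp (mgradP i) (mpair a).
by apply: measurable_funB; apply: measurable_funM;
  [exact: mF|exact: mG|exact: mF|exact: mG].
Qed.

Let slice_integrable C A B t : controlled theta C A B (r t) ->
  (r t).-integrable setT (fun y => (dtP t y)%:E) /\
  (r t).-integrable setT (fun y => (dot (perp (fld t y)) (gradP t y))%:E).
Proof.
have [c c0 hc] := derive_bound; move=> [hC _ hB]; split.
  have H := integrable_bounded _ _ _ (r t) _ measurableT c (fun y : mplane R => dtP t y).
  apply: H; [by rewrite ltey_eq fin_num_measure|exact: mdtP_t|].
  by move=> y _; have [] := hc t y.
have H := integrable_velocity_grad N (r t) (fun a => x a t) B hB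
  (fun y => Phi (t, y)) c (fun i => mgradP_t i t).
by apply: H => i y; have [_] := hc t y.
Qed.

Let I1_bound c C A B t : 0 <= c -> (forall y, `|dtP t y| <= c) ->
  controlled theta C A B (r t) -> `|I1 t| <= c * C.
Proof.
move=> c0 hc /[dup] ht [hC _ _]; have [iD _] := slice_integrable _ _ _ _ ht.
have H := Rintegral_norm_le_bound _ _ _ (r t) _ measurableT (c * C) _ iD.
apply: H; apply: (@le_trans _ _ (\int[r t]_y (cst c%:E y))%E).
  apply: ge0_le_integral => //.
  - by apply/measurable_EFinP; exact: measurableT_comp.
  - by move=> y _; rewrite lee_fin hc.
by rewrite integral_cst// EFinM lee_wpmul2l.
Qed.

Let I2_bound c C A B t : 0 <= c -> (forall i y, `|coord i (gradP t y)| <= c) ->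
  controlled theta C A B (r t) -> `|I2 t| <= c * (2 * (B * C + N%:R * B)).
Proof.
move=> c0 hc ht; have [_ iV] := slice_integrable _ _ _ _ ht.
have [hC _ hB] := ht.
have hI i := controlled_integral_field N theta C A B (r t) (fun a => x a t) ht i.
have iF i := integrable_norm _ _ _ _ _ measurableT _
  (integrable_field N (r t) (fun a => x a t) B hB i).
have H := Rintegral_norm_le_bound _ _ _ (r t) _ measurableT
  (c * (2 * (B * C + N%:R * B))) _ iV.
apply: H; apply: (@le_trans _ _ (\int[r t]_y (c%:E * (`|coord ord0 (fld t y)|%:E +
    `|coord ord_max (fld t y)|%:E)))%E).
  apply: ge0_le_integral => //.
  - have mV := measurable_int (r t) iV; apply/measurable_EFinP.
    by apply: measurableT_comp => //; apply/measurable_EFinP.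
  - apply: measurable_funeM; apply: emeasurable_funD.
      exact: (measurable_int (r t) (iF ord0)).
    exact: (measurable_int (r t) (iF ord_max)).
  move=> y _; rewrite -EFinD -EFinM lee_fin dot_perp (le_trans (ler_normB _ _))//.
  by rewrite !normrM mulrDr lerD// mulrC ler_wpM2r.
rewrite ge0_integralZl_EFin//; last 2 first.
- by move=> y _; rewrite adde_ge0.
- apply: emeasurable_funD.
    exact: (measurable_int (r t) (iF ord0)).
  exact: (measurable_int (r t) (iF ord_max)).
rewrite EFinM lee_wpmul2l// ge0_integralD//.
- by rewrite mulr_natl mulr2n EFinD leeD//; exact: hI.
- exact: (measurable_int (r t) (iF ord0)).
- exact: (measurable_int (r t) (iF ord_max)).
Qed.

Lemma measurable_time_flux : measurable_fun setT time_flux.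
Proof.
apply: (measurable_time_Rintegral r measurable_r
  (fun w => 'D_(1, 0) Phi w + dot (perp (fld w.1 w.2)) (gradP w.1 w.2))).
apply: measurable_funD; first exact: mdtP.
under eq_fun do rewrite dot_perp.
have mF := measurable_field _ r (fun a => x a) measurable_r measurable_x.
by apply: measurable_funB; apply: measurable_funM.
Qed.

(** The support lies in one small box around the point a, so the flux is at most M1 times the mass
    of the box plus M2 times the integrals of both field coordinates over it. Half of the separation
    e is spent on the size of the box, the other half keeps the remaining points at distance e/2
    from it. *)
Lemma time_flux_le C A B t a m M1 M2 : 0 <= A -> 2^-1 ^+ m <= e / 2 ->
  controlled theta C A B (r t) ->
  (forall y, ~ box (x a t) (2^-1 ^+ m) y -> dtP t y = 0 /\ gradP t y = 0) ->
  0 <= M2 -> (forall y, `|dtP t y| <= M1) -> (forall i y, `|coord i (gradP t y)| <= M2) ->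
  `|time_flux t| <= M1 * (A * (theta / 2) ^+ m) +
    M2 * (2 * ((B + N%:R / (e / 2)) * (A * (theta / 2) ^+ m) +
               A * theta ^+ m * (1 + (1 - theta)^-1))).
Proof.
move=> A0 me ht off M20 hM1 hM2; have [_ hbox hB] := ht.
have [i1 i2] := slice_integrable _ _ _ _ ht.
have iV := integrable_realD _ _ _ (r t) _ measurableT _ _ i1 i2.
have H := Rintegral_norm_le_bound _ _ _ (r t) _ measurableT _ _ iV.
apply: H; pose D := box (x a t) (2^-1 ^+ m).
have mD : measurable D := measurable_box _ _.
pose g y := dtP t y + dot (perp (fld t y)) (gradP t y).
have -> : (\int[r t]_y `|g y|%:E = \int[r t]_(y in D) `|g y|%:E)%E.
  rewrite [RHS]integral_mkcond; apply: eq_integral => y _.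
  rewrite patchE; case: ifPn => //; rewrite notin_setE => /off[h1 h2].
  by rewrite /g h1 h2 /dot !mulr0 !addr0 normr0.
have M10 : 0 <= M1 := le_trans (normr_ge0 _) (hM1 0).
have mF i : measurable_fun D (fun y => `|coord i (fld t y)|%:E).
  have iF := integrable_norm _ _ _ _ _ measurableT _
    (integrable_field N (r t) (fun a => x a t) B hB i).
  exact: measurable_funTS (measurable_int (r t) iF).
apply: (@le_trans _ _ (\int[r t]_(y in D) (M1%:E +
    M2%:E * (`|coord ord0 (fld t y)|%:E + `|coord ord_max (fld t y)|%:E)))%E).
  apply: ge0_le_integral => //.
  - have mV := measurable_int (r t) iV; apply/measurable_EFinP.
    by apply: measurableT_comp => //; apply/measurable_EFinP; exact: measurable_funTS.
  - apply: emeasurable_funD => //; apply: measurable_funeM.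
    exact: emeasurable_funD.
  move=> y _; rewrite -(EFinD `|coord ord0 _|) -EFinM -EFinD lee_fin /g dot_perp.
  rewrite (le_trans (ler_normD _ _))// lerD// (le_trans (ler_normB _ _))//.
  by rewrite !normrM mulrDr lerD// mulrC ler_wpM2r.
rewrite ge0_integralD//; last 2 first.
- by move=> y _; rewrite mule_ge0// adde_ge0.
- by apply: measurable_funeM; exact: emeasurable_funD.
rewrite integral_cst// EFinD; apply: leeD.
  by rewrite EFinM lee_wpmul2l// hbox.
rewrite ge0_integralZl_EFin//; [|by move=> y _; rewrite adde_ge0|exact: emeasurable_funD].
rewrite EFinM lee_wpmul2l// ge0_integralD// mulr_natl mulr2n EFinD.
have e20 : 0 < e / 2 by rewrite divr_gt0.
have hl i := controlled_local_field _ _ _ _ _ _ (fun b => x b t) theta01 A0 ht i a (e / 2) m e20.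
have sp b : b != a -> e / 2 + 2^-1 ^+ m <= sup_norm (x a t - x b t).
  move=> ba; have /(le_trans _) : e <= sup_norm (x a t - x b t).
    by rewrite sep_x// eq_sym.
  by apply; lra.
by apply: leeD; exact: (hl _ sp).
Qed.

Variables tau T : R.
Hypothesis tauT : 0 < tau < T.
Hypothesis Phi0 : forall t y, t < tau -> Phi (t, y) = 0.
Hypothesis PhiT : forall y, Phi (T, y) = 0.

Let T0 : 0 < T. Proof. by case/andP: tauT; exact: lt_trans. Qed.

Let rT t : t \in (`[0, T]%classic : set R) -> 0 <= t <= T.
Proof. by rewrite inE/= in_itv. Qed.

(** The integrand is the derivative of Phi along the trajectory. This is where the C^1 regularity of
    the trajectories enters. *)
Let velocity_integral_eq0 a :
  \int[leb]_(s in `[0, T]) (J1 a s + dot (v a s) (gradP s (x a s))) = 0.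
Proof.
pose h s := Phi (s, xi a s).
pose dh s := dtP s (xi a s) + dot (w a s) (gradP s (xi a s)).
rewrite (_ : Rintegral _ _ _ = \int[leb]_(s in `[0, T]) dh s); last first.
  by apply: eq_Rintegral => s /rT/andP[s0 _]; rewrite /J1 !halfline_extensionE.
have dPhi z : differentiable Phi z by have [sP _ _] := tPhi; exact: (sP [::]).
apply: (integral_derive_eq0 h _ tau) => //.
- by move=> t t0; apply: is_derive_along_curve => //; exact: dxi.
- move=> t t0; rewrite /dh.
  have cxt : {for t, continuous (fun s => (s, xi a s))}.
    exact: (cvg_pair (@cvg_id _ _) (continuous_halfline_continuous _ _ (cxi a) t0)).
  have cwt := continuous_halfline_continuous _ _ (cw a) t0.
  have cD u : {for t, continuous (fun s => 'D_u Phi (s, xi a s))}.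
    exact: (continuous_comp cxt (cderive u _)).
  have cG i : {for t, continuous (fun s => coord i (gradP s (xi a s)))}.
    have gE : (fun s => coord i (gradP s (xi a s))) = (fun s => 'D_(0, basis i) Phi (s, xi a s)).
      by apply/funext => s; rewrite gradPE.
    by rewrite gE; exact: cD.
  apply: cvgD; first exact: cD.
  have cW i : {for t, continuous (fun s => coord i (w a s))}.
    rewrite /coord; case: (i == ord0).
      exact: (continuous_comp cwt (@cvg_fst _ _ _ _ _)).
    exact: (continuous_comp cwt (@cvg_snd _ _ _ _ _)).
  exact: (cvgD (cvgM (cW ord0) (cG ord0)) (cvgM (cW ord_max) (cG ord_max))).
- move=> t tt; split; first exact: Phi0.
  have z u : 'D_u Phi (t, xi a t) = 0.
    rewrite (@near_eq_derive _ _ _ _ (cst 0)) ?derive_cst//.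
    have : \forall z \near (t, xi a t), z.1 < tau.
      exact: (cvg_fst (lt_nbhsl tt)).
    by apply: filterS => -[s y]/= /Phi0.
  by rewrite /dh z dot_coord !gradPE !z !mulr0 !addr0.
- exact: PhiT.
Qed.

(** Symmetrization yields, for each point, d_t Phi plus the field velocity times grad Phi.
    Subtracting the derivative of Phi along the trajectory, whose integral is 0, leaves the slip
    times grad Phi. *)
Lemma weak_identity : \int[leb]_(t in `[0, T]) time_flux t +
  \sum_a \int[leb]_(s in `[0, T]) dot (slip a s) (gradP s (x a s)) = 0.
Proof.
have mT : measurable (`[0, T]%classic : set (measurableTypeR R)) by exact: measurable_itv.
have [c c0 hc] := derive_bound.
have [C [A [B [A0 hctrl]]]] := ctrl_r _ T0.
have iI1 : leb.-integrable `[0, T] (fun t => (I1 t)%:E).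
  apply: (integrable_ae_bounded _ _ (c * C) mI1).
  apply: (ae_impl _ _ _ _ _ _ _ hctrl) => t ht /ht{}ht.
  by apply: I1_bound ht => // y; have [] := hc t y.
have iI2 : leb.-integrable `[0, T] (fun t => (I2 t)%:E).
  apply: (integrable_ae_bounded _ _ (c * (2 * (B * C + N%:R * B))) mI2).
  apply: (ae_impl _ _ _ _ _ _ _ hctrl) => t ht /ht{}ht.
  by apply: I2_bound ht => // i y; have [_] := hc t y.
have iJ1 a : leb.-integrable `[0, T] (fun t => (J1 a t)%:E).
  apply: (integrable_ae_bounded _ _ c (mJ1 a)).
  by apply: aeW => t _; have [] := hc t (x a t).
have iJ2 a : leb.-integrable `[0, T] (fun t => (J2 a t)%:E).
  apply: (integrable_ae_bounded _ _ (2 * (c * (B + N%:R / e))) (mJ2 a)).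
  apply: (ae_impl _ _ _ _ _ _ _ hctrl) => t ht /ht{}ht.
  have hF i := controlled_field_point _ _ _ _ _ _ (fun b => x b t) ht i a e e0.
  have sp b : b != a -> e <= sup_norm (x a t - x b t).
    by move=> ba; rewrite sep_x// eq_sym.
  have [_ hG] := hc t (x a t).
  rewrite /J2 dot_perp (le_trans (ler_normB _ _))// mulr_natl mulr2n.
  by rewrite lerD// normrM mulrC ler_pM//; exact: hF.
have good : {ae leb, forall t, 0 <= t <= T -> \int[finite_add (rho t) (sum_dirac (xi^~ t))]_y dtP t y = I1 t + \sum_a J1 a t /\
   H_form (fun y => Phi (t, y)) (finite_add (rho t) (sum_dirac (xi^~ t))) (finite_add (rho t) (sum_dirac (xi^~ t))) = I2 t + \sum_a J2 a t}.
  apply: (ae_impl _ _ _ _ _ _ _ hctrl) => t ht /[dup] tT /ht{}ht.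
  have [t0 _] := andP tT.
  have [i1 i2] := slice_integrable _ _ _ _ ht.
  have rE : r t = rho t by exact: halfline_extensionE.
  have xE : (fun a => x a t) = (xi^~ t) by apply/funext => a; exact: halfline_extensionE.
  have [_ _ hB] := ht; split.
    by rewrite -rE -xE; exact: (Rintegral_total N (r t) (fun a => x a t) _ i1).
  rewrite -rE -xE.
  exact: (H_form_total N (r t) (fun a => x a t) B hB (fun y => Phi (t, y)) c
    (fun i => mgradP_t i t) (fun i y => (hc t y).2 i)).
have [sJ1 eJ1] := Rintegral_real_sum _ _ leb `[0, T]%classic _ (index_enum 'I_N) J1 mT iJ1.
have [sJ2 eJ2] := Rintegral_real_sum _ _ leb `[0, T]%classic _ (index_enum 'I_N) J2 mT iJ2.
have [_ _ _ /(_ Phi tPhi T (ltW T0))] := weak.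
have z0 (m : {finite_measure set (mplane R) -> \bar R}) (g : mplane R -> R) :
    (forall y, g y = 0) -> \int[m]_y g y = 0.
  by move=> g0; under eq_Rintegral do rewrite g0; rewrite Rintegral_cst// mul0r.
(* Both boundary terms vanish: time 0 lies before tau, and Phi is 0 at time T. *)
rewrite /= !z0 => [|y|y]; [|by rewrite Phi0//; case/andP: tauT|exact: PhiT].
rewrite subr0.
have -> : \int[leb]_(s in `[0, T]) hessian_integral (fun y => Phi (s, y)) (nu s) = 0.
  rewrite (Rintegral_ae_eq _ _ _ leb _ _ (cst 0)); first by rewrite Rintegral_cst// mul0r.
  apply: (ae_impl _ _ _ _ _ _ _ nu0) => t ht; rewrite /= in_itv/= => /andP[t0 _].
  rewrite /hessian_integral big1// => i _; rewrite big1// => j _.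
  by rewrite charge_integral_null// => E mE; exact: ht.
rewrite (Rintegral_ae_eq _ _ _ leb _ _ (fun s => I1 s + \sum_a J1 a s)); last first.
  apply: (ae_impl _ _ _ _ _ _ _ good) => t ht; rewrite /= in_itv/= => /ht{ht}.
  by case.
rewrite (Rintegral_ae_eq _ _ _ leb _ (fun s => H_form _ _ _)
  (fun s => I2 s + \sum_a J2 a s)); last first.
  apply: (ae_impl _ _ _ _ _ _ _ good) => t ht; rewrite /= in_itv/= => /ht{ht}.
  by case.
rewrite (RintegralD mT iI1 sJ1) (RintegralD mT iI2 sJ2).
rewrite eJ1 eJ2 addr0 => h0.
have eflux : \int[leb]_(t in `[0, T]) time_flux t =
    \int[leb]_(t in `[0, T]) I1 t + \int[leb]_(t in `[0, T]) I2 t.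
  rewrite -(RintegralD mT iI1 iI2); apply: Rintegral_ae_eq.
  apply: (ae_impl _ _ _ _ _ _ _ hctrl) => t ht; rewrite /= in_itv/= => /ht{}ht.
  have [i1 i2] := slice_integrable _ _ _ _ ht.
  exact: (RintegralD measurableT i1 i2).
have eslip a : \int[leb]_(s in `[0, T]) dot (slip a s) (gradP s (x a s)) =
    \int[leb]_(s in `[0, T]) J1 a s + \int[leb]_(s in `[0, T]) J2 a s.
  have iJ := integrable_realD _ _ _ leb _ mT _ _ (iJ1 a) (iJ2 a).
  have iV : leb.-integrable `[0, T]
      (fun s => (J1 a s + dot (v a s) (gradP s (x a s)))%:E).
    have [D hD] := continuous_halfline_bounded _ T (cw a).
    have mG i := measurableT_comp (mgradP i) (mpair a).
    have mV i : measurable_fun setT (fun s => coord i (v a s)).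
      have [m1 m2] := (measurable_fun_pairP _).1 (measurable_v a).
      by rewrite /coord; case: (i == ord0).
    apply: (integrable_realD _ _ _ leb _ mT _ _ (iJ1 a)).
    apply: (integrable_ae_bounded _ _ (D * c + D * c)).
      have := measurable_funD (measurable_funM (mV ord0) (mG ord0))
        (measurable_funM (mV ord_max) (mG ord_max)).
      exact.
    apply: aeW => s sT; have [_ hG] := hc s (x a s).
    have hv i : `|coord i (v a s)| <= D.
      by rewrite halfline_extensionE; [exact: hD|case/andP: sT].
    by rewrite dot_coord (le_trans (ler_normD _ _))// lerD// normrM ler_pM.
  rewrite -(RintegralD mT (iJ1 a) (iJ2 a)).
  have := RintegralB mT iJ iV; rewrite velocity_integral_eq0 subr0 => <-.
  apply: eq_Rintegral => s _; rewrite /J2 /slip /dot /=; ring.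
rewrite eflux (eq_bigr _ (fun a _ => eslip a)) big_split/= addrACA.
exact: esym h0.
Qed.

End test.

(* Tests the weak identity with [localized l d t0 (xi a t0) i], [d = 2^-1 ^+ m / 4]: with [l]
   small the point stays in the region where the gradient is [basis i] times a bump in time. *)
Lemma slip_estimate (a : 'I_N) (i : 'I_2) (t0 T : R) : 0 < t0 < T ->
  exists l K M d0 : R, [/\ 0 < l, 0 <= M, 0 < d0 & forall m, 2^-1 ^+ m < d0 ->
    let s := l * (2^-1 ^+ m / 4) in
    forall eta, (\int[leb]_(y in ball t0 (3 * s))
        `|coord i (slip a y) - coord i (slip a t0)|%:E <= eta%:E)%E ->
      s * `|coord i (slip a t0)| <= M * eta + s * (K * theta ^+ m)].
Proof.
move=> /andP[t00 t0T].
have T0 : 0 < T := lt_trans t00 t0T.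
have [M M0 hM] := @localized_bounded R.
have [C [A [B [A0 hctrl]]]] := ctrl_r _ T0.
have [S hS] := slip_bounded _ T0.
have [L L0 [del del0 hL]] := is_derive_lipschitz _ _ _ (dxi a t0 t00).
set g := fun t => coord i (slip a t).
have th0 : 0 < theta by case/andP: theta01.
(* During a time 2 l d the point then moves by at most 2 L l d = d/2. *)
pose l := (4 * L)^-1.
have l0 : 0 < l by rewrite invr_gt0 mulr_gt0.
(* The bound of [time_flux_le] with M1 = M / l and M2 = M, once theta^m is factored out. The
   absolute value is there because the sign of B is known only through a controlled time slice. *)
pose K0 := M / l * A + M * (2 * ((`|B| + N%:R / (e / 2)) * A + A * (1 + (1 - theta)^-1))).
(* The 3 is that of [average_estimate]. Since l 2^-m = 4 s, the second bound says that 4 s is below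
   del, t0 and T - t0: times within 3 s of t0 stay in [0, T] and in the range of the Lipschitz
   bound. *)
exists l, (3 * K0), M, (Num.min (e / 2) (Num.min del (Num.min t0 (T - t0)) / l)).
have th1 : 0 <= (1 - theta)^-1 by rewrite invr_ge0 subr_ge0 ltW//; case/andP: theta01.
have K00 : 0 <= K0.
  have c1 : 0 <= M / l by rewrite divr_ge0// ltW.
  have c2 : 0 <= `|B| + N%:R / (e / 2) by rewrite addr_ge0// divr_ge0// divr_ge0// ltW.
  have c3 : 0 <= 1 + (1 - theta)^-1 by rewrite addr_ge0.
  apply: addr_ge0; first exact: mulr_ge0.
  apply: mulr_ge0; first exact: ltW.
  by apply: mulr_ge0 => //; apply: addr_ge0; exact: mulr_ge0.
split => //; [exact: ltW|by rewrite !lt_min !divr_gt0// !lt_min del0 t00 subr_gt0|].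
move=> m; rewrite lt_min => /andP[me]; rewrite ltr_pdivlMr// !lt_min => /and3P[mdel mt0 mT] s.
(* The support reaches 2 d from z and the point strays by at most d/2, so the support stays in the
   box of half-side 4 d = 2^-m around the moving point. *)
set d := 2^-1 ^+ m / 4 in s *.
have dE : 2^-1 ^+ m = 4 * d by rewrite /d mulrC divfK.
have d0 : 0 < d by rewrite divr_gt0// exprn_gt0.
have s0 : 0 < s by rewrite mulr_gt0.
have sE : s * L = d / 4 by rewrite /s /l; field; rewrite gt_eqF.
have {}mdel : 4 * s < del by rewrite /s mulrCA -dE mulrC.
have {}mt0 : 4 * s < t0 by rewrite /s mulrCA -dE mulrC.
have {}mT : 4 * s < T - t0 by rewrite /s mulrCA -dE mulrC.
move=> eta heta; pose z := xi a t0.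
have near_z t : `|t - t0| <= 2 * s -> sup_norm (x a t - z) <= d / 2.
  move=> tt; have tt' := tt; move: tt'; rewrite ler_norml => /andP[t1 t2].
  rewrite halfline_extensionE; last by lra.
  apply: (le_trans (hL _ _)); first by lra.
  by rewrite (le_trans (ler_wpM2l (ltW L0) tt))//; lra.
pose Phi := localized l d t0 z i.
have tPhi : test_function setT Phi by exact: localized_test_function.
have off t y : 2 * s < `|t - t0| \/ 2 * d < sup_norm (y - z) ->
  [/\ Phi (t, y) = 0, 'D_(1, 0) Phi (t, y) = 0 & grad (fun y => Phi (t, y)) y = 0].
  exact: localized_off_support.
pose bm t := bump ((t - t0) / s).
(* Read off from the gradient bound at the centre z, where the gradient is the bump times a basis
   vector. *)
have bmM t : `|bm t| <= M.
  have [_ /(_ i)] := hM l d t0 z i t z l0 d0.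
  rewrite localized_grad_near//; last by rewrite subrr /sup_norm normr0 maxxx.
  by rewrite /basis /coord; case: (i == ord0); rewrite /= /GRing.scale/= mulr1.
have bm_off t : 2 * s < `|t - t0| -> bm t = 0.
  move=> tt; rewrite /bm bump0// normrM normfV (gtr0_norm s0) ler_pdivlMr//.
  exact: ltW.
have force t : dot (slip a t) (grad (fun y => Phi (t, y)) (x a t)) = bm t * g t.
  have [tt|tt] := ltP (2 * s) `|t - t0|.
    have [_ _ ->] := off t (x a t) (or_introl tt).
    by rewrite bm_off// /dot !mulr0 addr0 mul0r.
  rewrite localized_grad_near//; last by rewrite (le_lt_trans (near_z t tt))//; lra.
  rewrite /g /dot /coord /basis /bm; case: (i == ord0) => /=; rewrite /GRing.scale/=; ring.
have noforce b t : b != a -> dot (slip b t) (grad (fun y => Phi (t, y)) (x b t)) = 0.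
  move=> ba; suff [_ _ ->] : [/\ Phi (t, x b t) = 0, 'D_(1, 0) Phi (t, x b t) = 0 &
      grad (fun y => Phi (t, y)) (x b t) = 0] by rewrite /dot !mulr0 addr0.
  apply: off; have [tt|tt] := ltP (2 * s) `|t - t0|; [by left|right].
  have h1 := sep_x t _ _ ba; have h2 := near_z t tt.
  have := sup_normD (x b t - z) (z - x a t).
  (* The other point is at distance at least e - d/2 from z, beyond the support radius 2 d since e >
     8 d. *)
  rewrite addrA subrK -(sup_normN (z - x a t)) opprB; lra.
pose D : set R := ball t0 (3 * s).
have mD : measurable (D : set (measurableTypeR R)) := measurable_ball _ _.
(* Radius 3 s exceeds the time support 2 s strictly, so the test function and its derivatives vanish
   at both ends and outside [D]. *)
pose T' := t0 + 3 * s.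
have far t : ~ D t -> 2 * s < `|t - t0|.
  by rewrite /D /ball/= => /negP; rewrite -leNgt distrC; lra.
have D_T' t : D t -> t \in `[0, T'].
  by rewrite /D /ball/= ltr_norml in_itv/= /T' => /andP[h1 h2]; apply/andP; split; lra.
have to_D h : (forall t, 2 * s < `|t - t0| -> h t = 0) ->
    \int[leb]_(t in `[0, T']) h t = \int[leb]_(t in D) h t.
  move=> h0; apply: Rintegral_eq_domain => [t _ /far/h0//|t /D_T' h1 h2].
  by exfalso; apply: h2.
have flux_off t : 2 * s < `|t - t0| -> time_flux Phi t = 0.
  move=> tt; rewrite /time_flux.
  have h y : 'D_(1, 0) Phi (t, y) +
      dot (perp (fld t y)) (grad (fun y => Phi (t, y)) y) = 0.
    have [_ -> ->] := off t y (or_introl tt).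
    by rewrite /dot !mulr0 !addr0.
  by under eq_Rintegral do rewrite h; rewrite Rintegral_cst// mul0r.
have flux_le : {ae leb, forall t, 0 <= t <= T -> `|time_flux Phi t| <= K0 * theta ^+ m}.
  apply: (ae_impl _ _ _ _ _ _ _ hctrl) => t ht /ht{}ht.
  have [tt|tt] := ltP (2 * s) `|t - t0|.
    by rewrite flux_off// normr0 mulr_ge0// exprn_ge0// ltW.
  have B0 : 0 <= B by have [_ _ hB] := ht; exact: B_ge0 hB.
  have offb y : ~ box (x a t) (2^-1 ^+ m) y ->
      'D_(1, 0) Phi (t, y) = 0 /\ grad (fun y => Phi (t, y)) y = 0.
    rewrite /box/= => /negP; rewrite -leNgt dE => hy.
    suff [] : [/\ Phi (t, y) = 0, 'D_(1, 0) Phi (t, y) = 0 &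
      grad (fun y => Phi (t, y)) y = 0] by [].
    apply: off; right; have h2 := near_z t tt.
    have := sup_normD (x a t - z) (z - y).
    rewrite addrA subrK -(sup_normN (z - y)) opprB; lra.
  have := time_flux_le Phi tPhi C A B t a m (M / l) M A0 (ltW me) ht offb (ltW M0)
    (fun y => (hM l d t0 z i t y l0 d0).1)
    (fun j y => (hM l d t0 z i t y l0 d0).2 j).
  move=> /le_trans; apply.
  (* Box masses decay faster than the field integrals; the slower rate theta^m is used for both. *)
  have pm : (theta / 2) ^+ m <= theta ^+ m by rewrite lerXn2r ?nnegrE ?divr_ge0 ?(ltW th0)// ler_pdivrMr// ler_peMr ?ler1n ?ltW.
  have p0 : 0 <= (theta / 2) ^+ m by rewrite exprn_ge0// divr_ge0// ltW.
  have q0 : 0 <= N%:R / (e / 2) by rewrite divr_ge0// divr_ge0// ltW.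
  have Ml0 : 0 <= M / l by rewrite divr_ge0// ltW.
  have h1 : A * (theta / 2) ^+ m <= A * theta ^+ m by rewrite ler_wpM2l.
  have h2 : (B + N%:R / (e / 2)) * (A * (theta / 2) ^+ m) <=
      (`|B| + N%:R / (e / 2)) * (A * theta ^+ m).
    by rewrite ler_pM ?mulr_ge0 ?addr_ge0// lerD2r ler_norm.
  rewrite /K0; set Y := (`|B| + _) * A + _; set X := (B + _) * _ + _.
  have h3 : X <= Y * theta ^+ m.
    by rewrite /X /Y [leRHS]mulrDl lerD//; [rewrite -mulrA|rewrite mulrAC].
  have -> : (M / l * A + M * (2 * Y)) * theta ^+ m =
    M / l * (A * theta ^+ m) + M * (2 * (Y * theta ^+ m)) by ring.
  by rewrite lerD ?ler_wpM2l// ltW.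
have [S0 S00 hS0] : exists2 S0 : R, 0 <= S0 &
    {ae leb, forall t, 0 <= t <= T -> `|g t| <= S0}.
  exists `|S| => //; apply: (ae_impl _ _ _ _ _ _ _ hS) => t ht /ht/(_ i a).
  by move=> h; rewrite (le_trans h)// ler_norm.
have s3 : 0 < 3 * s by rewrite mulr_gt0.
have s3t : 3 * s <= t0 by lra.
have s3T : t0 + 3 * s <= T by lra.
have [ig _] := Rintegral_ball_le _ _ _ _ _ (measurable_slip i a) S00 hS0 s3 s3t s3T.
have K0m : 0 <= K0 * theta ^+ m by rewrite mulr_ge0// exprn_ge0// ltW.
have [_ hflux] := Rintegral_ball_le _ _ _ _ _ (measurable_time_flux Phi tPhi) K0m
  flux_le s3 s3t s3T.
have mbm : measurable_fun setT bm.
  have cb : continuous (bump : R -> R).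
    move=> t; apply: differentiable_continuous; apply/derivable1_diffP.
    exact: (derivable_cut_off false).
  apply: (measurableT_comp (f := bump)).
    exact: continuous_measurable_fun.
  by apply: measurable_funM => //; exact: measurable_funB.
have W := weak_identity Phi tPhi (t0 - 3 * s) T'.
have {}W : \int[leb]_(t in D) time_flux Phi t + \int[leb]_(t in D) (bm t * g t) = 0.
  rewrite -(to_D _ flux_off) -(to_D (fun t => bm t * g t)); last first.
    by move=> t /bm_off ->; rewrite mul0r.
  rewrite -[RHS]W /T'; [|by apply/andP; split; lra|move=> t y ht|move=> y].
  - congr (_ + _); rewrite (bigD1 a)//= big1 ?addr0.
      by apply: eq_Rintegral => t _; rewrite force.
    move=> b ba; under eq_Rintegral do rewrite noforce//.
    by rewrite Rintegral_cst// mul0r.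
  - have [] // := off t y; left.
    by rewrite distrC ger0_norm; lra.
  - by have [] // := off (t0 + 3 * s) y; left; rewrite addrAC subrr add0r gtr0_norm//; lra.
have bm0 t : 0 <= bm t by exact: bump_ge0.
have bm1 t : ball t0 s t -> bm t = 1.
  rewrite /ball/= => tt; rewrite /bm bump1// normrM normfV (gtr0_norm s0).
  by rewrite ler_pdivrMr// mul1r distrC ltW.
have := average_estimate _ _ _ _ _ _ _ _ s0 mbm bm0 bmM bm1 ig hflux heta W.
by rewrite -[3 * K0 * _]mulrA.
Qed.

(** Dividing [slip_estimate] by s at a Lebesgue point bounds the slip by a multiple of an arbitrary
    eta plus a multiple of theta^m. The integer horizons n + 1 are countably many, so the
    exceptional sets add up to a null set. *)
Lemma slip_ae_eq0 : {ae leb, forall t, 0 < t -> forall a, slip a t = 0}.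
Proof.
suff h i a n : {ae leb, forall t, 0 < t < n.+1%:R -> coord i (slip a t) = 0}.
  have ha i a : {ae leb, forall t, 0 < t -> coord i (slip a t) = 0}.
    apply: (ae_impl _ _ _ _ _ _ _ (ae_foralln (h i a))) => t ht t0.
    apply: (ht (Num.bound t)); rewrite t0/= (lt_le_trans (archi_boundP (ltW t0)))//.
    by rewrite ler_nat.
  have FF := ae_filter_ringOfSetsType leb.
  have hh := filter_forall FF (fun a => filter_forall FF (fun i => ha i a)).
  apply: (ae_impl _ _ _ _ _ _ _ hh) => t ht t0 a.
  have h1 : (slip a t).1 = 0 := ht a ord0 t0.
  have h2 : (slip a t).2 = 0 := ht a ord_max t0.
  by rewrite [LHS]surjective_pairing h1 h2.
have T0 : 0 < n.+1%:R :> R by rewrite ltr0n.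
have [S hS] := slip_bounded _ T0.
have hS' : {ae leb, forall t, 0 <= t <= n.+1%:R -> `|coord i (slip a t)| <= S}.
  by apply: (ae_impl _ _ _ _ _ _ _ hS) => t ht /ht.
have avg := small_averages _ _ _ (measurable_slip i a) hS'.
apply: (ae_impl _ _ _ _ _ _ _ avg) => t0 ht0 /[dup] t0T /ht0{}ht0.
have [l [K [M [d0 [l0 M0 d00 est]]]]] := slip_estimate a i _ _ t0T.
apply/eqP; rewrite -normr_eq0 eq_le normr_ge0 andbT; apply/ler_addgt0Pl => eps eps0.
(* The oscillation is measured on a ball of radius 3 s, so it enters as 3 M eta, which this choice
   makes at most eps/2; M + 1 avoids dividing by M = 0. *)
rewrite addr0; pose eta := eps / (6 * (M + 1)).
have M1 : 0 < M + 1 by rewrite ltr_wpDl.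
have eta0 : 0 < eta by rewrite divr_gt0// mulr_gt0.
have [d dgt0 hd] := ht0 _ eta0.
have half0 : (2^-1 ^+ k : R) @[k --> \oo] --> 0.
  by apply: cvg_expr; rewrite ger0_norm ?invr_ge0// invf_lt1// ltr1n.
have theta0 : (`|K| * theta ^+ k : R) @[k --> \oo] --> 0.
  rewrite -[X in _ --> X](mulr0 `|K|); apply: cvgMl_tmp; apply: cvg_expr.
  by case/andP: theta01 => h0 h1; rewrite gtr0_norm.
have sml (u : R^nat) (c : R) : u @ \oo --> 0 -> 0 < c -> \forall k \near \oo, u k < c.
  by move=> u0 c0; exact: (u0 _ (lt_nbhsl c0)).
have e2 : 0 < eps / 2 by rewrite divr_gt0.
have dl : 0 < d / l by rewrite divr_gt0.
near \oo => m.
have hm0 : 2^-1 ^+ m < d0 by near: m; exact: sml half0 d00.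
have hmd : 2^-1 ^+ m < d / l by near: m; exact: sml half0 dl.
have hmK : `|K| * theta ^+ m < eps / 2 by near: m; exact: sml theta0 e2.
have p0 : 0 < 2^-1 ^+ m :> R by rewrite exprn_gt0.
have {}est := est m hm0.
set s := l * (2^-1 ^+ m / 4) in est.
have s0 : 0 < s by rewrite mulr_gt0// divr_gt0.
have s3 : 0 < 3 * s < d.
  rewrite mulr_gt0//=; move: hmd; rewrite ltr_pdivlMr// => hmd.
  by move: s0; rewrite /s; lra.
have h := est _ (hd _ s3).
have : s * `|coord i (slip a t0)| <= s * (3 * M * eta + `|K| * theta ^+ m).
  apply: (le_trans h); rewrite mulrDr; apply: lerD; first by rewrite (_ : M * _ = s * (3 * M * eta))//; ring.
  apply: ler_wpM2l; first exact: ltW.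
  apply: ler_wpM2r; last exact: ler_norm.
  by rewrite exprn_ge0// ltW//; case/andP: theta01.
rewrite ler_pM2l// => /le_trans; apply.
have : 3 * M * eta <= eps / 2.
  have -> : 3 * M * eta = M / (M + 1) * (eps / 2) by rewrite /eta; field; rewrite gt_eqF.
  by apply: ler_piMl; [exact: ltW|rewrite ler_pdivrMr// mul1r lerDl].
by move: hmK; lra.
Unshelve. all: by end_near. Qed.

(** * The clauses of the vortex-wave system *)

Lemma vw_velocityE t y : 0 <= t -> vw_velocity rho xi t y = perp (fld t y).
Proof.
move=> t0; rewrite /vw_velocity /field halfline_extensionE//.
by congr (perp (_ + Ffield _ _)); apply/funext => a; rewrite halfline_extensionE.
Qed.

(** The rotation [perp] exchanges the coordinates up to sign, so bounds on the field pass to the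
    velocity with exchanged indices. *)
Let swap (i : 'I_2) : 'I_2 := if i == ord0 then ord_max else ord0.

Let norm_coord_perp i (y : plane R) : `|coord i (perp y)| = `|coord (swap i) y|.
Proof. by rewrite /swap /coord /perp; case: (i == ord0); rewrite /= ?normrN. Qed.

Lemma ae_controlled : {ae leb, forall t, 0 <= t ->
  exists C A B : R, controlled theta C A B (r t)}.
Proof.
have h n : {ae leb, forall t, 0 <= t <= n.+1%:R ->
    exists C A B : R, controlled theta C A B (r t)}.
  have [C [A [B [_ h]]]] := ctrl_r n.+1%:R (ltr0Sn _ _).
  by apply: (ae_impl _ _ _ _ _ _ _ h) => t ht /ht; exists C, A, B.
apply: (ae_impl _ _ _ _ _ _ _ (ae_foralln h)) => t ht t0.
apply: (ht (Num.bound t)); rewrite t0/= ltW// (lt_le_trans (archi_boundP t0))//.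
by rewrite ler_nat.
Qed.

Lemma weak_vw_well_defined : vw_well_defined rho xi.
Proof.
have vE t y i : 0 <= t -> `|coord i (vw_velocity rho xi t y)| = `|coord (swap i) (fld t y)|.
  by move=> t0; rewrite vw_velocityE// norm_coord_perp.
split.
- apply: (ae_impl _ _ _ _ _ _ _ ae_controlled) => t ht /[dup] t0 /ht[C [A [B [_ _ hB]]]] y i.
  have := integrable_K (r t) B hB i y; by rewrite halfline_extensionE.
- apply: (ae_impl _ _ _ _ _ _ _ ae_controlled) => t ht /[dup] t0 /ht[C [A [B [_ _ hB]]]] i.
  have iF j := integrable_field N (r t) (fun a => x a t) B hB j.
  rewrite -(halfline_extensionE rho)//.
  under eq_fun do rewrite vw_velocityE//.
  rewrite /coord /perp; case: (i == ord0) => /=; last exact: (iF ord0).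
  under eq_fun do rewrite -mulN1r.
  exact: (integrable_realZl _ _ _ (r t) _ measurableT _ _ (iF ord_max)).
- move=> T i T0; have [C [A [B [A0 h]]]] := ctrl_r _ T0.
  have mT : measurable (`[0, T]%classic : set (measurableTypeR R)) by exact: measurable_itv.
  have mI := measurable_integral_abs_field _ r (fun a => x a) measurable_r measurable_x (swap i).
  have h0 t : (0 <= \int[r t]_y `|coord (swap i) (fld t y)|%:E)%E.
    by apply: integral_ge0 => y _; rewrite lee_fin.
  apply: (eq_integrable mT (fun t => \int[r t]_y `|coord (swap i) (fld t y)|%:E)%E).
    move=> t; rewrite inE/= in_itv/= => /andP[t0 _].
    by rewrite halfline_extensionE//; apply: eq_integral => y _; rewrite vE.
  apply/integrableP; split; first exact: measurable_funTS.
  apply: (@le_lt_trans _ _ (\int[leb]_(t in `[0%R, T]) (Num.max 0 (B * C + N%:R * B))%:E)%E).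
    apply: ae_ge0_le_integral => //.
    + by apply: measurableT_comp => //; exact: measurable_funTS.
    + by move=> t _; rewrite lee_fin le_max lexx.
    apply: (ae_impl _ _ _ _ _ _ _ h) => t ht; rewrite /= in_itv/= => /ht{}ht.
    rewrite gee0_abs//.
    have := controlled_integral_field N theta C A B (r t) (fun a => x a t) ht (swap i).
    by move=> /le_trans; apply; rewrite lee_fin le_max lexx orbT.
  have mT' : (leb (`[0%R, T]%classic : set R) < +oo)%E.
    by rewrite lebesgue_measure_itv/=; case: ifPn => _; rewrite ?ltry// -EFinB ltry.
  by rewrite integral_cst// lte_mul_pinfty// lee_fin le_max lexx.
- move=> T a i T0; have [C [A [B [A0 h]]]] := ctrl_r _ T0.
  have mT : measurable (`[0, T]%classic : set (measurableTypeR R)) by exact: measurable_itv.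
  apply: (eq_integrable mT (fun t => (coord i (perp (fld t (x a t))))%:E)%E).
    move=> t; rewrite inE/= in_itv/= => /andP[t0 _].
    by rewrite vw_velocityE// halfline_extensionE.
  have mF j := measurable_field_point _ r (fun a => x a) measurable_r measurable_x j a.
  apply: (integrable_ae_bounded _ _ (B + N%:R / e)).
    rewrite /coord /perp; case: (i == ord0) => /=; last exact: (mF ord0).
    by apply: measurableT_comp => //; exact: (mF ord_max).
  apply: (ae_impl _ _ _ _ _ _ _ h) => t ht /ht{}ht; rewrite norm_coord_perp.
  have hF j := controlled_field_point _ _ _ _ _ _ (fun b => x b t) ht j a e e0.
  by apply: hF => b ba; rewrite sep_x// eq_sym.
Qed.

Lemma weak_transport (Phi : R * plane R -> R) :
  test_function [set z : R * plane R | 0 < z.1] Phi ->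
  \int[leb]_(t in `[0, +oo[) \int[rho t]_y
    ('D_(1, 0) Phi (t, y) +
     dot (vw_velocity rho xi t y) (grad (fun y' => Phi (t, y')) y)) = 0.
Proof.
move=> tP; have [sP cP supP] := tP.
have tPhi : test_function setT Phi by split.
have cfst : continuous (fst : R * plane R -> R) by move=> z; exact: cvg_fst.
have [tau tau0 htau] := compact_bounded_below _ _ cfst cP supP.
have [T0 T00 hT0] := compact_bounded_above _ _ cfst cP.
(* Strictly beyond the support in time, so that the test function vanishes at T. *)
pose T := Num.max tau T0 + 1.
have tauT : 0 < tau < T by rewrite tau0/= /T ltr_pwDr// le_max lexx.
have TT0 : T0 < T by rewrite /T ltr_pwDr// le_max lexx orbT.
have early t y u : t < tau -> Phi (t, y) = 0 /\ 'D_u Phi (t, y) = 0.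
  move=> tt; apply: (test_function_off_support _ _ _ _ tPhi) => /htau/=.
  by rewrite leNgt tt.
have late t y u : T0 < t -> Phi (t, y) = 0 /\ 'D_u Phi (t, y) = 0.
  move=> tt; apply: (test_function_off_support _ _ _ _ tPhi) => /hT0/=.
  by rewrite leNgt tt.
have W := weak_identity Phi tPhi tau T tauT (fun t y tt => (early t y 0 tt).1)
  (fun y => (late T y 0 TT0).1).
rewrite big1 ?addr0 in W; last first.
  move=> a _; rewrite (Rintegral_ae_eq _ _ _ leb _ _ (cst 0)).
    by rewrite Rintegral_cst// mul0r.
  apply: (ae_impl _ _ _ _ _ _ _ slip_ae_eq0) => t ht; rewrite /= in_itv/= => /andP[t0 _].
  (* The slip is known to vanish at positive times only; before tau, time 0 included, the gradient
     of the test function is 0. *)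
  have [tt|tt] := ltP t tau; last by rewrite ht ?(lt_le_trans tau0)// /dot !mul0r addr0.
  have gz u : 'D_u (fun y => Phi (t, y)) (x a t) = 0.
    by rewrite -derive_slicer; have [] := early t (x a t) (0, u) tt.
  by rewrite /dot /grad !gz !mulr0 addr0.
rewrite -[RHS]W; transitivity (\int[leb]_(t in `[0, T]) \int[rho t]_y
    ('D_(1, 0) Phi (t, y) +
     dot (vw_velocity rho xi t y) (grad (fun y' => Phi (t, y')) y))).
  apply: Rintegral_eq_domain => t /=; rewrite !in_itv/=; last first.
    by move=> /andP[t0 _] /negP; rewrite t0.
  rewrite andbT => t0 /negP; rewrite t0/= -ltNge => tT.
  have tt : T0 < t by exact: lt_trans tT.
  have z y : 'D_(1, 0) Phi (t, y) +
     dot (vw_velocity rho xi t y) (grad (fun y' => Phi (t, y')) y) = 0.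
    have [_ ->] := late t y (1, 0) tt.
    by rewrite /dot /grad -!derive_slicer !(late t y _ tt).2 !mulr0 !addr0.
  by under eq_Rintegral do rewrite z; rewrite Rintegral_cst// mul0r.
apply: eq_Rintegral => t; rewrite inE/= in_itv/= => /andP[t0 _].
rewrite /time_flux halfline_extensionE//; apply: eq_Rintegral => y _.
by rewrite vw_velocityE.
Qed.

(** Integration by parts against the classical derivative [w], which equals the vortex-wave velocity
    at almost every time because the slip is 0. *)
Lemma weak_point_motion (a : 'I_N) (i : 'I_2) (phi : R -> R) :
  test_function [set t : R | 0 < t] phi ->
  \int[leb]_(t in `[0, +oo[) (coord i (xi a t) * 'D_1 phi t) =
  - \int[leb]_(t in `[0, +oo[) (coord i (vw_velocity rho xi t (xi a t)) * phi t).
Proof.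
move=> tp; have [sp cp supp] := tp.
have tphi : test_function setT phi by split.
have cid' : continuous (fun t : R => t) by move=> t; exact: cvg_id.
have [tau tau0 htau] := compact_bounded_below _ _ cid' cp supp.
have [T0 T00 hT0] := compact_bounded_above _ _ cid' cp.
pose T := Num.max tau T0 + 1.
have tauT : 0 < tau < T by rewrite tau0/= /T ltr_pwDr// le_max lexx.
have TT0 : T0 < T by rewrite /T ltr_pwDr// le_max lexx orbT.
have early t : t < tau -> phi t = 0 /\ 'D_1 phi t = 0.
  move=> tt; apply: (test_function_off_support _ _ _ _ tphi) => /htau/=.
  by rewrite leNgt tt.
have late t : T0 < t -> phi t = 0 /\ 'D_1 phi t = 0.
  move=> tt; apply: (test_function_off_support _ _ _ _ tphi) => /hT0/=.
  by rewrite leNgt tt.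
have to_T (f : R -> R) : (forall t, T0 < t -> f t = 0) ->
    \int[leb]_(t in `[0, +oo[) f t = \int[leb]_(t in `[0, T]) f t.
  move=> f0; apply: Rintegral_eq_domain => t /=; rewrite !in_itv/=; last first.
    by move=> /andP[t0 _] /negP; rewrite t0.
  rewrite andbT => t0 /negP; rewrite t0/= -ltNge => tT.
  by apply: f0; exact: lt_trans tT.
rewrite !to_T; [|by move=> t /late[-> _]; rewrite mulr0|by move=> t /late[_ ->]; rewrite mulr0].
have mT : measurable (`[0, T]%classic : set (measurableTypeR R)) by exact: measurable_itv.
have dphi (t : R) : is_derive t (1 : R) phi ('D_1 phi t).
  by apply: DeriveDef => //; apply/derivable1_diffP; exact: (sp [::]).
have cphi : continuous phi by move=> t; exact/differentiable_continuous/(sp [::]).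
have cdphi : continuous ('D_1 phi) by move=> t; exact/differentiable_continuous/(sp [:: 1]).
have ccoord : continuous (coord i : plane R -> R).
  by move=> z; rewrite /coord; case: (i == ord0); [exact: cvg_fst|exact: cvg_snd].
pose dh t := coord i (w a t) * phi t + coord i (xi a t) * 'D_1 phi t.
have dh0 : \int[leb]_(t in `[0, T]) dh t = 0.
  apply: (integral_derive_eq0 (fun t => coord i (xi a t) * phi t) _ tau) => //.
  - move=> t t0; have H := is_deriveM (is_derive_coord i _ _ _ (dxi a t t0)) (dphi t).
    by apply: (is_derive_eq H); rewrite /dh addrC [phi t *: _]mulrC.
  - move=> t t0; apply: cvgD; apply: cvgM.
    + exact: (continuous_comp (continuous_halfline_continuous _ _ (cw a) t0) (ccoord _)).
    + exact: cphi.
    + exact: (continuous_comp (continuous_halfline_continuous _ _ (cxi a) t0) (ccoord _)).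
    + exact: cdphi.
  - by move=> t /early[h1 h2]; rewrite /dh h1 h2 !mulr0 addr0.
  - by rewrite (late T TT0).1 mulr0.
have iprod (u : R -> plane R) (f : R -> R) : {within `[0, +oo[, continuous u} -> continuous f ->
    leb.-integrable `[0, T] (fun t => (coord i (u t) * f t)%:E).
  move=> cu cf; apply: continuous_compact_integrable; first exact: segment_compact.
  have {}cu : {within `[0, T], continuous u}.
    by apply: continuous_subspaceW cu => t /=; rewrite !in_itv/= andbT => /andP[].
  have cf' : {within `[0, T], continuous f} by exact: continuous_subspaceT.
  move=> t; apply: cvgM; last exact: cf'.
  exact: (@continuous_comp (subspace (`[0, T]%classic : set R)) (R * R)%type R u (coord i) t (cu t) (ccoord _)).
move: dh0; rewrite (RintegralD mT (iprod _ _ (cw a) cphi) (iprod _ _ (cxi a) cdphi)).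
move/eqP; rewrite addrC addr_eq0 => /eqP ->; congr (- _).
apply: Rintegral_ae_eq; apply: (ae_impl _ _ _ _ _ _ _ slip_ae_eq0) => t ht.
rewrite /= in_itv/= => /andP[t0 _].
have [tt|tt] := ltP t tau; first by rewrite (early t tt).1 !mulr0.
have /eqP := ht (lt_le_trans tau0 tt) a.
by rewrite /slip subr_eq0 !halfline_extensionE// vw_velocityE// => /eqP ->.
Qed.

End weak_identity.

Lemma eucl_le_sup_norm {R : realType} (z : plane R) : eucl z <= 2 * sup_norm z.
Proof.
have s0 := sup_norm_ge0 z.
rewrite /eucl -[leRHS]ger0_norm ?mulr_ge0// -sqrtr_sqr ler_wsqrtr//.
have h1 : `|z.1| <= sup_norm z by rewrite /sup_norm le_max lexx.
have h2 : `|z.2| <= sup_norm z by rewrite /sup_norm le_max lexx orbT.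
have e1 : z.1 * z.1 <= sup_norm z ^+ 2 by rewrite -expr2 -real_normK ?num_real// lerXn2r ?nnegrE.
have e2 : z.2 * z.2 <= sup_norm z ^+ 2 by rewrite -expr2 -real_normK ?num_real// lerXn2r ?nnegrE.
by rewrite /dot exprMn; have := sqr_ge0 (sup_norm z); lra.
Qed.

Theorem proposition1p1 (R : realType) (N : nat) (hN : (1 < N)%N)
  (f0 : R -> phase R -> R) (xi0 eta0 : R -> 'I_N -> plane R)
  (f : R -> R -> phase R -> R) (xie etae : R -> 'I_N -> R -> plane R)
  (rho : R -> {finite_measure set (mplane R) -> \bar R})
  (xi : 'I_N -> R -> plane R)
  (nu : R -> matrix_charge (R := R)) (p : \bar R) :
  admissible_family f0 xi0 eta0 ->
  (forall eps : R, 0 < eps < 1 ->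
     global_weak_solution eps (f0 eps) (xi0 eps) (eta0 eps)
       (f eps) (xie eps) (etae eps)) ->
  accumulation_point f xie rho xi nu ->
  defect_vanishes nu ->
  (2%:E < p)%E ->
  Linf_loc_Lp p rho ->
  (forall a : 'I_N, C1_halfline (xi a)) ->
  vortex_wave_system rho xi.
Proof.
move=> _ _ [epsn [_ _ _ _ [_ _ [m m0 sepm] weak _]]] nu0 p2 rhop C1.
have [mrho _ _ _] := weak.
have [theta th01 ctrl] := Linf_loc_Lp_controlled p rho p2 mrho rhop.
have cxi a : {within `[0, +oo[, continuous (xi a)} by have [] := C1 a.
have hw a : exists w : R -> plane R, {within `[0, +oo[, continuous w} /\
    forall t : R, 0 < t -> is_derive t 1 (xi a) (w t).
  by have [_ [w cw dw]] := C1 a; exists w.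
pose w a := sval (cid (hw a)).
have cw a : {within `[0, +oo[, continuous (w a)} by have [] := svalP (cid (hw a)).
have dw a (t : R) : 0 < t -> is_derive t 1 (xi a) (w a t) by have [_] := svalP (cid (hw a)); apply.
(* The separation m is Euclidean; [eucl_le_sup_norm] turns it into m/2 in the sup norm. *)
have e0 : 0 < m / 2 by rewrite divr_gt0.
have sep (t : R) a b : 0 <= t -> a != b -> m / 2 <= sup_norm (xi a t - xi b t).
  move=> t0 ab; rewrite ler_pdivrMr// mulrC.
  exact: le_trans (sepm t a b t0 ab) (eucl_le_sup_norm _).
split.
- exact: (weak_vw_well_defined N rho xi theta (m / 2)).
- exact: (weak_transport N rho xi w nu theta (m / 2)).
- exact: (weak_point_motion N rho xi w nu theta (m / 2)).
Qed.
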